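(* Fix an integer $\ell \geq 2$. There is an algorithm that, given an instance $(G,k)$ of $\mathcal{L}_\ell$-Cluster Editing$(k)$, where $G$ has $n$ vertices and $m$ edges, runs in $O(n+m)$ time and outputs an equivalent instance $(G_k,k')$ with $k' \leq k$ (that is, $(G,k)$ is a yes-instance if and only if $(G_k,k')$ is a yes-instance) such that $G_k$ has $O(\ell k^2)$ vertices. In other words, $\mathcal{L}_\ell$-Cluster Editing$(k)$ admits a problem kernel with $O(\ell k^2)$ vertices computable in $O(n+m)$ time.
   Context: All graphs are finite, simple and undirected. A clique is a complete graph. For an integer $\ell \geq 2$, an $\ell$-clique is a connected complete $\ell$-partite graph (so a connected graph whose vertex set can be partitioned into at most $\ell$ independent sets with all edges present between different sets). Let $\mathcal{K}$ be the family of cliques, $\mathcal{K}_\ell$ the family of $\ell$-cliques, and $\mathcal{L}_\ell = \mathcal{K} \cup \mathcal{K}_\ell$. An $\mathcal{L}_\ell$-cluster graph is a graph each of whose connected components is a clique or an $\ell$-clique. An edition set $F$ for a graph $G$ is a set of unordered pairs of distinct vertices of $G$, no pair occurring twice, each marked either $-$ (the pair is an edge of $G$, to be deleted) or $+$ (the pair is a non-edge of $G$, to be added); $G+F$ denotes the graph obtained from $G$ by performing these deletions and additions, and $|F|$ is the number of edge editions. The problem $\mathcal{L}_\ell$-Cluster Editing$(k)$ (parameterized by $k$): given a graph $G$ and a nonnegative integer $k$, decide whether there is an edition set $F$ with $|F| \leq k$ such that $G+F$ is an $\mathcal{L}_\ell$-cluster graph. *)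

(* Defs.v *)
From mathcomp Require Import all_boot.

Set Implicit Arguments.
Unset Strict Implicit.
Unset Printing Implicit Defensive.

(** * Graphs and cluster editing *)

Record sgraph (T : finType) := SGraph {
  adj :> rel T;
  adj_sym : symmetric adj;
  adj_irr : irreflexive adj }.

Section Graphs.
Variable T : finType.
Implicit Types (G : sgraph T) (A : {set T}) (F : {set {set T} * bool}).

Definition edges G : {set {set T}} :=
  [set [set p.1; p.2] | p : T * T & G p.1 p.2].

Definition components G : {set {set T}} :=
  [set [set y | connect G x y] | x : T].

(* The predicates below speak about the subgraph of G induced by A. *)
Definition connected_in G A : Prop :=
  {in A &, forall x y,
     connect [rel u v | [&& u \in A, v \in A & G u v]] x y}.

Definition clique G A : Prop := {in A &, forall x y, x != y -> G x y}.

Definition independent G A : Prop := {in A &, forall x y, ~~ G x y}.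

Definition lclique (l : nat) G A : Prop :=
  connected_in G A /\
  exists P : {set {set T}},
    [/\ partition P A, #|P| <= l,
        forall B, B \in P -> independent G B &
        forall B B', B \in P -> B' \in P -> B != B' ->
          {in B & B', forall x y, G x y}].

Definition cluster_graph (l : nat) G : Prop :=
  forall A, A \in components G -> clique G A \/ lclique l G A.

(* The mark [true] stands for + (addition), [false] for - (deletion). *)
Definition edition_set G F : Prop :=
  {in F &, injective fst} /\
  forall A b, (A, b) \in F -> #|A| = 2 /\ (A \in edges G) = ~~ b.

(* For an edition set F the guard [x != y] is redundant; it makes [edit] total
   on arbitrary F. *)
Definition edit_rel G F : rel T := fun x y =>
  (x != y) &&
  ((([set x; y] \in edges G) && (([set x; y], false) \notin F))
   || (([set x; y], true) \in F)).

Lemma edit_sym G F : symmetric (edit_rel G F).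
Proof. by move=> x y; rewrite /edit_rel eq_sym setUC. Qed.

Lemma edit_irr G F : irreflexive (edit_rel G F).
Proof. by move=> x; rewrite /edit_rel eqxx. Qed.

Definition edit G F : sgraph T := SGraph (edit_sym G F) (edit_irr G F).

Definition yes_instance (l : nat) G (k : nat) : Prop :=
  exists F, [/\ edition_set G F, #|F| <= k & cluster_graph l (edit G F)].

End Graphs.

(** * Random access machine *)

(* Programs of a word RAM, in structured form.  The store consists of registers
   and of arrays of cells; a program names finitely many of both, by literals.
   The only arithmetic is addition and truncated subtraction. *)
Inductive expr :=
| Cst of nat
| Reg of nat
| Get of nat & expr
| Plus of expr & expr
| Minus of expr & expr.

(* Tests have the form [e1 <= e2]. *)
Inductive cmd :=
| Skip
| Asg of nat & expr
| Put of nat & expr & expr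
| Seq of cmd & cmd
| If of expr & expr & cmd & cmd
| While of expr & expr & cmd.

Record state := State { regs : nat -> nat; arrs : nat -> nat -> nat }.

Definition upd (V : Type) (f : nat -> V) (i : nat) (v : V) : nat -> V :=
  fun j => if j == i then v else f j.

Definition set_reg (s : state) (x v : nat) : state :=
  State (upd (regs s) x v) (arrs s).

Definition set_arr (s : state) (a i v : nat) : state :=
  State (regs s) (upd (arrs s) a (upd (arrs s a) i v)).

Fixpoint eval (s : state) (e : expr) : nat :=
  match e with
  | Cst c => c
  | Reg x => regs s x
  | Get a e1 => arrs s a (eval s e1)
  | Plus e1 e2 => eval s e1 + eval s e2
  | Minus e1 e2 => eval s e1 - eval s e2
  end.

(* Every value met while evaluating e fits in a machine word, i.e. is at most
   W; array indices are such values, so W also bounds the addressable memory. *)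
Fixpoint fits (W : nat) (s : state) (e : expr) : bool :=
  (eval s e <= W) &&
  match e with
  | Cst _ | Reg _ => true
  | Get _ e1 => fits W s e1
  | Plus e1 e2 | Minus e1 e2 => fits W s e1 && fits W s e2
  end.

Fixpoint ecost (e : expr) : nat :=
  match e with
  | Cst _ | Reg _ => 1
  | Get _ e1 => (ecost e1).+1
  | Plus e1 e2 | Minus e1 e2 => (ecost e1 + ecost e2).+1
  end.

(* [exec W p s t s']: with word bound W, program p started in s halts in s'
   after t elementary steps, without overflow.  The relation is deterministic
   and has no derivation when p diverges or overflows. *)
Inductive exec (W : nat) : cmd -> state -> nat -> state -> Prop :=
| ExecSkip s : exec W Skip s 1 s
| ExecAsg s x e : fits W s e ->
    exec W (Asg x e) s (ecost e).+1 (set_reg s x (eval s e))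
| ExecPut s a e1 e2 : fits W s e1 -> fits W s e2 ->
    exec W (Put a e1 e2) s (ecost e1 + ecost e2).+1
         (set_arr s a (eval s e1) (eval s e2))
| ExecSeq s1 s2 s3 c1 c2 t1 t2 :
    exec W c1 s1 t1 s2 -> exec W c2 s2 t2 s3 ->
    exec W (Seq c1 c2) s1 (t1 + t2) s3
| ExecIfT s s' e1 e2 c1 c2 t : fits W s e1 -> fits W s e2 ->
    eval s e1 <= eval s e2 -> exec W c1 s t s' ->
    exec W (If e1 e2 c1 c2) s (ecost e1 + ecost e2 + t).+1 s'
| ExecIfF s s' e1 e2 c1 c2 t : fits W s e1 -> fits W s e2 ->
    eval s e2 < eval s e1 -> exec W c2 s t s' ->
    exec W (If e1 e2 c1 c2) s (ecost e1 + ecost e2 + t).+1 s'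
| ExecWhileT s s1 s2 e1 e2 c t1 t2 : fits W s e1 -> fits W s e2 ->
    eval s e1 <= eval s e2 -> exec W c s t1 s1 ->
    exec W (While e1 e2 c) s1 t2 s2 ->
    exec W (While e1 e2 c) s (ecost e1 + ecost e2 + t1 + t2).+1 s2
| ExecWhileF s e1 e2 c : fits W s e1 -> fits W s e2 ->
    eval s e2 < eval s e1 ->
    exec W (While e1 e2 c) s (ecost e1 + ecost e2).+1 s.

(* Array 0 holds the input word sequence, array 1 receives the output. *)
Definition input_state (w : seq nat) : state :=
  State (fun _ => 0) (fun a i => if a == 0 then nth 0 w i else 0).

Definition output_is (s : state) (w : seq nat) : Prop :=
  forall i, i < size w -> arrs s 1 i = nth 0 w i.

(* Adjacency-list encoding of (G, k): the words n and k, and then, for each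
   vertex v = 0, ..., n-1, the degree of v followed by the neighbours of v
   in an arbitrary order. *)
Definition encodes (n : nat) (G : sgraph 'I_n) (k : nat) (w : seq nat) : Prop :=
  exists nb : 'I_n -> seq 'I_n,
    (forall v, uniq (nb v) /\ nb v =i G v) /\
    w = n :: k :: flatten [seq size (nb v) :: map val (nb v) | v <- enum 'I_n].

(* Main.v *)
(** A graph is an L_l-cluster graph iff its vertices carry labels c, p such that
    x, y are adjacent iff c x = c y and p x <> p y, and on each class of c either
    p is injective or p takes at most l values.

    The kernel is obtained by removing the components that are already cliques or
    l-cliques and truncating the classes of false twins to 2k+2 vertices and the
    classes of true twins to 2k+l+1.  A solution touches at most 2k vertices, so
    a truncated class still has untouched members, next to which the labels of the
    deleted twins can be put back.  Conversely, if there is a solution then every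
    label class of c meeting the kernel contains a touched vertex, and its
    untouched vertices form one class of true twins or at most l classes of false
    twins; this bounds the kernel by 2k + 2k l (2k+2), and a larger one is replaced
    by a path on four vertices with k = 0.

    For linear time, twin classes are computed by splitting labels along each
    neighbourhood.  No search is needed to find the components: those to be removed
    have diameter at most 2, so their root, the least vertex within distance 2, is
    the same for all their vertices, and v lies in a connected complete multipartite
    component iff the root is constant along edges and deg v plus the number of
    false twins of v is the number of vertices with the root of v. *)

Require Import Defs.
From mathcomp Require Import all_boot zify.

Set Implicit Arguments.
Unset Strict Implicit.
Unset Printing Implicit Defensive.

(** * Cluster graphs and labellings *)

Section UnorderedPairs.
Variable T : finType.
Implicit Types (x y : T) (r : rel T) (G : sgraph T).

Definition upairs r : {set {set T}} :=
  [set [set q.1; q.2] | q : T * T & r q.1 q.2].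

Lemma set2_eq x y a b :
  [set x; y] = [set a; b] -> (x, y) = (a, b) \/ (x, y) = (b, a).
Proof.
move=> /setP e; move: (e x) (e y) (e a) (e b); rewrite !inE !eqxx ?orbT.
case/esym/orP=> /eqP->; case/esym/orP=> /eqP->; rewrite ?orbb; auto.
  by move=> _ /eqP->; auto.
by move=> /eqP->; auto.
Qed.

Lemma mem_upairs r x y : symmetric r -> ([set x; y] \in upairs r) = r x y.
Proof.
move=> symr; apply/imsetP/idP => [[[a b]]|xy]; last by exists (x, y); rewrite ?inE.
by rewrite inE /= => ab /set2_eq[] [-> ->] //; rewrite symr.
Qed.

Lemma card_upairs r : symmetric r -> irreflexive r ->
  #|[set q : T * T | r q.1 q.2]| = 2 * #|upairs r|.
Proof.
move=> symr irrr.
rewrite -sum1_card (partition_big_imset (fun q => [set q.1; q.2])) /= mulnC.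
rewrite -sum_nat_const; apply: eq_bigr => _ /imsetP[[a b] + ->].
rewrite inE /= => ab; have ne : a != b by apply: contraTneq ab => ->; rewrite irrr.
rewrite sum1_card; have <- : #|[set (a, b); (b, a)]| = 2.
  by rewrite cards2 xpair_eqE negb_and ne.
apply: eq_card => -[x y]; rewrite !inE /=; apply/andP/orP => [[_ /eqP/set2_eq]|].
  by case=> ->; rewrite eqxx; [left | right].
by case=> /eqP[-> ->]; rewrite inE /=; [rewrite ab | rewrite symr ab setUC]; rewrite eqxx.
Qed.

Lemma mem_edges G x y : ([set x; y] \in edges G) = G x y.
Proof. exact/mem_upairs/adj_sym. Qed.

Lemma card_edges G : #|[set q : T * T | G q.1 q.2]| = 2 * #|edges G|.
Proof. apply: card_upairs; [exact: adj_sym | exact: adj_irr]. Qed.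

End UnorderedPairs.

Section Labellings.
Variable T : finType.
Implicit Types (G : sgraph T) (x y : T) (Y A B : {set T}).

Definition joined (C P : eqType) (c : T -> C) (p : T -> P) : rel T :=
  fun x y => (c x == c y) && (p x != p y).

Definition label_class (C : eqType) Y (c : T -> C) z := [set x in Y | c x == z].

Definition admissible (l : nat) (P : finType) (p : T -> P) A : Prop :=
  {in A &, injective p} \/ #|p @: A| <= l.

Definition conflicts G (C P : eqType) Y (c : T -> C) (p : T -> P) : {set T * T} :=
  [set q in setX Y Y | G q.1 q.2 != joined c p q.1 q.2].

(* Conflicts are ordered pairs, hence the factor 2. *)
Definition editable (l : nat) G Y k : Prop :=
  exists (C P : finType) (c : T -> C) (p : T -> P),
    (forall z, admissible l p (label_class Y c z)) /\
    #|conflicts G Y c p| <= 2 * k.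

Lemma joined_sym (C P : eqType) (c : T -> C) (p : T -> P) : symmetric (joined c p).
Proof. by move=> x y; rewrite /joined eq_sym [p x == _]eq_sym. Qed.

Lemma joined_irr (C P : eqType) (c : T -> C) (p : T -> P) : irreflexive (joined c p).
Proof. by move=> x; rewrite /joined !eqxx. Qed.

Lemma conflictE G (C P : eqType) (c : T -> C) (p : T -> P) Y x y :
  ((x, y) \in conflicts G Y c p) = [&& x \in Y, y \in Y & G x y != joined c p x y].
Proof. by rewrite !inE andbA. Qed.

Lemma no_conflicts G (C P : eqType) (c : T -> C) (p : T -> P) Y :
  #|conflicts G Y c p| <= 2 * 0 <-> {in Y &, forall x y, G x y = joined c p x y}.
Proof.
rewrite muln0 leqn0 cards_eq0; split=> [/eqP/setP h x y xY yY|h].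
  by have := h (x, y); rewrite conflictE xY yY inE /= => /negbFE/eqP.
apply/eqP/setP => -[x y]; rewrite conflictE [RHS]inE.
by apply/and3P => -[xY yY]; rewrite h ?eqxx.
Qed.

Lemma in_label_class (C : eqType) Y (c : T -> C) z x :
  (x \in label_class Y c z) = (x \in Y) && (c x == z).
Proof. by rewrite inE. Qed.

Lemma admissible_sub l (P : finType) (p : T -> P) A B :
  A \subset B -> admissible l p B -> admissible l p A.
Proof.
move=> /subsetP sAB [inj|le]; [left | right].
  by move=> x y /sAB xB /sAB yB; apply: inj.
by apply: leq_trans le; apply/subset_leq_card/imsetS/subsetP.
Qed.

End Labellings.

Section ClusterLabels.
Variables (T : finType) (l : nat).
Implicit Types (G H : sgraph T) (x y : T) (A Y : {set T}) (P : {set {set T}}).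

Definition component G x : {set T} := [set y | connect G x y].

Definition part G x : {set T} := component G x :\: [set y | G x y].

Definition multipartite G A P : Prop :=
  [/\ partition P A, forall B, B \in P -> independent G B &
      forall B B', B \in P -> B' \in P -> B != B' ->
        {in B & B', forall x y, G x y}].

Lemma connect_adj_sym G : connect_sym G.
Proof. exact/sym_connect_sym/adj_sym. Qed.

Lemma component_refl G x : x \in component G x.
Proof. by rewrite inE connect0. Qed.

Lemma component_eq G x y : (component G x == component G y) = connect G x y.
Proof.
apply/eqP/idP => [e|cxy].
  by have := component_refl G y; rewrite -e inE.
by apply/setP => z; rewrite !inE (same_connect (@connect_adj_sym G) cxy).
Qed.

Lemma component_mem G x y : y \in component G x -> component G y = component G x.
Proof. by rewrite inE => cxy; apply/esym/eqP; rewrite component_eq. Qed.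

Lemma component_connected G x : connected_in G (component G x).
Proof.
move=> u v ux vx; have : connect G u v.
  by rewrite -component_eq (component_mem ux) (component_mem vx).
case/connectP => s; elim: s u ux => [|w s IH] u ux /=; first by move=> _ ->.
case/andP => uw ws ev; have wx : w \in component G x.
  by move: ux; rewrite !inE => /connect_trans; apply; apply: connect1.
by apply: connect_trans (connect1 _) (IH w wx ws ev); rewrite /= ux wx.
Qed.

Lemma clique_multipartite G A : clique G A -> multipartite G A (preim_partition id A).
Proof.
move=> cl; split; first exact: preim_partitionP.
  move=> _ /imsetP[x _ ->] u v; rewrite !inE => /andP[_ /eqP<-] /andP[_ /eqP<-].
  by rewrite adj_irr.
move=> _ _ /imsetP[x xA ->] /imsetP[y yA ->] ne u v.
rewrite !inE => /andP[uA /eqP eu] /andP[vA /eqP ev].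
by apply: cl => //; apply: contraNneq ne => e; rewrite eu ev e.
Qed.

Lemma part_pblock G x P : multipartite G (component G x) P ->
  {in component G x, forall y, part G y = pblock P y}.
Proof.
move=> [/and3P[/eqP covP tiP _] indep compl] y yx; rewrite /part (component_mem yx).
have yB : y \in pblock P y by rewrite mem_pblock covP.
have BP : pblock P y \in P by rewrite pblock_mem ?covP.
apply/setP => z; rewrite in_setD; apply/andP/idP => [[]|zB].
  rewrite inE => nyz zx; apply: contraNT nyz => zB.
  have zB' : z \in pblock P z by rewrite mem_pblock covP.
  apply: (compl (pblock P y) (pblock P z)) => //; first by rewrite pblock_mem ?covP.
  by apply: contraNneq zB => ->.
rewrite inE; split; first exact: indep BP _ _ yB zB.
by rewrite -covP; apply/bigcupP; exists (pblock P y).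
Qed.

Lemma component_multipartite G x : cluster_graph l G -> exists P,
  multipartite G (component G x) P /\ (clique G (component G x) \/ #|P| <= l).
Proof.
move=> cg; case: (cg (component G x)); first exact: imset_f.
  by move=> cl; exists (preim_partition id (component G x)); split;
    [exact: clique_multipartite | left].
by case=> _ [P [ptP cP indep compl]]; exists P; split; [split | right].
Qed.

Lemma cluster_joined G : cluster_graph l G -> joined (component G) (part G) =2 G.
Proof.
move=> cg x y; rewrite /joined component_eq.
have [P [mP _]] := component_multipartite x cg.
have [/and3P[/eqP covP tiP _] indep compl] := mP.
have [cxy|/negP ncxy] := boolP (connect G x y); last first.
  by symmetry; apply/negP => /connect1.
have yx : y \in component G x by rewrite inE.
have xx := component_refl G x; rewrite !(part_pblock mP) //.
apply/idP/idP => [ne|xy].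
  by apply: (compl (pblock P x) (pblock P y)); rewrite ?pblock_mem ?mem_pblock ?covP.
apply: contraTneq xy => e; apply: (indep (pblock P x)).
- by rewrite pblock_mem ?covP.
- by rewrite mem_pblock covP.
by rewrite e mem_pblock covP.
Qed.

Lemma cluster_admissible G Y z : cluster_graph l G ->
  admissible l (part G) (label_class Y (component G) z).
Proof.
move=> cg; set A := label_class _ _ _.
have [->|[x xA]] := set_0Vmem A; first by left=> y; rewrite inE.
have sA : A \subset component G x.
  apply/subsetP => y yA; move: xA yA; rewrite !inE => /andP[_ /eqP ex] /andP[_ ey].
  by rewrite -component_eq ex eq_sym.
apply: (admissible_sub sA).
have [P [mP clP]] := component_multipartite x cg; have [ptP _ _] := mP.
case: clP => [cl|cP]; [left=> u v ux vx e | right].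
  apply/eqP/negPn/negP => ne; have := cl u v ux vx ne.
  by rewrite -(cluster_joined cg) /joined e eqxx andbF.
apply: leq_trans cP; apply/subset_leq_card/subsetP => _ /imsetP[y yx ->].
by rewrite (part_pblock mP) // pblock_mem // (cover_partition ptP).
Qed.

Lemma joined_cluster G (C P : finType) (c : T -> C) (p : T -> P) :
  (forall z, admissible l p (label_class setT c z)) -> joined c p =2 G ->
  cluster_graph l G.
Proof.
move=> adm eG _ /imsetP[x _ ->]; set A := [set y | _].
have cA y : y \in A -> c y = c x.
  rewrite inE => cxy; have cl : closed G [pred u | c u == c x].
    by apply: (intro_closed (@connect_adj_sym G)) => u v; rewrite !inE -eG => /andP[/eqP->].
  by have := closed_connect cl cxy; rewrite !inE eqxx => /esym/eqP.
have AG : {in A &, forall u v, G u v = (p u != p v)}.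
  by move=> u v /cA cu /cA cv; rewrite -eG /joined cu cv eqxx.
have sA : A \subset label_class setT c (c x).
  by apply/subsetP => y /cA e; rewrite in_label_class inE e /=.
case: (admissible_sub sA (adm (c x))) => [inj|cp]; [left | right].
  by move=> u v uA vA; rewrite AG //; apply: contra_neq; apply: inj.
split; first exact: component_connected.
exists (preim_partition p A); split; first exact: preim_partitionP.
- have -> : preim_partition p A = [set [set y in A | q == p y] | q in p @: A].
    by rewrite -imset_comp.
  exact: leq_trans (leq_imset_card _ _) cp.
- move=> _ /imsetP[w _ ->] u v; rewrite !inE => /andP[uA /eqP eu] /andP[vA /eqP ev].
  by rewrite AG ?inE // -eu -ev eqxx.
move=> _ _ /imsetP[w wA ->] /imsetP[w' wA' ->] ne u v.
rewrite !inE => /andP[uA /eqP eu] /andP[vA /eqP ev]; rewrite AG ?inE //.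
by apply: contraNneq ne => e; rewrite eu ev e.
Qed.

Definition differ G H : rel T := fun x y => G x y != H x y.

Lemma differ_sym G H : symmetric (differ G H).
Proof. by move=> x y; rewrite /differ adj_sym [H x y]adj_sym. Qed.

Lemma differ_irr G H : irreflexive (differ G H).
Proof. by move=> x; rewrite /differ !adj_irr. Qed.

Lemma edit_upairs_differ G H : exists2 F, edition_set G F &
  edit G F =2 H /\ #|F| <= #|upairs (differ G H)|.
Proof.
pose F := [set (A, A \in edges H) | A in upairs (differ G H)].
have inF x y b : (([set x; y], b) \in F) = differ G H x y && (b == H x y).
  apply/imsetP/andP => [[A]|[xy /eqP->]]; last first.
    by exists [set x; y]; rewrite ?(mem_upairs _ _ (@differ_sym G H)) ?mem_edges.
  by move=> + [eA ->]; rewrite -eA (mem_upairs _ _ (@differ_sym G H)) mem_edges.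
exists F; last split; last exact: leq_imset_card.
  split=> [_ _ /imsetP[A _ ->] /imsetP[B _ ->] /= ->|A b] //.
  case/imsetP => _ /imsetP[[x y] + ->] [-> ->]; rewrite inE /= !mem_edges => xy.
  have ne : x != y by apply: contraTneq xy => ->; rewrite differ_irr.
  by rewrite cards2 ne; move: xy; rewrite /differ; case: (G x y); case: (H x y).
move=> x y; rewrite /= /edit_rel mem_edges !inF /differ.
have [->|_] := eqVneq x y; first by rewrite !adj_irr.
by case: (G x y); case: (H x y).
Qed.

Lemma upairs_differ_edit G F : edition_set G F -> #|upairs (differ G (edit G F))| <= #|F|.
Proof.
move=> [injF edF]; apply: leq_trans (leq_imset_card fst F).
apply/subset_leq_card/subsetP => _ /imsetP[[x y] + ->].
rewrite inE /= /differ /= /edit_rel mem_edges.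
have [->|_ /=] := eqVneq x y; first by rewrite adj_irr.
have [f _|_] := boolP (([set x; y], true) \in F).
  by apply/imsetP; exists ([set x; y], true).
have [f _|_] := boolP (([set x; y], false) \in F).
  by apply/imsetP; exists ([set x; y], false).
by rewrite andbT orbF eqxx.
Qed.

Lemma yes_instance_differ G k : yes_instance l G k <->
  exists2 H, cluster_graph l H & #|upairs (differ G H)| <= k.
Proof.
split=> [[F [edF cF cg]]|[H cg cH]].
  by exists (edit G F) => //; apply: leq_trans (upairs_differ_edit edF) cF.
have [F edF [eF cF]] := edit_upairs_differ G H.
exists F; split=> //; first exact: leq_trans cF cH.
apply: (joined_cluster (fun z => cluster_admissible setT z cg)) => x y.
by rewrite cluster_joined // eF.
Qed.

Lemma yes_instanceE G k : yes_instance l G k <-> editable l G setT k.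
Proof.
have conflicts_differ (C P : finType) (c : T -> C) (p : T -> P) H : joined c p =2 H ->
    #|conflicts G setT c p| = 2 * #|upairs (differ G H)|.
  move=> eH; rewrite -(card_upairs (@differ_sym G H) (@differ_irr G H)).
  by apply: eq_card => -[x y]; rewrite conflictE !inE eH.
rewrite yes_instance_differ; split=> [[H cg cH]|[C [P [c [p [adm]]]]]].
  exists {set T}, {set T}, (component H), (part H).
  rewrite (conflicts_differ _ _ _ _ _ (cluster_joined cg)) leq_mul2l cH orbT.
  by split=> // z; apply: cluster_admissible.
pose H := SGraph (joined_sym c p) (joined_irr c p).
rewrite (conflicts_differ _ _ _ _ H) // leq_mul2l => cH.
by exists H => //; apply: joined_cluster adm _.
Qed.

End ClusterLabels.

Lemma editable_map (T T' : finType) l (G : sgraph T) (G' : sgraph T')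
    (Y : {set T}) (Y' : {set T'}) (g : T' -> T) k :
  {in Y' &, injective g} -> (forall x, x \in Y' -> g x \in Y) ->
  {in Y' &, forall x y, G' x y = G (g x) (g y)} ->
  editable l G Y k -> editable l G' Y' k.
Proof.
move=> ginj gY gE [C [P [c [p [adm cD]]]]].
exists C, P, (c \o g), (p \o g); split=> [z|].
  have gZ x : x \in label_class Y' (c \o g) z ->
      x \in Y' /\ g x \in label_class Y c z.
    by rewrite !inE /= => /andP[xY ->]; rewrite gY.
  case: (adm z) => [inj|le]; [left=> x y /gZ[xY xz] /gZ[yY yz] e | right].
    exact/ginj/inj.
  apply: leq_trans le; rewrite imset_comp; apply/subset_leq_card/imsetS.
  by apply/subsetP => _ /imsetP[x /gZ[_ xz] ->].
apply: leq_trans cD; pose gg q := (g q.1, g q.2).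
have gginj : {in conflicts G' Y' (c \o g) (p \o g) &, injective gg}.
  move=> [x y] [x' y']; rewrite !conflictE => /and3P[xY yY _] /and3P[xY' yY' _].
  by case=> /ginj-> // /ginj->.
rewrite -(card_in_imset gginj); apply/subset_leq_card/subsetP.
move=> _ /imsetP[[x y] + ->]; rewrite !conflictE => /and3P[xY yY].
by rewrite gE // !gY.
Qed.

Lemma editable_sub (T : finType) l (G : sgraph T) (Y Y' : {set T}) k :
  Y' \subset Y -> editable l G Y k -> editable l G Y' k.
Proof. by move/subsetP => sY; apply: (editable_map (g := id)). Qed.

Lemma editable0 (T : finType) l (G : sgraph T) k : editable l G set0 k.
Proof.
exists T, T, id, id; split=> [z|]; first by left=> x; rewrite !inE.
rewrite (_ : conflicts _ _ _ _ = set0) ?cards0 //.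
by apply/setP => -[x y]; rewrite conflictE !inE.
Qed.

Section Induced.
Variables (T : finType) (G : sgraph T) (X : {set T}).

Definition induced_rel : rel 'I_#|X| := fun i j => G (enum_val i) (enum_val j).

Lemma induced_sym : symmetric induced_rel.
Proof. by move=> i j; rewrite /induced_rel adj_sym. Qed.

Lemma induced_irr : irreflexive induced_rel.
Proof. by move=> i; rewrite /induced_rel adj_irr. Qed.

Definition induced := SGraph induced_sym induced_irr.

Lemma editable_induced l k : editable l induced setT k <-> editable l G X k.
Proof.
split; last first.
  apply: editable_map => // [i j _ _|i _]; [exact: enum_val_inj | exact: enum_valP].
have [X0|[x xX]] := set_0Vmem X.
  by move=> _; apply: editable_sub (editable0 l G k); rewrite X0.
apply: (editable_map (g := enum_rank_in xX)) => // [y z yX zX e|y z yX zX].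
  by rewrite -(enum_rankK_in xX yX) e enum_rankK_in.
by rewrite /= /induced_rel !enum_rankK_in.
Qed.

End Induced.

Section Union.
Variables (T : finType) (l : nat) (G : sgraph T) (Z : {set T}).
Hypothesis clZ : closed G (mem Z).

Lemma editable_union i j :
  editable l G Z i -> editable l G (~: Z) j -> editable l G setT (i + j).
Proof.
move=> [C [P [c [p [adm cD]]]]] [C' [P' [c' [p' [adm' cD']]]]].
pose cc x : C + C' := if x \in Z then inl (c x) else inr (c' x).
pose pp x : P + P' := if x \in Z then inl (p x) else inr (p' x).
exists (C + C')%type, (P + P')%type, cc, pp; split.
  have inl_class z x : x \in label_class setT cc (inl z) ->
      x \in label_class Z c z /\ pp x = inl (p x).
    by rewrite !inE /cc /pp; case: (x \in Z).
  have inr_class z x : x \in label_class setT cc (inr z) ->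
      x \in label_class (~: Z) c' z /\ pp x = inr (p' x).
    by rewrite !inE /cc /pp; case: (x \in Z).
  case=> z.
    case: (adm z) => [inj|le]; [left | right].
      by move=> x y /inl_class[xz ->] /inl_class[yz ->] [/inj->].
    apply: leq_trans le; rewrite -(card_imset _ (@inl_inj P P')) -imset_comp.
    apply/subset_leq_card/subsetP => _ /imsetP[x /inl_class[xz ->] ->].
    by apply/imsetP; exists x.
  case: (adm' z) => [inj|le]; [left | right].
    by move=> x y /inr_class[xz ->] /inr_class[yz ->] [/inj->].
  apply: leq_trans le; rewrite -(card_imset _ (@inr_inj P P')) -imset_comp.
  apply/subset_leq_card/subsetP => _ /imsetP[x /inr_class[xz ->] ->].
  by apply/imsetP; exists x.
rewrite mulnDr; apply: leq_trans (leq_add cD cD').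
apply: leq_trans (leq_card_setU _ _); apply/subset_leq_card/subsetP => -[x y].
rewrite in_setU !conflictE !in_setC !in_setT /= /joined /cc /pp.
have [xy|_] := boolP (G x y); first by rewrite (clZ xy); case: (y \in Z); rewrite /= ?orbF.
by case: (x \in Z); case: (y \in Z); rewrite /= ?orbF.
Qed.

End Union.

(** * Twins *)

Section Neighbourhoods.
Variables (T : finType) (G : sgraph T).
Implicit Types (x y u v w : T) (Y : {set T}).

Definition nbhd v : {set T} := [set u | G v u].

Definition cnbhd v : {set T} := v |: nbhd v.

Lemma in_nbhd v u : (u \in nbhd v) = G v u.
Proof. by rewrite inE. Qed.

Lemma in_cnbhd v u : (u \in cnbhd v) = (u == v) || G v u.
Proof. by rewrite !inE. Qed.

Lemma nbhd_eqP u v : reflect (forall x, G u x = G v x) (nbhd u == nbhd v).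
Proof.
apply: (iffP eqP) => [/setP e x|e]; first by have := e x; rewrite !inE.
by apply/setP => x; rewrite !inE e.
Qed.

Lemma cnbhd_eqP u v :
  reflect (forall x, (x == u) || G u x = (x == v) || G v x) (cnbhd u == cnbhd v).
Proof.
apply: (iffP eqP) => [/setP e x|e]; first by rewrite -!in_cnbhd e.
by apply/setP => x; rewrite !in_cnbhd e.
Qed.

Lemma false_twins_nonadjacent u v : nbhd u == nbhd v -> G u v = false.
Proof. by move/nbhd_eqP->; rewrite adj_irr. Qed.

Section Labelled.
Variables (C P : finType) (Y : {set T}) (c : T -> C) (p : T -> P).

Definition touched : {set T} := [set q.1 | q in conflicts G Y c p].

Lemma card_touched : #|touched| <= #|conflicts G Y c p|.
Proof. exact: leq_imset_card. Qed.

Lemma untouched_joined x y :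
  x \in Y :\: touched -> y \in Y -> G x y = joined c p x y.
Proof.
rewrite inE => /andP[nx xY] yY; apply/eqP/negPn/negP => ne; case/negP: nx.
by apply/imsetP; exists (x, y); rewrite ?conflictE ?xY ?yY.
Qed.

Lemma exists_untouched k m (Q : {set T}) : #|conflicts G Y c p| <= 2 * k ->
  2 * k + m <= #|Q| -> m <= #|Q :\: touched|.
Proof.
move=> cD cQ; have := cardsD Q touched; have := subset_leq_card (subsetIr Q touched).
by have := card_touched; lia.
Qed.

Lemma conflicts_setU1 (C' P' : finType) (c' : T -> C') (p' : T -> P') v :
  {in Y &, joined c' p' =2 joined c p} ->
  {in Y, forall y, G v y = joined c' p' v y} ->
  #|conflicts G (v |: Y) c' p'| <= #|conflicts G Y c p|.
Proof.
move=> eY ev; apply/subset_leq_card/subsetP => -[x y]; rewrite !conflictE !in_setU1.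
case/and3P => /orP[/eqP->|xY] /orP[/eqP->|yY].
- by rewrite adj_irr joined_irr.
- by rewrite ev ?eqxx.
- by rewrite adj_sym joined_sym ev ?eqxx.
by rewrite eY // xY yY.
Qed.

Lemma false_twins_few_parts l u u' : 0 < l ->
  admissible l p (label_class Y c (c u)) ->
  u \in Y :\: touched -> u' \in Y :\: touched -> u != u' -> nbhd u == nbhd u' ->
  #|p @: label_class Y c (c u)| <= l.
Proof.
move=> l0 adm uU uU' ne tw; have [uY uY'] : u \in Y /\ u' \in Y.
  by move: uU uU'; rewrite !inE => /andP[_ ->] /andP[].
have nadj := false_twins_nonadjacent tw.
have [ec|nc] := eqVneq (c u) (c u').
  case: adm => // inj; case/eqP: ne; apply: inj; rewrite ?inE ?uY ?uY' ?ec ?eqxx //.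
  by move: nadj; rewrite (untouched_joined uU) // /joined ec eqxx => /negbFE/eqP.
apply: leq_trans l0; rewrite -(cards1 (p u)); apply/subset_leq_card/subsetP.
move=> _ /imsetP[x + ->]; rewrite !inE => /andP[xY /eqP cx].
rewrite eq_sym; apply: contraNT nc => pne.
have : G u' x by rewrite -(nbhd_eqP _ _ tw) (untouched_joined uU) // /joined cx eqxx.
by rewrite (untouched_joined uU') // /joined cx eq_sym => /andP[].
Qed.

Lemma true_twins_injective l (Q : {set T}) v : l < #|Q| -> Q \subset Y :\: touched ->
  {in Q, forall w, cnbhd w == cnbhd v} -> (forall z, admissible l p (label_class Y c z)) ->
  {in Q, forall u, {in label_class Y c (c u) &, injective p}}.
Proof.
move=> cQ sQ tw adm u uQ.
have QY w : w \in Q -> w \in Y by move/(subsetP sQ); rewrite inE => /andP[].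
have joinedQ w w' : w \in Q -> w' \in Q -> w != w' -> joined c p w w'.
  move=> wQ wQ' ne; rewrite -(untouched_joined (subsetP sQ w wQ)) ?QY //.
  have : w' \in cnbhd w by rewrite (eqP (tw w wQ)) -(eqP (tw w' wQ')) in_cnbhd eqxx.
  by rewrite in_cnbhd eq_sym (negbTE ne).
have injQ : {in Q &, injective p}.
  move=> w w' wQ wQ' e; apply/eqP/negPn/negP => /(joinedQ w w' wQ wQ').
  by rewrite /joined e eqxx andbF.
case: (adm (c u)) => // le; suff : #|Q| <= l by rewrite leqNgt cQ.
apply: leq_trans le; rewrite -(card_in_imset injQ).
apply/subset_leq_card/imsetS/subsetP => w wQ; rewrite inE QY //=.
by have [->//|ne] := eqVneq w u; have /andP[] := joinedQ w u wQ uQ ne.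
Qed.

End Labelled.

Variables (l k : nat).

Lemma editable_add_false_twin Y v : 0 < l -> v \notin Y ->
  2 * k + 2 <= #|[set u in Y | nbhd u == nbhd v]| ->
  editable l G Y k -> editable l G (v |: Y) k.
Proof.
move=> l0 vY cQ [C [P [c [p [adm cD]]]]].
have := exists_untouched cD cQ; set S := touched _ _ _.
case/card_gt1P => u [u' [+ + ne]]; rewrite !inE => /and3P[uS uY tu] /and3P[uS' uY' tu'].
have uU : u \in Y :\: S by rewrite inE uS.
have few : #|p @: label_class Y c (c u)| <= l.
  apply: false_twins_few_parts l0 (adm _) uU _ ne _; first by rewrite inE uS'.
  by rewrite (eqP tu) eq_sym.
pose g x := if x == v then u else x.
have gY x : x \in Y -> g x = x by rewrite /g; case: eqP => // ->; rewrite (negbTE vY).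
have gv : g v = u by rewrite /g eqxx.
exists C, P, (c \o g), (p \o g); split=> [z|]; last first.
  apply: leq_trans cD; apply: conflicts_setU1 => [x y xY yY|y yY].
    by rewrite /joined /= !gY.
  by rewrite /joined /= gv gY // -(nbhd_eqP _ _ tu) (untouched_joined uU).
have gclass x : x \in label_class (v |: Y) (c \o g) z -> g x \in label_class Y c z.
  by rewrite !inE /= => /andP[/orP[/eqP->|xY] ->]; rewrite ?gv ?uY ?gY ?xY.
have sub : (p \o g) @: label_class (v |: Y) (c \o g) z \subset p @: label_class Y c z.
  by apply/subsetP => _ /imsetP[x /gclass xz ->]; apply: imset_f.
have [ez|nz] := eqVneq (c u) z.
  by right; apply: leq_trans (subset_leq_card sub) _; rewrite -ez.
case: (adm z) => [inj|le]; last by right; apply: leq_trans (subset_leq_card sub) le.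
left=> x y xz yz /inj; rewrite !gclass // => /(_ isT isT).
have nv w : w \in label_class (v |: Y) (c \o g) z -> g w = w.
  by rewrite !inE => /andP[/orP[/eqP->|/gY//]]; rewrite /= gv (negbTE nz).
by rewrite !nv.
Qed.

Lemma editable_add_true_twin Y v : v \notin Y ->
  2 * k + l.+1 <= #|[set u in Y | cnbhd u == cnbhd v]| ->
  editable l G Y k -> editable l G (v |: Y) k.
Proof.
move=> vY cQ [C [P [c [p [adm cD]]]]].
have := exists_untouched cD cQ; set S := touched _ _ _; set Q := [set u in Y | _] => cQS.
have QSP w : w \in Q :\: S -> [/\ w \in Y, w \in Y :\: S & cnbhd w == cnbhd v].
  by rewrite !inE => /and3P[-> ->].
have [u uQ] : exists u, u \in Q :\: S by apply/card_gt0P; lia.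
have [uY uU tu] := QSP u uQ.
have inj : {in label_class Y c (c u) &, injective p}.
  apply: (true_twins_injective (v := v) cQS _ _ adm uQ).
  - by apply/subsetP => w /QSP[].
  - by move=> w /QSP[].
pose c' x := if x == v then c u else c x.
pose p' x := if x == v then None else Some (p x).
have neqv x : x \in Y -> (x == v) = false by apply: contraTF => /eqP->.
exists C, (option P), c', p'; split=> [z|]; last first.
  apply: leq_trans cD; apply: conflicts_setU1 => [x y xY yY|y yY].
    by rewrite /joined /c' /p' !neqv.
  have := cnbhd_eqP _ _ tu y; rewrite neqv //= => <-.
  rewrite /joined /c' /p' eqxx neqv // andbT.
  have [->|ne] /= := eqVneq y u; first by rewrite eqxx.
  rewrite (untouched_joined uU) // /joined andb_idr // => ec.
  by apply: contra ne => /eqP/inj->; rewrite // inE ?uY ?yY ?eqxx // -(eqP ec) eqxx.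
have sub x : x \in label_class (v |: Y) c' z -> x != v -> x \in label_class Y c z.
  by rewrite !inE /c' => + ne; rewrite (negbTE ne).
have [ez|nz] := eqVneq (c u) z.
  left=> x y xz yz; rewrite /p'; have [->|nx] := eqVneq x v; have [->|ny] := eqVneq y v => //.
  by case; apply: inj; rewrite ez sub.
have nv x : x \in label_class (v |: Y) c' z -> x != v.
  by apply: contraTneq => ->; rewrite inE /c' eqxx (negbTE nz) andbF.
have p'E x : x \in label_class (v |: Y) c' z -> p' x = Some (p x).
  by rewrite /p' => /nv/negbTE->.
case: (adm z) => [injz|le]; [left=> x y xz yz | right].
  by rewrite !p'E // => -[]; apply: injz; apply: sub; rewrite ?nv.
have Some_inj : injective (@Some P) by move=> ? ? [].
apply: leq_trans le; rewrite -(card_imset _ Some_inj) -imset_comp.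
apply/subset_leq_card/subsetP => _ /imsetP[x xz ->]; rewrite p'E //.
by apply/imsetP; exists x; rewrite // sub ?nv.
Qed.

End Neighbourhoods.

(** * Truncating twin classes *)

Lemma card_le_fibers (T I : finType) (f : T -> I) (A : {set T}) m :
  {in f @: A, forall b, #|[set x in A | f x == b]| <= m} -> #|A| <= #|f @: A| * m.
Proof.
move=> le; rewrite -sum1_card (partition_big_imset f) /= -sum_nat_const.
apply: leq_sum => b bA; apply: leq_trans (le b bA); rewrite sum1_card.
by apply/subset_leq_card/subsetP => x; rewrite !inE.
Qed.

Section Truncate.
Variables (n : nat) (A : eqType) (f : 'I_n -> A).
Implicit Types (u v : 'I_n) (X : {set 'I_n}).

Definition earlier X v : {set 'I_n} := [set u in X | (u < v) && (f u == f v)].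

Definition truncate X m : {set 'I_n} := [set v in X | #|earlier X v| < m].

Lemma truncate_sub X m : truncate X m \subset X.
Proof. by apply/subsetP => v; rewrite inE => /andP[]. Qed.

Lemma truncate_le X m a : #|[set u in truncate X m | f u == a]| <= m.
Proof.
set F := [set u in _ | _]; have [->|[w wF]] := set_0Vmem F; first by rewrite cards0.
case: (@arg_maxnP _ w [in F] val wF) => v /= vF vmax.
rewrite (cardsD1 v) vF; move: (vF); rewrite !inE => /andP[/andP[_ lt] /eqP fv].
apply: leq_ltn_trans (subset_leq_card _) lt; apply/subsetP => u; rewrite in_setD1.
case/andP => ne uF; move: (uF); rewrite !inE => /andP[/andP[-> _] /eqP->].
by rewrite fv eqxx andbT ltn_neqAle (vmax u uF) andbT.
Qed.

Lemma truncate_full X m v : v \in X -> v \notin truncate X m ->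
  m <= #|earlier (truncate X m) v|.
Proof.
move=> vX vt; pose D := [set u in X :\: truncate X m | f u == f v].
have vD : v \in D by rewrite inE in_setD vt vX eqxx.
case: (@arg_minnP _ v [in D] val vD) => w /= wD wmin.
move: (wD); rewrite in_set in_setD => /andP[/andP[wt wX] /eqP fw].
move: wt; rewrite inE wX /= -leqNgt => /leq_trans; apply; apply/subset_leq_card.
apply/subsetP => u; rewrite in_set => /and3P[uX uw fu]; rewrite in_set -fw fu andbT.
rewrite (leq_trans uw (wmin v vD)) andbT; apply: contraTT uw => ut.
by rewrite -leqNgt; apply: wmin; rewrite in_set in_setD ut uX -fw.
Qed.

Lemma mem_truncate X m v :
  v \in X -> (v \in truncate X m) = (#|earlier (truncate X m) v| < m).
Proof.
move=> vX; apply/idP/idP => [vt|]; last first.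
  by apply: contraTT => /truncate_full -/(_ vX); rewrite -leqNgt.
move: (vt); rewrite inE vX /=; apply/leq_ltn_trans/subset_leq_card.
by apply/subsetP => u; rewrite 2!inE => /andP[/andP[uX _] lt]; rewrite inE uX.
Qed.

End Truncate.

Section Growth.
Variables (l k : nat).

Lemma editable_grow (T : finType) (G : sgraph T) (X Y : {set T}) : X \subset Y ->
  (forall (Z : {set T}) v, X \subset Z -> v \in Y -> v \notin Z ->
     editable l G Z k -> editable l G (v |: Z) k) ->
  editable l G X k -> editable l G Y k.
Proof.
move=> sXY step; have [m] := ubnP #|Y :\: X|.
elim: m X sXY step => // m IH X sXY step le yX.
have [/eqP|[v]] := set_0Vmem (Y :\: X).
  by rewrite setD_eq0 => sYX; have -> : Y = X by apply/eqP; rewrite eqEsubset sYX.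
rewrite inE => /andP[vX vY]; apply: (IH (v |: X)); last exact: step.
- by rewrite subUset sub1set vY.
- by move=> Z w /subUsetP[_]; apply: step.
by move: le; rewrite (cardsD1 v) inE vX vY setDDl setUC.
Qed.

Lemma editable_truncate (n : nat) (G : sgraph 'I_n) (A : eqType) (f : 'I_n -> A)
    (X : {set 'I_n}) m :
  (forall (Z : {set _}) v, v \notin Z -> m <= #|[set u in Z | f u == f v]| ->
     editable l G Z k -> editable l G (v |: Z) k) ->
  editable l G X k <-> editable l G (truncate f X m) k.
Proof.
move=> step; split; first exact/editable_sub/truncate_sub.
apply: editable_grow (truncate_sub _ _ _) _ => Z v sZ vX vZ; apply: step => //.
have vt : v \notin truncate f X m by apply: contra vZ => /(subsetP sZ).
apply: leq_trans (truncate_full vX vt) _; apply/subset_leq_card/subsetP => u.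
by rewrite in_set => /and3P[/(subsetP sZ) uZ _ fu]; rewrite inE uZ.
Qed.

End Growth.

Section UntouchedBound.
Variables (T C P : finType) (G : sgraph T) (l k : nat) (c : T -> C) (p : T -> P).
Hypotheses (adm : forall z, admissible l p (label_class setT c z)) (l_gt1 : 1 < l).
Let S := touched G setT c p.

Lemma untouchedE u x : u \notin S -> G u x = joined c p u x.
Proof. by move=> uS; rewrite (@untouched_joined _ _ _ _ setT c p) ?inE ?uS. Qed.

Lemma untouched_nbhd u v : u \notin S -> v \notin S -> c u = c v -> p u = p v ->
  nbhd G u == nbhd G v.
Proof. by move=> uS vS ec ep; apply/nbhd_eqP => x; rewrite !untouchedE // /joined ec ep. Qed.

Lemma untouched_cnbhd u v : {in label_class setT c (c v) &, injective p} ->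
  u \notin S -> v \notin S -> c u = c v -> cnbhd G u == cnbhd G v.
Proof.
move=> inj uS vS ec.
have cnbhdE w x : w \notin S -> c w = c v -> (x == w) || G w x = (c x == c v).
  move=> wS cw; rewrite untouchedE // /joined cw.
  have [->|ne] /= := eqVneq x w; first by rewrite cw eqxx.
  rewrite eq_sym andb_idr // => /eqP cx; apply: contra ne => /eqP e.
  by rewrite (inj w x) ?in_label_class ?inE ?cw ?cx ?eqxx.
by apply/cnbhd_eqP => x; rewrite !cnbhdE.
Qed.

Lemma untouched_class_editable z : [disjoint label_class setT c z & S] ->
  closed G (mem (label_class setT c z)) /\ editable l G (label_class setT c z) 0.
Proof.
rewrite disjoint_subset => /subsetP disj; split.
  apply: (intro_closed (@connect_adj_sym _ G)) => x y + xz.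
  rewrite (untouchedE _ (disj x xz)) => /andP[/eqP e _].
  by move: xz; rewrite !inE e.
exists C, P, c, p; split=> [z'|].
  by apply: admissible_sub (adm z'); apply/subsetP => x; rewrite !inE => /andP[].
by apply/no_conflicts => x y xz _; apply: untouchedE (disj x xz).
Qed.

Variable X : {set T}.
Hypotheses
  (le_false : forall v, #|[set u in X | nbhd G u == nbhd G v]| <= 2 * k + 2)
  (le_true : forall v, #|[set u in X | cnbhd G u == cnbhd G v]| <= 2 * k + l.+1).

Lemma card_untouched_class z : #|label_class (X :\: S) c z| <= l * (2 * k + 2).
Proof.
set Y := label_class _ _ _.
have YP v : v \in Y -> [/\ v \in X, v \notin S & c v = z].
  by rewrite !inE => /andP[/andP[-> ->] /eqP].
have [->|[w wY]] := set_0Vmem Y; first by rewrite cards0.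
have [wX wS cw] := YP w wY.
case: (adm z) => [inj|le].
  apply: (@leq_trans (2 * k + l.+1)); last by nia.
  apply: leq_trans (le_true w); apply/subset_leq_card/subsetP => u /YP[uX uS cu].
  by rewrite inE uX untouched_cnbhd ?cu ?cw.
apply: (@leq_trans (#|p @: Y| * (2 * k + 2))); last first.
  rewrite leq_mul2r; apply/orP; right; apply: leq_trans le.
  by apply/subset_leq_card/imsetS/subsetP => u /YP[_ _ cu]; rewrite in_label_class inE cu eqxx.
apply: card_le_fibers => _ /imsetP[v vY ->]; apply: leq_trans (le_false v).
apply/subset_leq_card/subsetP => u; rewrite inE => /andP[/YP[uX uS cu] /eqP pu].
by have [_ vS cv] := YP v vY; rewrite inE uX untouched_nbhd ?cu.
Qed.

Hypothesis no_editable_component :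
  forall v (Z : {set T}), v \in X -> v \in Z -> closed G (mem Z) -> ~ editable l G Z 0.

Lemma class_touched v : v \in X -> c v \in c @: S.
Proof.
move=> vX; apply: contraT => cv.
have [|cl ed] := @untouched_class_editable (c v).
  rewrite disjoint_subset; apply/subsetP => x; rewrite !inE => /eqP e.
  by apply: contra cv => xS; rewrite -e; apply: imset_f.
by case: (no_editable_component vX _ cl ed); rewrite in_label_class inE eqxx.
Qed.

Lemma card_le_touched : #|X| <= #|S| + #|S| * (l * (2 * k + 2)).
Proof.
rewrite -(cardsID S X); apply: leq_add; first exact: subset_leq_card (subsetIr _ _).
apply: (@leq_trans (#|c @: (X :\: S)| * (l * (2 * k + 2)))).
  by apply: card_le_fibers => z _; apply: card_untouched_class.
rewrite leq_mul2r; apply/orP; right; apply: leq_trans (leq_imset_card c S).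
by apply/subset_leq_card/subsetP => _ /imsetP[v /setDP[/class_touched + _] ->].
Qed.

End UntouchedBound.

(** * Recognising complete multipartite components *)

Section ClassRepresentatives.
Variables (n : nat) (A : eqType) (f : 'I_n -> A).

Definition class_rep v : 'I_n := [arg min_(u < v | f u == f v) u].

Lemma class_repK v : f (class_rep v) = f v.
Proof. by rewrite /class_rep; case: arg_minnP => // u /eqP. Qed.

Lemma class_rep_le u v : f u = f v -> class_rep v <= u.
Proof. by move/eqP; rewrite /class_rep; case: arg_minnP => // w _; apply. Qed.

Lemma class_rep_eq u v : (class_rep u == class_rep v) = (f u == f v).
Proof.
apply/eqP/eqP => [e|e]; first by rewrite -(class_repK u) e class_repK.
by apply/val_inj/eqP; rewrite eqn_leq !class_rep_le // class_repK.
Qed.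

Definition representatives : {set 'I_n} := [set u | class_rep u == u].

Lemma mem_class_rep v : class_rep v \in representatives.
Proof. by rewrite inE class_rep_eq class_repK. Qed.

Lemma representatives_inj : {in representatives &, injective f}.
Proof.
move=> u v; rewrite !inE => /eqP eu /eqP ev /eqP.
by rewrite -class_rep_eq eu ev => /eqP.
Qed.

End ClassRepresentatives.

Section Recognition.
Variables (n l : nat) (G : sgraph 'I_n).
Implicit Types (u v w x y : 'I_n) (f : 'I_n -> 'I_n) (Z : {set 'I_n}).

Definition cnbhd_min f v : 'I_n := f [arg min_(u < v in cnbhd G v) f u].

(* The least vertex within distance 2 of [v]; it identifies the component of [v]
   as soon as that component has diameter at most 2. *)
Definition root : 'I_n -> 'I_n := cnbhd_min (cnbhd_min id).

Definition root_class r : {set 'I_n} := [set u | root u == r].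

Definition twins v : {set 'I_n} := [set u | nbhd G u == nbhd G v].

Definition crossing r : {set 'I_n * 'I_n} :=
  [set q | [&& G q.1 q.2, root q.1 != root q.2 & root q.1 == r]].

Definition irregular r : {set 'I_n} :=
  [set v | (#|nbhd G v| + #|twins v| != #|root_class (root v)|) && (root v == r)].

Definition parts r : {set 'I_n} := representatives (nbhd G) :&: root_class r.

Definition recognized : {set 'I_n} :=
  [set v | (nbhd G v == set0) ||
    [&& crossing (root v) == set0, irregular (root v) == set0 &
        (#|parts (root v)| <= l) || (#|root_class (root v)| <= #|parts (root v)|)]].

Lemma cnbhd_refl v : v \in cnbhd G v.
Proof. by rewrite in_cnbhd eqxx. Qed.

Lemma cnbhd_sym u v : (u \in cnbhd G v) = (v \in cnbhd G u).
Proof. by rewrite !in_cnbhd eq_sym adj_sym. Qed.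

Lemma cnbhd_min_le f u v : u \in cnbhd G v -> cnbhd_min f v <= f u.
Proof.
by rewrite /cnbhd_min; case: arg_minnP => [|w _]; [exact: cnbhd_refl | apply].
Qed.

Lemma cnbhd_minP f v : exists2 u, u \in cnbhd G v & cnbhd_min f v = f u.
Proof.
rewrite /cnbhd_min; case: arg_minnP => [|w wv _]; first exact: cnbhd_refl.
by exists w.
Qed.

Lemma root_near v : exists2 x, x \in cnbhd G v & root v \in cnbhd G x.
Proof.
have [x xv e] := cnbhd_minP (cnbhd_min id) v; have [y yx e'] := cnbhd_minP id x.
by exists x; rewrite // /root e e'.
Qed.

Lemma root_le v x y : x \in cnbhd G v -> y \in cnbhd G x -> root v <= y.
Proof.
by move=> xv yx; apply: leq_trans (cnbhd_min_le _ xv) (cnbhd_min_le id yx).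
Qed.

Lemma isolated_cnbhd v : nbhd G v = set0 -> cnbhd G v = [set v].
Proof. by rewrite /cnbhd => ->; rewrite setU0. Qed.

Lemma isolated_root x y : nbhd G x = set0 -> root y = root x -> y = x.
Proof.
move/isolated_cnbhd => cx e.
have rx : root x = x.
  by have [a] := root_near x; rewrite cx => /set1P->; rewrite cx => /set1P.
have [a + ra] := root_near y; move: ra; rewrite e rx cnbhd_sym cx => /set1P->.
by rewrite cnbhd_sym cx => /set1P.
Qed.

Lemma nbhd_neq0 u v : G u v -> nbhd G u != set0.
Proof. by move=> uv; apply/set0Pn; exists v; rewrite in_nbhd. Qed.

Lemma recognized_nonisolated v : nbhd G v != set0 -> (v \in recognized) =
  [&& crossing (root v) == set0, irregular (root v) == set0 &
      (#|parts (root v)| <= l) || (#|root_class (root v)| <= #|parts (root v)|)].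
Proof. by move=> ne; rewrite inE (negbTE ne). Qed.

Lemma recognized_root u v : v \in recognized -> G v u -> root u = root v.
Proof.
move=> + vu; rewrite (recognized_nonisolated (nbhd_neq0 vu)) => /and3P[/eqP/setP h _ _].
have := h (v, u); rewrite !inE vu eqxx andbT /= => /negbFE/eqP-> //.
Qed.

Lemma recognized_root_class u v : v \in recognized -> nbhd G v != set0 ->
  root u = root v -> nbhd G u != set0 /\ u \in recognized.
Proof.
move=> rv nv e; have nu : nbhd G u != set0.
  by apply: contra nv => /eqP iu; rewrite (isolated_root iu (esym e)) iu.
by split=> //; move: rv; rewrite !recognized_nonisolated // e.
Qed.

Lemma recognized_closed : closed G (mem recognized).
Proof.
apply: (intro_closed (@connect_adj_sym _ G)) => x y xy rx.
by have [] := recognized_root_class rx (nbhd_neq0 xy) (recognized_root rx xy).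
Qed.

Lemma recognized_twin_root u v : v \in recognized -> nbhd G v != set0 ->
  nbhd G u = nbhd G v -> root u = root v.
Proof.
move=> rv /set0Pn[a va] e; have ua : G u a by rewrite -in_nbhd e.
rewrite in_nbhd in va; rewrite -(recognized_root rv va).
by apply: recognized_root; rewrite 1?adj_sym // -(recognized_closed va).
Qed.

Lemma recognized_cover v : v \in recognized -> nbhd G v != set0 ->
  nbhd G v :|: twins v = root_class (root v).
Proof.
move=> rv nv; apply/eqP; rewrite eqEcard; apply/andP; split.
  apply/subsetP => u; rewrite in_setU in_nbhd !inE => /orP[/(recognized_root rv)->//|/eqP tu].
  by rewrite (recognized_twin_root rv nv tu).
rewrite cardsU (_ : nbhd G v :&: twins v = set0) ?cards0 ?subn0.
  move: rv; rewrite (recognized_nonisolated nv) => /and3P[_ /eqP/setP/(_ v) + _].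
  by rewrite !inE eqxx andbT => /negbFE/eqP->.
apply/setP => u; rewrite in_setI in_nbhd !inE; apply/andP => -[vu /false_twins_nonadjacent].
by rewrite adj_sym vu.
Qed.

Lemma recognized_joined :
  {in recognized &, forall x y, G x y = joined root (nbhd G) x y}.
Proof.
move=> x y rx ry; rewrite /joined; have [iso|nx] := eqVneq (nbhd G x) set0.
  have -> : G x y = false by rewrite -in_nbhd iso inE.
  apply/esym/negP => /andP[/eqP e].
  by rewrite (isolated_root iso (esym e)) eqxx.
apply/idP/andP => [xy|[/eqP e ne]].
  rewrite (recognized_root rx xy) eqxx; split=> //; apply: contraTN xy => /eqP e.
  by rewrite -in_nbhd e in_nbhd adj_irr.
have : y \in root_class (root x) by rewrite inE e.
by rewrite -(recognized_cover rx nx) in_setU in_nbhd inE eq_sym (negbTE ne) orbF.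
Qed.

Lemma recognized_admissible r :
  admissible l (nbhd G) (label_class recognized root r).
Proof.
set A := label_class _ _ _; have AP u : u \in A -> u \in recognized /\ root u = r.
  by rewrite in_label_class => /andP[? /eqP].
have [/exists_inP[x /AP[rx rootx] nx]|/exists_inPn iso] :=
    boolP [exists x in A, nbhd G x != set0]; last first.
  left=> u v /AP[_ ru] vA _; have [_ rv] := AP v vA.
  by apply: isolated_root; [exact/eqP/negbNE/iso | rewrite rv].
have nA u : u \in A -> nbhd G u != set0.
  by case/AP => _ ru; case: (recognized_root_class rx nx (u := u)); rewrite ?ru.
have sA : A \subset root_class r by apply/subsetP => u /AP[_ ru]; rewrite inE ru.
have := rx; rewrite recognized_nonisolated // rootx => /and3P[_ _ /orP[le|le]].
  right; apply: leq_trans le; apply: leq_trans (leq_imset_card (nbhd G) _).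
  apply/subset_leq_card/subsetP => _ /imsetP[u uA ->]; have [ru rootu] := AP u uA.
  rewrite -(class_repK (nbhd G) u); apply: imset_f; rewrite in_setI mem_class_rep inE.
  by rewrite (recognized_twin_root ru (nA u uA)) ?class_repK ?rootu /=.
have eparts : parts r = root_class r by apply/eqP; rewrite eqEcard subsetIr.
left=> u v uA vA; apply: representatives_inj.
  by have := subsetP sA u uA; rewrite -eparts => /setIP[].
by have := subsetP sA v vA; rewrite -eparts => /setIP[].
Qed.

Lemma recognized_editable : editable l G recognized 0.
Proof.
exists 'I_n, {set 'I_n}, root, (nbhd G); split; first exact: recognized_admissible.
exact/no_conflicts/recognized_joined.
Qed.

Section MultipartiteComponent.
Variables (P : finType) (p : 'I_n -> P) (K : {set 'I_n}).
Hypotheses (adjK : {in K, forall x y, G x y = (y \in K) && (p x != p y)})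
  (two_parts : {in K, forall x, exists2 y, y \in K & p x != p y}).

Lemma cnbhd_in x y : x \in K -> y \in cnbhd G x -> y \in K.
Proof. by move=> xK; rewrite in_cnbhd => /orP[/eqP->//|]; rewrite adjK // => /andP[]. Qed.

Lemma within_distance2 x y : x \in K -> y \in K ->
  exists2 a, a \in cnbhd G x & y \in cnbhd G a.
Proof.
move=> xK yK; have [e|ne] := eqVneq (p x) (p y); last first.
  by exists x; rewrite ?cnbhd_refl // in_cnbhd adjK // yK ne orbT.
have [a aK na] := two_parts xK; exists a; rewrite in_cnbhd adjK //.
  by rewrite aK na orbT.
by rewrite yK -e [p a == _]eq_sym na orbT.
Qed.

Lemma root_in x : x \in K -> root x \in K.
Proof. by move=> xK; have [a ax ra] := root_near x; apply: cnbhd_in (cnbhd_in xK ax) ra. Qed.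

Lemma root_constant x y : x \in K -> y \in K -> root x = root y.
Proof.
have le u v : u \in K -> v \in K -> root u <= root v.
  move=> uK vK; have [a au va] := within_distance2 uK (root_in vK).
  exact: root_le au va.
by move=> xK yK; apply/val_inj/eqP; rewrite eqn_leq !le.
Qed.

Lemma root_class_component x : x \in K -> root_class (root x) = K.
Proof.
move=> xK; apply/setP => y; rewrite inE; apply/eqP/idP => [e|yK]; last exact: root_constant.
have [a ay ra] := root_near y; rewrite e cnbhd_sym in ra; rewrite cnbhd_sym in ay.
by apply: (cnbhd_in _ ay); apply: (cnbhd_in _ ra); apply: root_in.
Qed.

Lemma twins_component x : x \in K -> twins x = [set u in K | p u == p x].
Proof.
move=> xK; have [a aK na] := two_parts xK; apply/setP => u; rewrite !inE.
apply/nbhd_eqP/andP => [tw|[uK /eqP e] y]; last by rewrite !adjK // e.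
have uK : u \in K by apply: (cnbhd_in aK); rewrite in_cnbhd adj_sym tw adjK // aK na orbT.
by split=> //; have := tw u; rewrite adj_irr adjK // uK eq_sym => /esym/negbFE.
Qed.

Lemma recognized_component x : admissible l p K -> x \in K -> x \in recognized.
Proof.
move=> adm xK; have nx : nbhd G x != set0.
  by have [a aK na] := two_parts xK; apply: (@nbhd_neq0 _ a); rewrite adjK // aK.
have rc := root_class_component xK; rewrite recognized_nonisolated // rc.
have inK u : root u == root x -> u \in K by rewrite -rc inE.
apply/and3P; split.
- apply/eqP/setP => -[u v]; rewrite !inE /=; apply/and3P => -[uv ne /inK uK].
  by rewrite (root_constant (x := u) (y := v)) ?eqxx // in ne; move: uv; rewrite adjK // => /andP[].
- apply/eqP/setP => u; rewrite !inE; apply/andP => -[/eqP ne /inK uK]; case: ne.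
  have -> : nbhd G u = K :\: twins u.
    apply/setP => v; rewrite in_nbhd adjK // twins_component // !inE.
    by case: (v \in K); rewrite //= andbT eq_sym.
  have sub : twins u \subset K.
    by apply/subsetP => v; rewrite twins_component // inE => /andP[].
  by rewrite root_class_component // -(cardsID (twins u) K) (setIidPr sub) addnC.
case: adm => [inj|le]; apply/orP; [right | left].
  apply/subset_leq_card/subsetP => u uK; rewrite in_setI rc uK andbT inE.
  have : class_rep (nbhd G) u \in twins u by rewrite inE class_repK.
  by rewrite twins_component // inE => /andP[rK /eqP e]; rewrite (inj _ _ rK uK e).
apply: leq_trans le; rewrite /parts rc -(card_in_imset (f := p) (D := _ :&: K)).
  exact/subset_leq_card/imsetS/subsetIr.
move=> u v /setIP[ur uK] /setIP[vr vK] e; apply: representatives_inj ur vr _.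
by have : u \in twins v by [rewrite twins_component // inE uK e eqxx]; rewrite inE => /eqP.
Qed.

End MultipartiteComponent.

Lemma editable_recognized Z v : v \in Z -> closed G (mem Z) -> editable l G Z 0 ->
  v \in recognized.
Proof.
move=> vZ clZ [C [P [c [p [adm /no_conflicts GE]]]]].
have [iso|/set0Pn[v' vv']] := eqVneq (nbhd G v) set0; first by rewrite inE iso eqxx.
pose K := label_class Z c (c v).
have adjK : {in K, forall x y, G x y = (y \in K) && (p x != p y)}.
  move=> x; rewrite in_label_class => /andP[xZ /eqP cx] y; rewrite in_label_class.
  have [yZ|yZ] := boolP (y \in Z); first by rewrite GE // /joined cx eq_sym.
  by apply: contraNF yZ => /clZ <-.
have vK : v \in K by rewrite in_label_class vZ eqxx.
have : G v v' by rewrite -in_nbhd.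
rewrite adjK // => /andP[v'K pvv'].
apply: (recognized_component adjK _ (adm (c v)) vK) => x xK.
by have [e|ne] := eqVneq (p x) (p v); [exists v'; rewrite // e | exists v].
Qed.

End Recognition.

Section Kernel.
Variables (n l k : nat) (G : sgraph 'I_n).
Hypothesis l_gt1 : 1 < l.

Definition false_twin_kernel : {set 'I_n} :=
  truncate (nbhd G) (~: recognized l G) (2 * k + 2).

Definition kernel : {set 'I_n} := truncate (cnbhd G) false_twin_kernel (2 * k + l.+1).

Lemma kernel_equiv : yes_instance l G k <-> yes_instance l (induced G kernel) k.
Proof.
rewrite !yes_instanceE editable_induced.
have step1 := editable_truncate (~: recognized l G)
  (fun Z v vZ le => editable_add_false_twin (ltnW l_gt1) vZ le (k := k)).
have step2 := editable_truncate false_twin_kernel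
  (fun Z v vZ le => editable_add_true_twin vZ le (l := l) (k := k)).
rewrite -step2 -step1; split; first exact/editable_sub/subsetT.
exact: (editable_union (@recognized_closed _ l G) (recognized_editable l G) (j := k)).
Qed.

Lemma card_kernel : yes_instance l G k -> #|kernel| <= 10 * l * k ^ 2.
Proof.
rewrite yes_instanceE => -[C [P [c [p [adm cD]]]]].
have sub : kernel \subset false_twin_kernel by apply: truncate_sub.
have le : #|kernel| <= #|touched G setT c p| + #|touched G setT c p| * (l * (2 * k + 2)).
  apply: (card_le_touched adm l_gt1) => [v|v|v Z vX vZ clZ edZ].
  - apply: leq_trans (truncate_le (nbhd G) (~: recognized l G) _ (nbhd G v)).
    apply/subset_leq_card/subsetP => u; rewrite in_set => /andP[/(subsetP sub) uF tu].
    by rewrite inE uF tu.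
  - exact: truncate_le.
  have := subsetP (truncate_sub _ _ _) _ (subsetP sub v vX).
  by rewrite in_setC (editable_recognized vZ clZ edZ).
apply: leq_trans le _; have := leq_trans (card_touched G setT c p) cD.
by case: (k) => [|k']; nia.
Qed.

End Kernel.

(** * Total correctness of programs with time bounds *)

Lemma upd_same (V : Type) (f : nat -> V) i v : upd f i v i = v.
Proof. by rewrite /upd eqxx. Qed.

Lemma upd_other (V : Type) (f : nat -> V) i v j : j != i -> upd f i v j = f j.
Proof. by rewrite /upd => /negbTE->. Qed.

Ltac upd_simpl :=
  rewrite /=; repeat match goal with
  | |- context [upd ?f ?i ?v ?j] =>
      (rewrite (@upd_other _ f i v j); last by lia) ||
      (rewrite (_ : upd f i v j = v); last by rewrite /upd; case: eqP => //; lia)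
  end.

Fixpoint written_regs c : seq nat :=
  match c with
  | Skip | Put _ _ _ => [::]
  | Asg x _ => [:: x]
  | Seq c1 c2 | If _ _ c1 c2 => written_regs c1 ++ written_regs c2
  | While _ _ c => written_regs c
  end.

Fixpoint written_arrs c : seq nat :=
  match c with
  | Skip | Asg _ _ => [::]
  | Put a _ _ => [:: a]
  | Seq c1 c2 | If _ _ c1 c2 => written_arrs c1 ++ written_arrs c2
  | While _ _ c => written_arrs c
  end.

Fixpoint avoids (R A : seq nat) e : bool :=
  match e with
  | Cst _ => true
  | Reg x => x \notin R
  | Get a e => (a \notin A) && avoids R A e
  | Plus e1 e2 | Minus e1 e2 => avoids R A e1 && avoids R A e2
  end.

Definition frame (R A : seq nat) s s' :=
  (forall r, r \notin R -> regs s' r = regs s r) /\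
  (forall a, a \notin A -> arrs s' a = arrs s a).

Lemma frame_trans R A s1 s2 s3 :
  frame R A s1 s2 -> frame R A s2 s3 -> frame R A s1 s3.
Proof. by move=> [r1 a1] [r2 a2]; split=> x h; rewrite ?r2 ?a2 ?r1 ?a1. Qed.

Lemma frame_sub (R R' A A' : seq nat) s s' :
  {subset R <= R'} -> {subset A <= A'} -> frame R A s s' -> frame R' A' s s'.
Proof.
by move=> sR sA [r a]; split=> x nx; [apply: r | apply: a]; apply: contra nx; auto.
Qed.

Lemma frame_set_reg s x v : frame [:: x] [::] s (set_reg s x v).
Proof. by split=> // r; rewrite inE => ne; rewrite /= upd_other. Qed.

Lemma frame_set_arr s a i v : frame [::] [:: a] s (set_arr s a i v).
Proof. by split=> // b; rewrite inE => ne; rewrite /= upd_other. Qed.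

Section Logic.
Variable W : nat.
Implicit Types (s : state) (c : cmd) (e : expr) (Q : state -> Prop).

Lemma exec_frame c s t s' :
  exec W c s t s' -> frame (written_regs c) (written_arrs c) s s'.
Proof.
have catl (A B : seq nat) : {subset A <= A ++ B} by move=> x xA; rewrite mem_cat xA.
have catr (A B : seq nat) : {subset B <= A ++ B}.
  by move=> x xB; rewrite mem_cat xB orbT.
elim=> {c s t s'} //=.
- by move=> s x e _; apply: frame_set_reg.
- by move=> s a e1 e2 _ _; apply: frame_set_arr.
- move=> s1 s2 s3 c1 c2 t1 t2 _ f1 _ f2; apply: frame_trans.
    exact: frame_sub (catl _ _) (catl _ _) f1.
  exact: frame_sub (catr _ _) (catr _ _) f2.
- by move=> s s' e1 e2 c1 c2 t _ _ _ _; apply: frame_sub.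
- by move=> s s' e1 e2 c1 c2 t _ _ _ _; apply: frame_sub.
by move=> s s1 s2 e1 e2 c t1 t2 _ _ _ _ f1 _; apply: frame_trans.
Qed.

Definition run c s t Q : Prop :=
  exists t' s', [/\ exec W c s t' s', t' <= t & Q s'].

Lemma run_weaken c s t t' Q Q' :
  t <= t' -> (forall s', Q s' -> Q' s') -> run c s t Q -> run c s t' Q'.
Proof.
by move=> le h [u [s1 [x1 l1 q]]]; exists u, s1; split; [|exact: leq_trans le|exact: h].
Qed.

Lemma run_frame c s t Q : run c s t Q ->
  run c s t (fun s' => Q s' /\ frame (written_regs c) (written_arrs c) s s').
Proof.
by case=> [u [s1 [x1 l1 q]]]; exists u, s1; split=> //; split=> //; apply: exec_frame x1.
Qed.

Lemma run_seq c1 c2 s t1 t2 Q :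
  run c1 s t1 (fun s1 => run c2 s1 t2 Q) -> run (Seq c1 c2) s (t1 + t2) Q.
Proof.
case=> [u1 [s1 [x1 l1 [u2 [s2 [x2 l2 q]]]]]].
by exists (u1 + u2), s2; split; [econstructor; eauto | apply: leq_add |].
Qed.

Lemma run_then c1 c2 s t1 t2 (R Q : state -> Prop) : run c1 s t1 R ->
  (forall s1, R s1 -> run c2 s1 t2 Q) -> run (Seq c1 c2) s (t1 + t2) Q.
Proof. by move=> r1 r2; apply/run_seq/(run_weaken (leqnn _) r2). Qed.

Definition denotes s e v := fits W s e /\ eval s e = v.

Lemma fits_le s e : fits W s e -> eval s e <= W.
Proof. by case: e => [c|x|a e|e1 e2|e1 e2] /= /andP[]. Qed.

Lemma denotes_le s e v : denotes s e v -> v <= W.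
Proof. by case=> fe <-; apply: fits_le. Qed.

Lemma denotes_frame R A s s' e v :
  frame R A s s' -> avoids R A e -> denotes s e v -> denotes s' e v.
Proof.
move=> [fr fa]; suff same : avoids R A e -> fits W s' e = fits W s e /\ eval s' e = eval s e.
  by move=> /same[ef ee]; rewrite /denotes ef ee.
elim: e {v} => [c|x|a e IH|e1 IH1 e2 IH2|e1 IH1 e2 IH2] //=.
- by move=> /fr->.
- by move=> /andP[/fa-> /IH[-> ->]].
- by move=> /andP[/IH1[-> ->] /IH2[-> ->]].
by move=> /andP[/IH1[-> ->] /IH2[-> ->]].
Qed.

Lemma denotes_cst s (c : nat) : c <= W -> denotes s (Cst c) c.
Proof. by move=> le; rewrite /denotes /= le. Qed.

Lemma denotes_reg s x v : regs s x = v -> v <= W -> denotes s (Reg x) v.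
Proof. by move=> <- le; rewrite /denotes /= le. Qed.

Lemma denotes_get s a e i v :
  denotes s e i -> arrs s a i = v -> v <= W -> denotes s (Get a e) v.
Proof. by move=> [fe ee] <- le; rewrite /denotes /= fe ee le. Qed.

Lemma denotes_plus s e1 e2 v1 v2 : denotes s e1 v1 -> denotes s e2 v2 ->
  v1 + v2 <= W -> denotes s (Plus e1 e2) (v1 + v2).
Proof. by move=> [f1 e1'] [f2 e2'] le; rewrite /denotes /= f1 f2 e1' e2' le. Qed.

Lemma denotes_minus s e1 e2 v1 v2 : denotes s e1 v1 -> denotes s e2 v2 ->
  denotes s (Minus e1 e2) (v1 - v2).
Proof.
move=> [f1 e1'] [f2 e2']; rewrite /denotes /= f1 f2 e1' e2' !andbT; split=> //.
by apply: leq_trans (leq_subr _ _) _; rewrite -e1' fits_le.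
Qed.

(* Meaningful for loop-free programs only. *)
Fixpoint cost c : nat :=
  match c with
  | Skip => 1
  | Asg _ e => (ecost e).+1
  | Put _ e1 e2 => (ecost e1 + ecost e2).+1
  | Seq c1 c2 => cost c1 + cost c2
  | If e1 e2 c1 c2 => (ecost e1 + ecost e2 + (cost c1 + cost c2)).+1
  | While _ _ _ => 0
  end.

Definition wp c Q s : Prop := run c s (cost c) Q.

Lemma wp_weaken c Q Q' s : (forall s', Q s' -> Q' s') -> wp c Q s -> wp c Q' s.
Proof. exact: run_weaken. Qed.

Lemma wp_skip Q s : Q s -> wp Skip Q s.
Proof. by exists 1, s; split=> //; constructor. Qed.

Lemma wp_asg x e v Q s : denotes s e v -> Q (set_reg s x v) -> wp (Asg x e) Q s.
Proof. by move=> [fe <-] q; do 2 eexists; split; [constructor | | exact: q]. Qed.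

Lemma wp_put a e1 e2 i v Q s : denotes s e1 i -> denotes s e2 v ->
  Q (set_arr s a i v) -> wp (Put a e1 e2) Q s.
Proof.
by move=> [f1 <-] [f2 <-] q; do 2 eexists; split; [constructor | | exact: q].
Qed.

Lemma wp_seq c1 c2 Q s : wp c1 (wp c2 Q) s -> wp (Seq c1 c2) Q s.
Proof. exact: run_seq. Qed.

Lemma wp_if e1 e2 c1 c2 v1 v2 Q s : denotes s e1 v1 -> denotes s e2 v2 ->
  (v1 <= v2 -> wp c1 Q s) -> (v2 < v1 -> wp c2 Q s) -> wp (If e1 e2 c1 c2) Q s.
Proof.
move=> [f1 <-] [f2 <-]; case: leqP => le h1 h2.
  have [t [s' [x lt q]]] := h1 isT; exists (ecost e1 + ecost e2 + t).+1, s'.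
  by split=> //; [apply: ExecIfT | rewrite /=; lia].
have [t [s' [x lt q]]] := h2 isT; exists (ecost e1 + ecost e2 + t).+1, s'.
by split=> //; [apply: ExecIfF | rewrite /=; lia].
Qed.

Definition For (x : nat) c : cmd :=
  Seq (Asg 3 (Cst 0))
    (While (Plus (Reg 3) (Cst 1)) (Reg x)
       (Seq c (Asg 3 (Plus (Reg 3) (Cst 1))))).

Lemma run_while_foreach (X : Type) (E : seq X) (I : seq X -> state -> Prop) x c s0 :
  regs s0 x = size E -> size E < W -> x \notin 3 :: written_regs c ->
  3 \notin written_regs c ->
  (forall t q u s, E = t ++ q :: u ->
     frame (3 :: written_regs c) (written_arrs c) s0 s -> regs s 3 = size t -> I t s ->
     wp c (fun s' => I (rcons t q) (set_reg s' 3 (size t).+1)) s) ->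
  forall u t s, E = t ++ u ->
    frame (3 :: written_regs c) (written_arrs c) s0 s -> regs s 3 = size t -> I t s ->
    run (While (Plus (Reg 3) (Cst 1)) (Reg x) (Seq c (Asg 3 (Plus (Reg 3) (Cst 1)))))
      s ((cost c + 10) * size u + 5) (I E).
Proof.
move=> ex EW nx n3 step; elim=> [|q u IH] t s eE fr e3 It.
  rewrite cats0 in eE; exists 5, s; rewrite eE muln0; split=> //.
  by apply: ExecWhileF; rewrite /= ?(proj1 fr x nx) ?ex ?e3 -?eE; lia.
have tE : size t < size E by rewrite eE size_cat /= addnS ltnS leq_addr.
have [t1 [s1 [x1 l1 [I1 fr1]]]] := run_frame (step t q u s eE fr e3 It).
have e31 : regs s1 3 = size t by rewrite (proj1 fr1).
have fr2 : frame (3 :: written_regs c) (written_arrs c) s0 (set_reg s1 3 (size t).+1).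
  apply: frame_trans fr _; apply: (@frame_trans _ _ _ s1).
    by apply: frame_sub fr1 => // r; rewrite inE orbC => ->.
  by apply: frame_sub (frame_set_reg _ _ _) => // r; rewrite !inE => ->.
have [||t2 [s2 [x2 l2 IE]]] := IH (rcons t q) _ _ fr2 _ I1.
- by rewrite cat_rcons.
- by rewrite /= upd_same size_rcons.
exists (ecost (Plus (Reg 3) (Cst 1)) + ecost (Reg x) + (t1 + 4) + t2).+1, s2.
split=> //; last by rewrite /= mulnS; lia.
apply: (ExecWhileT (s1 := set_reg s1 3 (size t).+1)) x2;
  rewrite /= ?(proj1 fr x nx) ?ex ?e3; try lia.
have -> : (size t).+1 = eval s1 (Plus (Reg 3) (Cst 1)) by rewrite /= e31 addn1.
by apply: ExecSeq x1 _; apply: ExecAsg; rewrite /= e31; lia.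
Qed.

Lemma run_foreach (X : Type) (E : seq X) (I : seq X -> state -> Prop) x c s :
  regs s x = size E -> size E < W -> x \notin 3 :: written_regs c ->
  3 \notin written_regs c -> I [::] (set_reg s 3 0) ->
  (forall t q u s', E = t ++ q :: u ->
     frame (3 :: written_regs c) (written_arrs c) s s' -> regs s' 3 = size t -> I t s' ->
     wp c (fun s'' => I (rcons t q) (set_reg s'' 3 (size t).+1)) s') ->
  run (For x c) s ((cost c + 10) * (size E).+1) (I E).
Proof.
move=> ex EW nx n3 I0 step.
have fr : frame (3 :: written_regs c) (written_arrs c) s (set_reg s 3 0).
  by apply: frame_sub (frame_set_reg _ _ _) => // r; rewrite !inE => ->.
have [t [s' [x1 l1 IE]]] :=
  run_while_foreach ex EW nx n3 step (t := [::]) (erefl _) fr (erefl _) I0.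
exists (2 + t), s'; split=> //; last by rewrite mulnS; lia.
by apply: ExecSeq x1; apply: ExecAsg.
Qed.

End Logic.

(** * Adjacency lists as lists of pairs *)

Section OrdinalPrefixes.
Variables (n : nat) (t s : seq 'I_n) (v : 'I_n).
Hypothesis e : enum 'I_n = t ++ v :: s.

Lemma size_enum_ord_prefix : size t = v.
Proof.
have tn : size t < n by rewrite -[X in _ < X]size_enum_ord e size_cat /= addnS ltnS leq_addr.
by have := nth_enum_ord v tn; rewrite e nth_cat ltnn subnn.
Qed.

Lemma mem_enum_ord_prefix w : (w \in t) = (w < v).
Proof.
rewrite -(index_enum_ord w) e index_cat -size_enum_ord_prefix.
by case: ifP => wt; rewrite ?index_mem ?wt // ltnNge leq_addr.
Qed.

Lemma count_enum_ord_prefix (P : pred 'I_n) : count P t = #|[set w | P w & w < v]|.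
Proof.
have ut : uniq t by have := enum_uniq 'I_n; rewrite e cat_uniq => /and3P[].
rewrite -size_filter -(card_uniqP (filter_uniq P ut)); apply: eq_card => w.
by rewrite inE mem_filter mem_enum_ord_prefix.
Qed.

End OrdinalPrefixes.

Lemma count_enum (T : finType) (P : pred T) : count P (enum T) = #|[set x | P x]|.
Proof. by rewrite cardsE cardE size_filter -enumT. Qed.

Lemma filter_enum_in (T : finType) (X : {set T}) : [seq x <- enum T | x \in X] = enum X.
Proof. by rewrite {1}/enum_mem -filter_predI; apply: eq_filter => x; rewrite /= andbT. Qed.

Lemma map_enum_val (T : finType) (X : {set T}) : [seq enum_val i | i <- enum 'I_#|X|] = enum X.
Proof.
have sz : size [seq enum_val i | i <- enum 'I_#|X|] = size (enum X).
  by rewrite size_map size_enum_ord -cardE.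
case: (set_0Vmem X) => [X0|[x0 _]].
  have e0 : size (enum X) = 0 by rewrite -cardE X0 cards0.
  by rewrite (size0nil e0); apply: size0nil; rewrite sz.
apply: (eq_from_nth (x0 := x0)) => // i; rewrite size_map size_enum_ord => iX.
by rewrite (nth_map (Ordinal iX)) ?size_enum_ord // (nth_ord_enum _ (Ordinal iX)) (enum_val_nth x0).
Qed.

Definition rank n (X : {set 'I_n}) (v : 'I_n) := #|[set w in X | w < v]|.

Lemma enum_rank_in_rank n (X : {set 'I_n}) x (xX : x \in X) v :
  v \in X -> enum_rank_in xX v = rank X v :> nat.
Proof.
move=> vX; have vn : v \in enum 'I_n by rewrite mem_enum.
case/path.splitPr e: {1}(enum 'I_n) / vn => [t s].
have vt : v \notin t by rewrite (mem_enum_ord_prefix e) ltnn.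
rewrite -[LHS](index_uniq v (s := enum X)) ?enum_uniq -?cardE // nth_enum_rank_in //.
rewrite -filter_enum_in e filter_cat /= vX index_cat mem_filter (negbTE vt) andbF.
by rewrite /= eqxx addn0 size_filter (count_enum_ord_prefix e).
Qed.

Definition pairs n (nb : 'I_n -> seq 'I_n) : seq ('I_n * 'I_n) :=
  [seq (v, u) | v <- enum 'I_n, u <- v :: nb v].

Section Pairs.
Variables (n : nat) (G : sgraph 'I_n) (nb : 'I_n -> seq 'I_n).
Hypothesis nbP : forall v, uniq (nb v) /\ nb v =i G v.

Lemma mem_nb v u : (u \in nb v) = G v u.
Proof. by have [_ ->] := nbP v. Qed.

Lemma mem_pairs v u : ((v, u) \in pairs nb) = (u \in cnbhd G v).
Proof.
rewrite in_cnbhd -mem_nb; apply/allpairsPdep/idP => [[v' [u' [_ + [-> ->]]]]|uv].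
  by rewrite inE.
by exists v, u; rewrite mem_enum inE.
Qed.

Lemma pairs_uniq : uniq (pairs nb).
Proof.
apply: allpairs_uniq_dep => [|v _|[v u] [v' u'] _ _ /= [-> ->] //]; first exact: enum_uniq.
by rewrite /= mem_nb adj_irr; have [] := nbP v.
Qed.

Lemma count_pairs (P : pred ('I_n * 'I_n)) :
  count P (pairs nb) = #|[set q | (q.2 \in cnbhd G q.1) && P q]|.
Proof.
rewrite -size_filter -(card_uniqP (filter_uniq P pairs_uniq)); apply: eq_card => -[v u].
by rewrite inE mem_filter mem_pairs andbC.
Qed.

Lemma size_pairs : size (pairs nb) = n + 2 * #|edges G|.
Proof.
rewrite -count_predT count_pairs -card_edges -(cardsID [set q | q.1 == q.2]); congr (_ + _).
  rewrite -[RHS]card_ord -(card_imset _ (f := fun v : 'I_n => (v, v))); last by move=> v u [].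
  apply: eq_card => -[v u]; rewrite !inE andbT /=; apply/andP/imsetP => [[_ /eqP->]|[w _ [-> ->]]].
    by exists u.
  by rewrite eqxx.
apply: eq_card => -[v u]; rewrite !inE andbT /=.
by case: eqVneq => [->|ne] //=; rewrite adj_irr.
Qed.

Lemma pairs_sorted : sorted (fun q q' : 'I_n * 'I_n => q.1 <= q'.1) (pairs nb).
Proof.
rewrite sorted_pairwise; last by move=> a b c; apply: leq_trans.
have : sorted ltn (map val (enum 'I_n)) by rewrite val_enum_ord iota_ltn_sorted.
rewrite sorted_map sorted_pairwise; last by move=> a b c; apply: ltn_trans.
rewrite /pairs; elim: (enum 'I_n) => // v s IH; rewrite pairwise_cons allpairs_cons.
case/andP => /allP vs /IH {}IH; rewrite pairwise_cat IH andbT; apply/andP; split.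
  apply/allrelP => _ _ /mapP[u _ ->] /allpairsPdep[v' [u' [vs' _ ->]]].
  exact/ltnW/vs.
rewrite pairwise_map; apply/(pairwiseP v) => i j _ _ _; exact: leqnn.
Qed.

Lemma pairs_before t q s : pairs nb = t ++ q :: s -> forall q', q' \in t -> q'.1 <= q.1.
Proof.
have := pairs_sorted; rewrite sorted_pairwise; last by move=> a b c; apply: leq_trans.
move=> + e q' qt; rewrite e pairwise_cat => /and3P[/allrelP + _ _]; apply => //.
exact: mem_head.
Qed.

Lemma pairs_fresh t q s : pairs nb = t ++ q :: s -> q \notin t.
Proof.
move=> e; have := pairs_uniq; rewrite e cat_uniq => /and3P[_ /hasPn h _].
exact/h/mem_head.
Qed.

Definition word_item (q : 'I_n * 'I_n) : nat :=
  if q.1 == q.2 then size (nb q.1) else q.2.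

Lemma word_pairs : flatten [seq size (nb v) :: map val (nb v) | v <- enum 'I_n] =
  map word_item (pairs nb).
Proof.
rewrite map_flatten -map_comp; congr flatten; apply: eq_map => v /=.
rewrite /word_item /= eqxx -map_comp; congr cons; apply/eq_in_map => u /=.
by rewrite mem_nb; case: eqVneq => [->|//]; rewrite adj_irr.
Qed.

Definition degree_in (X : {set 'I_n}) v := #|nbhd G v :&: X|.

Definition output_item (X : {set 'I_n}) (q : 'I_n * 'I_n) : nat :=
  if q.1 == q.2 then degree_in X q.1 else rank X q.2.

Lemma filter_pairs (X : {set 'I_n}) :
  [seq q <- pairs nb | (q.1 \in X) && (q.2 \in X)] =
  [seq (v, u) | v <- enum X, u <- [seq u <- v :: nb v | u \in X]].
Proof.
rewrite -filter_enum_in /pairs; elim: (enum 'I_n) => // v s IH.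
rewrite allpairs_cons filter_cat IH filter_map.
rewrite -[[seq x <- v :: s | _]]/(if v \in X then _ else _); case: ifP => vX.
  rewrite allpairs_cons; congr (map _ _ ++ _).
  by apply: eq_filter => u; rewrite /= vX.
by rewrite (@eq_filter _ _ pred0) ?filter_pred0 // => u; rewrite /= vX.
Qed.

Lemma encodes_induced k (X : {set 'I_n}) : encodes (induced G X) k
  (#|X| :: k :: [seq output_item X q | q <- pairs nb & (q.1 \in X) && (q.2 \in X)]).
Proof.
pose nbX (i : 'I_#|X|) := [seq enum_rank_in (enum_valP i) u | u <- nb (enum_val i) & u \in X].
exists nbX; split=> [i|].
  split=> [|j].
    rewrite map_inj_in_uniq ?filter_uniq //; first by have [] := nbP (enum_val i).
    move=> u v; rewrite !mem_filter => /andP[uX _] /andP[vX _] e.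
    by rewrite -(enum_rankK_in (enum_valP i) uX) e enum_rankK_in.
  apply/mapP/idP => [[u + ->]|ij].
    by rewrite mem_filter mem_nb => /andP[uX]; rewrite unfold_in /= /induced_rel enum_rankK_in.
  by exists (enum_val j); rewrite ?enum_valK_in // mem_filter enum_valP mem_nb.
rewrite filter_pairs map_flatten -map_enum_val -!map_comp.
congr [:: _, _ & flatten _]; apply: eq_map => i /=.
have iX := enum_valP i; have loopless : enum_val i \notin nb (enum_val i).
  by rewrite mem_nb adj_irr.
rewrite iX /= /output_item eqxx -!map_comp; congr cons.
  have uniqX := filter_uniq (mem X) (proj1 (nbP (enum_val i))).
  rewrite size_map /degree_in -(card_uniqP uniqX).
  by apply: eq_card => u; rewrite inE in_nbhd mem_filter mem_nb andbC.
apply/eq_in_map => u; rewrite mem_filter => /andP[uX uv] /=.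
by rewrite eq_sym (negbTE (memPn loopless u uv)) enum_rank_in_rank.
Qed.

End Pairs.

(** * Partition refinement *)

Section Refinement.
Variable n : nat.
Implicit Types (L : seq ('I_n * 'I_n)) (u v w x : 'I_n) (A : 'I_n -> nat).

Definition hits L u : {set 'I_n} := [set w | (w, u) \in L].

Definition hits_before L v u : {set 'I_n} := [set w in hits L u | w < v].

(* Labels are refined by one pivot [v] at a time.  [A0] is the labelling, and [f0]
   the first unused label, when [v] became the pivot.  A label [t] stamped
   [S t = v.+1] is being split: its vertices met so far have moved to [N t]. *)
Record refining L v A0 f0 A (S N : nat -> nat) f : Prop := Refining {
  refining_le : forall q, q \in L -> q.1 <= v;
  refining_before : forall u x,
    (A0 u == A0 x) = (hits_before L v u == hits_before L v x);
  refining_before_lt : forall u, A0 u < f0;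
  refining_label : forall u, A u = if (v, u) \in L then N (A0 u) else A0 u;
  refining_stamp : forall t, t < f0 ->
    (S t = v.+1 <-> exists2 u, (v, u) \in L & A0 u = t);
  refining_stamp_le : forall t, S t <= v.+1;
  refining_new : forall u, (v, u) \in L -> f0 <= N (A0 u) < f;
  refining_new_inj : forall u x, (v, u) \in L -> (v, x) \in L ->
    N (A0 u) = N (A0 x) -> A0 u = A0 x;
  refining_fresh : f0 <= f <= (size L).+1 }.

Lemma refining_ext L v A0 f0 A A' S S' N N' f : A =1 A' -> S =1 S' -> N =1 N' ->
  refining L v A0 f0 A S N f -> refining L v A0 f0 A' S' N' f.
Proof.
move=> eA eS eN [? ? ? ? ? ? ? ? ?].
split=> // [u|t tf|t|u|u x]; rewrite -?eS -?eN -?eA; auto.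
Qed.

Lemma refining_nil v A S N : (forall u, A u = 0) -> (forall t, S t = 0) ->
  refining [::] v A 1 A S N 1.
Proof.
move=> A0 S0; split=> // [u x|u|t _|t]; rewrite ?A0 ?S0 //; last by split=> // -[].
by apply/esym/eqP/setP => w; rewrite !inE.
Qed.

Section Step.
Variables (L : seq ('I_n * 'I_n)) (v : 'I_n) (A0 A : 'I_n -> nat) (S N : nat -> nat).
Variables (f0 f : nat).
Hypothesis ref : refining L v A0 f0 A S N f.

Lemma refining_lt u : A u < f.
Proof.
have /andP[le _] := refining_fresh ref; rewrite (refining_label ref).
by case: ifP => [/(refining_new ref)/andP[]|_] //; apply: leq_trans (refining_before_lt ref u) le.
Qed.

Lemma refining_hits u x : (A u == A x) = (hits L u == hits L x).
Proof.
have lt y := refining_before_lt ref y.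
have hits_eq : (hits L u == hits L x) =
    (((v, u) \in L) == ((v, x) \in L)) && (A0 u == A0 x).
  rewrite (refining_before ref); apply/eqP/andP => [/setP e|[/eqP ev /eqP/setP e]].
    split; first by have := e v; rewrite !inE => ->.
    by apply/eqP/setP => w; have := e w; rewrite !inE => ->.
  apply/setP => w; have := e w; rewrite !inE; case: (ltngtP w v) => [_|lt_vw|/val_inj->] //.
    by rewrite !andbT.
  have none y : ((w, y) \in L) = false.
    by apply: contraTF lt_vw => /(refining_le ref) /=; rewrite -leqNgt.
  by rewrite !none.
rewrite hits_eq !(refining_label ref).
case: ifP => [uL|_]; case: ifP => [xL|_] //=.
- by apply/eqP/eqP => [|->//]; apply: (refining_new_inj ref).
- by apply/eqP => e; have := refining_new ref uL; have := lt x; lia.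
by apply/eqP => e; have := refining_new ref xL; have := lt u; lia.
Qed.

Lemma refining_next_pivot v' : v < v' -> refining L v' A f A S N f.
Proof.
move=> vv'; have none u : ((v', u) \in L) = false.
  by apply: contraTF vv' => /(refining_le ref) /=; rewrite -leqNgt.
split=> [q /(refining_le ref)|u x|u|u|t _|t|u|u x|].
- by move/leq_trans; apply; apply: ltnW.
- rewrite refining_hits; suff before y : hits_before L v' y = hits L y by rewrite !before.
  apply/setP => w; rewrite in_set andb_idr // inE => /(refining_le ref) /= le.
  exact: leq_ltn_trans le vv'.
- exact: refining_lt.
- by rewrite none.
- split=> [e|[u]]; last by rewrite none.
  by have := refining_stamp_le ref t; rewrite e; lia.
- exact: leq_trans (refining_stamp_le ref t) (leqW vv').
- by rewrite none.
- by rewrite none.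
by have := refining_fresh ref; lia.
Qed.

Variable u : 'I_n.
Hypothesis uL : (v, u) \notin L.

Lemma refining_label_unhit : A u = A0 u.
Proof. by rewrite (refining_label ref) (negbTE uL). Qed.

Lemma refining_move d S' N' f' :
  S' (A0 u) = v.+1 -> N' (A0 u) = d ->
  (forall t, t != A0 u -> S' t = S t /\ N' t = N t) ->
  f0 <= d < f' -> f <= f' <= f.+1 ->
  (forall x, (v, x) \in L -> (N (A0 x) == d) = (A0 x == A0 u)) ->
  refining (rcons L (v, u)) v A0 f0 (fun x => if x == u then d else A x) S' N' f'.
Proof.
move=> Su Nu off df ff' dN.
have mem x w : ((w, x) \in rcons L (v, u)) = ((w == v) && (x == u)) || ((w, x) \in L).
  by rewrite mem_rcons inE xpair_eqE.
have N'E x : (v, x) \in L -> N' (A0 x) = N (A0 x).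
  move=> xL; have [e|/off[]//] := eqVneq (A0 x) (A0 u).
  by rewrite e Nu; apply/esym/eqP; rewrite -e dN // e.
split=> [q|x y|x|x|t tf|t|x|x y|].
- by rewrite mem_rcons inE => /orP[/eqP->|/(refining_le ref)].
- rewrite (refining_before ref).
  suff before z : hits_before (rcons L (v, u)) v z = hits_before L v z by rewrite !before.
  apply/setP => w; rewrite !inE mem; case: eqVneq => [->|_] //=.
  by rewrite ltnn !andbF.
- exact: refining_before_lt ref x.
- rewrite mem eqxx; case: eqVneq => [->|_] /=; first by rewrite Nu.
  by rewrite (refining_label ref); case: ifP => // /N'E->.
- have [->|ne] := eqVneq t (A0 u).
    by rewrite Su; split=> // _; exists u => //; rewrite mem !eqxx.
  have [-> _] := off t ne; rewrite (refining_stamp ref) //; split=> -[x xL e].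
    by exists x; rewrite // mem xL orbT.
  by exists x => //; move: xL; rewrite mem => /orP[/andP[_ /eqP xu]|//]; rewrite -e xu eqxx in ne.
- have [->|/off[-> _]] := eqVneq t (A0 u); first by rewrite Su.
  exact: refining_stamp_le ref t.
- rewrite mem eqxx => /orP[/eqP->|xL]; first by rewrite Nu.
  by have := refining_new ref xL; rewrite N'E //; lia.
- rewrite !mem eqxx => /orP[/eqP->|xL] /orP[/eqP->|yL] //.
  + by rewrite Nu N'E // => /esym/eqP; rewrite dN // => /eqP.
  + by rewrite Nu N'E // => /eqP; rewrite dN // => /eqP.
  by rewrite !N'E //; apply: (refining_new_inj ref).
by have := refining_fresh ref; rewrite size_rcons; lia.
Qed.

Lemma refining_move_stamped : S (A u) = v.+1 ->
  refining (rcons L (v, u)) v A0 f0 (fun x => if x == u then N (A u) else A x) S N f.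
Proof.
rewrite refining_label_unhit => st.
have [x xL ex] := (refining_stamp ref (refining_before_lt ref u)).1 st.
have df := refining_new ref xL; rewrite ex in df.
apply: refining_move => //; first by rewrite leqnn leqnSn.
move=> y yL; apply/eqP/eqP => [|->//]; rewrite -ex.
exact: (refining_new_inj ref).
Qed.

Lemma refining_move_fresh : S (A u) != v.+1 ->
  refining (rcons L (v, u)) v A0 f0 (fun x => if x == u then f else A x)
    (upd S (A u) v.+1) (upd N (A u) f) f.+1.
Proof.
rewrite refining_label_unhit => st; have /andP[f0f _] := refining_fresh ref.
apply: refining_move; rewrite ?upd_same ?leqnn ?leqnSn ?f0f ?ltnSn //.
  by move=> t ne; rewrite !upd_other.
move=> x xL; have /andP[_ lt] := refining_new ref xL.
rewrite ltn_eqF //; apply/esym/negbTE; apply: contra st => /eqP e.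
by apply/eqP/(refining_stamp ref); [apply: (refining_before_lt ref) | exists x].
Qed.

End Step.

End Refinement.

(** * Loops over vertices and pairs *)

Definition src := Get 2 (Reg 3).
Definition dst := Get 3 (Reg 3).
Definition absdiff e1 e2 := Plus (Minus e1 e2) (Minus e2 e1).
Definition positive e := Minus (Cst 1) (Minus (Cst 1) e).

Definition distance (a b : nat) := a - b + (b - a).

Lemma denotes_absdiff W s e1 e2 v1 v2 : denotes W s e1 v1 -> denotes W s e2 v2 ->
  denotes W s (absdiff e1 e2) (distance v1 v2).
Proof.
move=> d1 d2; apply: denotes_plus; try exact: denotes_minus.
by have := denotes_le d1; have := denotes_le d2; lia.
Qed.

Lemma denotes_positive W s e v : 0 < W -> denotes W s e v ->
  denotes W s (positive e) (0 < v).
Proof.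
move=> W0 d; have -> : (0 < v) = 1 - (1 - v) :> nat by lia.
by apply: denotes_minus; [apply: denotes_cst | apply: denotes_minus d; apply: denotes_cst].
Qed.

Section Loops.
Variables (W n k : nat) (nb : 'I_n -> seq 'I_n).
Variable spec : nat -> option ('I_n -> nat).
Let N := n + size (pairs nb).
Hypotheses (N_lt : N.+2 < W)
  (spec_gt3 : forall a f, spec a = Some f -> 3 < a)
  (spec_le : forall a f v, spec a = Some f -> f v <= W).
Implicit Types (s : state) (v : 'I_n).

Record loaded s : Prop := Loaded {
  loaded_order : regs s 0 = n;
  loaded_budget : regs s 1 = k;
  loaded_size : regs s 2 = size (pairs nb);
  loaded_pair : forall t q u, pairs nb = t ++ q :: u ->
    arrs s 2 (size t) = q.1 /\ arrs s 3 (size t) = q.2 }.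

Definition known m s := loaded s /\
  forall a f, a < m -> spec a = Some f -> forall v, arrs s a v = f v.

Definition env m s := known m s /\ forall a i, m <= a -> arrs s a i = 0.

(* Arrays 0 and 1 hold the input and the output, arrays 2 and 3 the pairs. *)
Definition writable m : pred nat := fun a => (a < 2) || (m <= a).

Lemma loaded_frame R A s s' : frame R A s s' -> all (leq 3) R -> all (writable 4) A ->
  loaded s -> loaded s'.
Proof.
move=> [fr fa] /allP R3 /allP A4 [hn hk hM hp].
have er r : r < 3 -> regs s' r = regs s r.
  by move=> r3; apply: fr; apply: contraL r3 => /R3; rewrite -leqNgt.
have ea a : 1 < a < 4 -> arrs s' a = arrs s a.
  by move=> a4; apply: fa; apply: contraL a4 => /A4; rewrite /writable; lia.
by split; rewrite ?er // => t q u /hp; rewrite !ea.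
Qed.

Lemma known_frame m R A s s' : 3 < m -> frame R A s s' -> all (leq 3) R ->
  all (writable m) A -> known m s -> known m s'.
Proof.
move=> m3 fr R3 Am [ld kn]; split.
  by apply: loaded_frame fr R3 _ ld; apply: sub_all Am => a; rewrite /writable; lia.
move=> a f am sa v; rewrite (proj2 fr) ?(kn a f) //; have := spec_gt3 sa.
by move=> a3; apply: contraL am => /(allP Am); rewrite /writable; lia.
Qed.

Lemma known_loaded m s : known m s -> loaded s.
Proof. by case. Qed.

Lemma env_extend m m' R A s s' : 3 < m <= m' -> env m s -> frame R A s s' ->
  all (leq 3) R -> all (fun a => m <= a < m') A ->
  (forall a f, m <= a < m' -> spec a = Some f -> forall v, arrs s' a v = f v) -> env m' s'.
Proof.
move=> /andP[m3 mm'] [kn z] fr R3 Am post; have kn' : known m s'.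
  apply: known_frame m3 fr R3 _ kn; apply: sub_all Am => a /andP[ma _].
  by rewrite /writable ma orbT.
split=> [|a i am].
  split; first exact: known_loaded kn'.
  by move=> a f am' sa; case: (ltnP a m) => am; [apply: (proj2 kn') | apply: post; rewrite ?am].
rewrite (proj2 fr) ?z ?(leq_trans mm') //.
by apply: contraL am => /(allP Am)/andP[_]; rewrite -ltnNge.
Qed.

Lemma run_env m m' c t s (Q : state -> Prop) : 3 < m <= m' -> env m s ->
  all (leq 3) (written_regs c) -> all (fun a => m <= a < m') (written_arrs c) ->
  run W c s t Q ->
  (forall s', Q s' ->
     forall a f, m <= a < m' -> spec a = Some f -> forall v, arrs s' a v = f v) ->
  run W c s t (env m').
Proof.
move=> mm' en R3 Am rc post; apply: run_weaken (leqnn _) _ (run_frame rc) => s' [q fr].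
exact: env_extend mm' en fr R3 Am (post s' q).
Qed.

Lemma run_items (X : Type) (E : seq X) (I : seq X -> state -> Prop) x m c s : 3 < m ->
  (forall s', loaded s' -> regs s' x = size E) -> x < 3 -> size E <= N -> known m s ->
  all (leq 4) (written_regs c) -> all (writable m) (written_arrs c) -> cost c <= 90 ->
  I [::] (set_reg s 3 0) ->
  (forall t (q : X) u s', E = t ++ q :: u -> known m s' -> regs s' 3 = size t -> I t s' ->
     wp W c (fun s'' => I (rcons t q) (set_reg s'' 3 (size t).+1)) s') ->
  run W (For x c) s (100 * N.+1) (fun s' => known m s' /\ I E s').
Proof.
move=> m3 ex x3 EN kn R4 Am cc I0 step.
have R3 : all (leq 3) (3 :: written_regs c) by rewrite /= (sub_all _ R4) // => r /ltnW.
have notin r : r < 4 -> r \notin written_regs c.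
  by apply: contraL => /(allP R4); rewrite -leqNgt.
have knF s' : frame (3 :: written_regs c) (written_arrs c) s s' -> known m s'.
  by move=> fr; apply: known_frame m3 fr _ _ kn.
have /run_frame rf : run W (For x c) s ((cost c + 10) * (size E).+1) (I E).
  apply: run_foreach I0 _ => [|||//|t q u s' eE fr]; last by apply: (step _ _ u); auto.
  - exact: ex (known_loaded kn).
  - by move: N_lt; lia.
  - by rewrite inE negb_or notin ?andbT; lia.
  by rewrite notin.
apply: run_weaken _ _ rf => [|s' [IE fr]]; first by rewrite leq_mul //; lia.
split=> //; apply: known_frame m3 fr _ _ kn; rewrite /= ?cats0 //.
by rewrite all_cat (sub_all _ R4) // => r /ltnW.
Qed.

Lemma vertex_denotes t v u s : enum 'I_n = t ++ v :: u -> regs s 3 = size t ->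
  denotes W s (Reg 3) v.
Proof.
move=> e e3; apply: denotes_reg; first by rewrite e3 (size_enum_ord_prefix e).
by have := ltn_ord v; move: N_lt; rewrite /N; lia.
Qed.

Lemma pair_denotes t q u s : pairs nb = t ++ q :: u -> loaded s -> regs s 3 = size t ->
  denotes W s src q.1 /\ denotes W s dst q.2.
Proof.
move=> e ld e3; have [e1 e2] := loaded_pair ld e.
have tN : size t <= W by move: N_lt; rewrite /N e size_cat; lia.
have nW : n <= W by move: N_lt; rewrite /N; lia.
split; apply: denotes_get (denotes_reg e3 tN) _ _ => //;
  exact: leq_trans (ltnW (ltn_ord _)) nW.
Qed.

Lemma known_denotes m a f e v s : known m s -> a < m -> spec a = Some f ->
  denotes W s e v -> denotes W s (Get a e) (f v).
Proof.
by move=> [_ kn] am sa d; apply: denotes_get d _ (spec_le _ sa); apply: kn am sa v.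
Qed.

Lemma run_vertices (I : seq 'I_n -> state -> Prop) m c s : 3 < m -> known m s ->
  all (leq 4) (written_regs c) -> all (writable m) (written_arrs c) -> cost c <= 90 ->
  I [::] (set_reg s 3 0) ->
  (forall t v u s', enum 'I_n = t ++ v :: u -> known m s' -> regs s' 3 = v ->
     denotes W s' (Reg 3) v -> I t s' ->
     wp W c (fun s'' => I (rcons t v) (set_reg s'' 3 v.+1)) s') ->
  run W (For 0 c) s (100 * N.+1) (fun s' => known m s' /\ I (enum 'I_n) s').
Proof.
move=> m3 kn R4 Am cc I0 step; apply: run_items => // [s' /loaded_order->||t v u s' e kn' e3 It].
- by rewrite size_enum_ord.
- by rewrite size_enum_ord leq_addr.
have d := vertex_denotes e e3; rewrite (size_enum_ord_prefix e) in e3 *.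
exact: (step _ _ u).
Qed.

Lemma run_pairs (I : seq ('I_n * 'I_n) -> state -> Prop) m c s : 3 < m -> known m s ->
  all (leq 4) (written_regs c) -> all (writable m) (written_arrs c) -> cost c <= 90 ->
  I [::] (set_reg s 3 0) ->
  (forall t q u s', pairs nb = t ++ q :: u -> known m s' -> regs s' 3 = size t ->
     denotes W s' src q.1 -> denotes W s' dst q.2 -> I t s' ->
     wp W c (fun s'' => I (rcons t q) (set_reg s'' 3 (size t).+1)) s') ->
  run W (For 2 c) s (100 * N.+1) (fun s' => known m s' /\ I (pairs nb) s').
Proof.
move=> m3 kn R4 Am cc I0 step; apply: run_items => // [s' /loaded_size->||t q u s' e kn' e3 It].
- by [].
- by rewrite leq_addl.
by have [d1 d2] := pair_denotes e (known_loaded kn') e3; apply: (step _ _ u).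
Qed.

Definition fill b e := For 0 (Put b (Reg 3) e).

Lemma run_fill b e f s : 3 < b -> ecost e <= 80 -> spec b = Some f -> env b s ->
  (forall s' v, known b s' -> regs s' 3 = v -> denotes W s' (Reg 3) v ->
     denotes W s' e (f v)) ->
  run W (fill b e) s (100 * N.+1) (env b.+1).
Proof.
move=> b3 ce sb en de.
pose I (t : seq 'I_n) s' := forall v, v \in t -> arrs s' b v = f v.
apply: (run_env (m := b) (Q := fun s' => known b s' /\ I (enum 'I_n) s')) => //=.
- by rewrite b3 leqnSn.
- by rewrite leqnn ltnSn.
- apply: run_vertices => //=; [exact: (proj1 en) | by rewrite /writable; lia | by lia |].
  move=> t v u s' e' kn e3 dv It; apply: (wp_put dv (de _ _ kn e3 dv)) => w.
  rewrite mem_rcons inE /= upd_same /upd => /orP[/eqP->|wt]; first by rewrite eqxx.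
  by rewrite It //; case: eqP => // /val_inj->.
move=> s' [_ If] a g; rewrite ltnS -eqn_leq => /eqP<-.
by rewrite sb => -[<-] v; apply: If; rewrite mem_enum.
Qed.

Definition tests s e1 e2 (b : bool) := exists v1 v2 : nat,
  [/\ denotes W s e1 v1, denotes W s e2 v2 & (v1 <= v2) = b].

Lemma wp_tests e1 e2 c1 c2 b Q s : tests s e1 e2 b ->
  (b -> wp W c1 Q s) -> (~~ b -> wp W c2 Q s) -> wp W (If e1 e2 c1 c2) Q s.
Proof.
by move=> [v1 [v2 [d1 d2 <-]]] h1 h2; apply: wp_if d1 d2 h1 _ => lt; apply: h2; rewrite -ltnNge.
Qed.

Lemma tests_positive s e (i : nat) : denotes W s e i -> tests s (Cst 1) e (0 < i).
Proof. by move=> d; exists 1, i; split=> //; apply: denotes_cst; lia. Qed.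

Lemma tests_eq s e1 e2 (i j : nat) : denotes W s e1 i -> denotes W s e2 j ->
  tests s (absdiff e1 e2) (Cst 0) (i == j).
Proof.
move=> d1 d2; exists (distance i j), 0; split; first exact: denotes_absdiff.
  exact: denotes_cst.
by rewrite /distance; lia.
Qed.

Lemma tests_neq s e1 e2 (i j : nat) : denotes W s e1 i -> denotes W s e2 j ->
  tests s (Cst 1) (absdiff e1 e2) (i != j).
Proof.
move=> d1 d2; have := tests_positive (denotes_absdiff d1 d2).
by rewrite (_ : (0 < _) = (i != j)) // /distance; lia.
Qed.

Lemma tests_true s : tests s (Cst 0) (Cst 0) true.
Proof. by exists 0, 0; split=> //; apply: denotes_cst. Qed.

Definition count_cmd b idx g1 g2 := If g1 g2 (Put b idx (Plus (Get b idx) (Cst 1))) Skip.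

Lemma wp_count (X : Type) (ix : X -> 'I_n) (gd : pred X) b idx g1 g2 t (q : X) j s :
  size t < N.+1 ->
  (forall i, arrs s b i = count (fun q => gd q && (ix q == i :> nat)) t) ->
  denotes W s idx (ix q) -> tests s g1 g2 (gd q) ->
  wp W (count_cmd b idx g1 g2) (fun s' => forall i, arrs (set_reg s' 3 j) b i =
     count (fun q => gd q && (ix q == i :> nat)) (rcons t q)) s.
Proof.
move=> tN It dix tg; have step i : count (fun q => gd q && (ix q == i :> nat)) (rcons t q) =
    arrs s b i + (gd q && (ix q == i :> nat)) by rewrite -cats1 count_cat /= addn0 It.
apply: wp_tests tg _ _ => [gq|/negbTE gq]; last first.
  by apply: wp_skip => i; rewrite step gq addn0.
have bW i : arrs s b i < W.
  by rewrite It; apply: leq_ltn_trans (count_size _ _) _; move: N_lt; lia.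
apply: (wp_put (v := arrs s b (ix q) + 1) dix).
  apply: denotes_plus (denotes_get dix (erefl _) _) (denotes_cst _ _) _ => //.
  - exact: ltnW.
  - by move: N_lt; lia.
  by rewrite addn1.
move=> i; rewrite step gq /= upd_same /upd eq_sym.
by case: eqP => [->|]; rewrite ?addn0.
Qed.

Definition count_vertices b idx g1 g2 := For 0 (count_cmd b idx g1 g2).

Lemma run_count_vertices b idx g1 g2 f (ix : 'I_n -> 'I_n) (gd : pred 'I_n) s : 3 < b ->
  cost (count_cmd b idx g1 g2) <= 90 -> spec b = Some f ->
  (forall i, f i = #|[set v | gd v && (ix v == i)]|) -> env b s ->
  (forall s' v, known b s' -> denotes W s' (Reg 3) v ->
     denotes W s' idx (ix v) /\ tests s' g1 g2 (gd v)) ->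
  run W (count_vertices b idx g1 g2) s (100 * N.+1) (env b.+1).
Proof.
move=> b3 cc sb fE en de.
pose I t s' := forall i, arrs s' b i = count (fun v => gd v && (ix v == i :> nat)) t.
apply: (run_env (m := b) (Q := fun s' => known b s' /\ I (enum 'I_n) s')) => //=.
- by rewrite b3 leqnSn.
- by rewrite leqnn ltnSn.
- apply: run_vertices => //=; first exact: (proj1 en).
  + by rewrite /writable; lia.
  + by move=> i /=; rewrite (proj2 en).
  move=> t v u s' e' kn e3 dv It; have [dix tg] := de _ _ kn dv.
  apply: wp_count => //; rewrite (size_enum_ord_prefix e').
  by have := ltn_ord v; rewrite /N; lia.
move=> s' [_ If] a g; rewrite ltnS -eqn_leq => /eqP<-.
by rewrite sb => -[<-] v; rewrite fE If count_enum.
Qed.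

Definition count_pairs_cmd b idx g1 g2 := For 2 (count_cmd b idx g1 g2).

Variable G : sgraph 'I_n.
Hypothesis nbP : forall v, uniq (nb v) /\ nb v =i G v.

Lemma run_count_pairs b idx g1 g2 f (ix : 'I_n * 'I_n -> 'I_n) gd s : 3 < b ->
  cost (count_cmd b idx g1 g2) <= 90 -> spec b = Some f ->
  (forall i, f i = #|[set q | (q.2 \in cnbhd G q.1) && (gd q && (ix q == i))]|) -> env b s ->
  (forall s' (q : 'I_n * 'I_n), known b s' -> denotes W s' src q.1 -> denotes W s' dst q.2 ->
     denotes W s' idx (ix q) /\ tests s' g1 g2 (gd q)) ->
  run W (count_pairs_cmd b idx g1 g2) s (100 * N.+1) (env b.+1).
Proof.
move=> b3 cc sb fE en de.
pose I t s' := forall i, arrs s' b i = count (fun q => gd q && (ix q == i :> nat)) t.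
apply: (run_env (m := b) (Q := fun s' => known b s' /\ I (pairs nb) s')) => //=.
- by rewrite b3 leqnSn.
- by rewrite leqnn ltnSn.
- apply: run_pairs => //=; first exact: (proj1 en).
  + by rewrite /writable; lia.
  + by move=> i /=; rewrite (proj2 en).
  move=> t q u s' e' kn e3 d1 d2 It; have [dix tg] := de _ _ kn d1 d2.
  by apply: wp_count => //; rewrite ltnS /N e' size_cat addnCA leq_addr.
move=> s' [_ If] a g; rewrite ltnS -eqn_leq => /eqP<-.
by rewrite sb => -[<-] v; rewrite fE If (count_pairs nbP).
Qed.

Definition truncate_cmd sel rep b limit :=
  If (Cst 1) (Get sel (Reg 3))
    (If (Plus (Get b (Get rep (Reg 3))) (Cst 1)) limit
       (Seq (Put b.+1 (Reg 3) (Cst 1))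
            (Put b (Get rep (Reg 3)) (Plus (Get b (Get rep (Reg 3))) (Cst 1))))
       Skip) Skip.

Definition truncate_pass sel rep b limit := For 0 (truncate_cmd sel rep b limit).

Section TruncatePass.
Variables (A : eqType) (f : 'I_n -> A) (X : {set 'I_n}) (m sel rep b : nat) (limit : expr).
Let D := truncate f X m.
Hypotheses (b3 : 3 < b) (sel_lt : sel < b) (rep_lt : rep < b)
  (sel_spec : spec sel = Some (fun v => nat_of_bool (v \in X)))
  (rep_spec : spec rep = Some (fun v => nat_of_ord (class_rep f v)))
  (limit_denotes : forall s, loaded s -> denotes W s limit m).

Definition truncated_prefix (t : seq 'I_n) s :=
  (forall i : 'I_n, arrs s b i = count (fun w => (w \in D) && (class_rep f w == i)) t) /\
  (forall w : 'I_n, arrs s b.+1 w = (w \in t) && (w \in D)).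

Lemma truncated_prefix_skip t v j s : v \notin D -> truncated_prefix t s ->
  truncated_prefix (rcons t v) (set_reg s 3 j).
Proof.
move=> /negbTE nv [Ib Ib1]; split=> w.
  by rewrite -cats1 count_cat /= nv !addn0 Ib.
by rewrite mem_rcons inE /= Ib1; case: eqP => [->|//]; rewrite nv andbF.
Qed.

Lemma truncated_prefix_keep t v j s : v \in D -> truncated_prefix t s ->
  truncated_prefix (rcons t v)
    (set_reg (set_arr (set_arr s b.+1 v 1) b (class_rep f v) (arrs s b (class_rep f v) + 1)) 3 j).
Proof.
move=> vD [Ib Ib1]; split=> w.
  rewrite -cats1 count_cat /= vD addn0 upd_same (@upd_other _ (arrs s)) ?ltn_eqF //.
  rewrite -Ib eq_sym /upd; case: eqP => [/val_inj->|ne]; first by rewrite eqxx.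
  by case: eqP => [e|_]; [case: ne; rewrite e | rewrite addn0].
rewrite /= upd_other ?upd_same 1?eq_sym ?ltn_eqF // /upd mem_rcons inE Ib1.
by rewrite -[X in X == val v]/(val w) val_eqE; case: eqP => [->|//]; rewrite vD.
Qed.

Lemma truncated_prefix_count t v u s : enum 'I_n = t ++ v :: u -> truncated_prefix t s ->
  arrs s b (class_rep f v) = #|earlier f D v|.
Proof.
move=> e [Ib _]; rewrite Ib (count_enum_ord_prefix e); apply: eq_card => w.
by rewrite !inE class_rep_eq -!andbA; congr (_ && (_ && _)); rewrite andbC.
Qed.

Lemma wp_truncate_cmd t v u s : enum 'I_n = t ++ v :: u -> known b s -> regs s 3 = v ->
  denotes W s (Reg 3) v -> truncated_prefix t s ->
  wp W (truncate_cmd sel rep b limit)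
    (fun s' => truncated_prefix (rcons t v) (set_reg s' 3 v.+1)) s.
Proof.
move=> e kn e3 dv It; have drep := known_denotes kn rep_lt rep_spec dv.
have cntE := truncated_prefix_count e It.
have cnt_lt : arrs s b (class_rep f v) < W.
  by rewrite cntE; apply: leq_ltn_trans (max_card _) _; rewrite card_ord; move: N_lt; lia.
have dinc s' : arrs s' b = arrs s b -> denotes W s' (Get rep (Reg 3)) (class_rep f v) ->
    denotes W s' (Plus (Get b (Get rep (Reg 3))) (Cst 1)) (arrs s b (class_rep f v) + 1).
  move=> eb d; apply: denotes_plus (denotes_get d _ (ltnW cnt_lt)) (denotes_cst _ _) _.
  - by rewrite eb.
  - by move: N_lt; lia.
  by rewrite addn1.
apply: wp_tests (tests_positive (known_denotes kn sel_lt sel_spec dv)) _ _; last first.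
  rewrite lt0b => nX; apply/wp_skip/truncated_prefix_skip => //; apply: contra nX.
  exact: (subsetP (truncate_sub _ _ _)).
rewrite lt0b => vX.
apply: wp_if (dinc s (erefl _) drep) (limit_denotes (known_loaded kn)) _ _; last first.
  rewrite addn1 ltnS cntE => mle; apply/wp_skip/truncated_prefix_skip => //.
  by rewrite mem_truncate // -leqNgt.
rewrite addn1 cntE -mem_truncate // => vD; apply/wp_seq/(wp_put dv).
  by apply: denotes_cst; move: N_lt; lia.
have eb : arrs (set_arr s b.+1 v 1) b = arrs s b by rewrite /= upd_other ?ltn_eqF.
have drep' : denotes W (set_arr s b.+1 v 1) (Get rep (Reg 3)) (class_rep f v).
  apply: denotes_get (denotes_reg _ (denotes_le dv)) _ (denotes_le drep) => //.
  by rewrite /= upd_other -?(proj2 drep) /= ?e3 //; lia.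
exact: wp_put drep' (dinc _ eb drep') (truncated_prefix_keep _ vD It).
Qed.

Lemma run_truncate_pass g s : ecost limit <= 50 -> spec b = None -> spec b.+1 = Some g ->
  (forall v, g v = (v \in D)) -> env b s ->
  run W (truncate_pass sel rep b limit) s (100 * N.+1) (env b.+2).
Proof.
move=> limit_cost sb sb1 gE en.
apply: (run_env (m := b) (Q := fun s' => known b s' /\ truncated_prefix (enum 'I_n) s')) => //=.
- by lia.
- by lia.
- apply: run_vertices => //=; first exact: (proj1 en).
  + by rewrite /writable; lia.
  + by lia.
  + by split=> w; rewrite /= (proj2 en) ?leqnSn.
  by move=> t v u s' e kn e3 dv; apply: wp_truncate_cmd e kn e3 dv.
move=> s' [_ [_ If]] a h /andP[ba ab] sa v.
have [e|e] : a = b \/ a = b.+1 by lia.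
  by rewrite e sb in sa.
by move: sa; rewrite e sb1 => -[<-]; rewrite gE If mem_enum.
Qed.

End TruncatePass.

Section MinPass.
Variables (a b : nat) (f : 'I_n -> 'I_n).

Definition lowest (D : pred 'I_n) (i : nat) :=
  (exists2 u, D u & i = f u) /\ forall u, D u -> i <= f u.

Lemma lowest_cnbhd_min v i : lowest (mem (cnbhd G v)) i -> i = cnbhd_min G f v.
Proof.
move=> [[u uv ->] le]; have [x xv e] := cnbhd_minP G f v.
by apply/eqP; rewrite eqn_leq e -{2}e cnbhd_min_le // le.
Qed.

Lemma lowest_insert (D D' : pred 'I_n) i u : (forall w, D' w = (w == u) || D w) ->
  lowest D i -> lowest D' (if f u <= i then nat_of_ord (f u) else i).
Proof.
move=> eD [[w Dw e] le]; case: leqP => fu; split=> [|x]; rewrite ?eD.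
- by exists u; rewrite ?eD ?eqxx.
- by move=> /orP[/eqP->//|/le]; apply: leq_trans.
- by exists w; rewrite ?eD ?Dw ?orbT.
by move=> /orP[/eqP->|/le//]; apply: ltnW.
Qed.

Definition min_cmd := If (Get a dst) (Get b src) (Put b src (Get a dst)) Skip.

Definition min_pass := Seq (For 0 (Put b (Reg 3) (Get a (Reg 3)))) (For 2 min_cmd).

Hypotheses (b3 : 3 < b) (ab : a < b) (sa : spec a = Some (fun v => nat_of_ord (f v)))
  (sb : spec b = Some (fun v => nat_of_ord (cnbhd_min G f v))).

Definition lowest_prefix (t : seq ('I_n * 'I_n)) s := forall v,
  lowest [pred u | (u == v) || ((v, u) \in t)] (arrs s b v).

Lemma wp_min_cmd t (q : 'I_n * 'I_n) j s :
  known b s -> denotes W s src q.1 -> denotes W s dst q.2 -> lowest_prefix t s ->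
  wp W min_cmd (fun s' => lowest_prefix (rcons t q) (set_reg s' 3 j)) s.
Proof.
case: q => v u /= kn d1 d2 It; have du := known_denotes kn ab sa d2.
have bvW : arrs s b v <= W.
  have [[w _ ->] _] := It v; have := ltn_ord (f w); move: N_lt; rewrite /N; lia.
have mem w x : ((w, x) \in rcons t (v, u)) = ((w == v) && (x == u)) || ((w, x) \in t).
  by rewrite mem_rcons inE xpair_eqE.
have step : lowest_prefix (rcons t (v, u))
    (set_arr s b v (if f u <= arrs s b v then nat_of_ord (f u) else arrs s b v)).
  move=> w; rewrite /= upd_same /upd; case: eqP => [/val_inj->|ne].
    by apply: lowest_insert (It v) => x; rewrite /= mem eqxx orbCA.
  have [[x Dx e] le] := It w; have nw : (w == v) = false by apply/eqP => e'; case: ne; rewrite e'.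
  by split=> [|y]; [exists x; rewrite /= ?mem ?nw | rewrite /= mem nw; apply: le].
apply: (wp_if du (denotes_get d1 (erefl _) bvW)) => [le|lt].
  by apply: (wp_put d1 du) => w; have := step w; rewrite le.
apply: wp_skip => w; have := step w; rewrite leqNgt lt /= upd_same /upd.
by case: eqP => [->|].
Qed.

Lemma run_min_pass s : env b s -> run W min_pass s (200 * N.+1) (env b.+1).
Proof.
move=> en; pose I (t : seq 'I_n) s' := forall v, v \in t -> arrs s' b v = f v.
apply: (run_env (m := b) (Q := fun s' => known b s' /\ lowest_prefix (pairs nb) s')) => //=.
- by lia.
- by lia.
- rewrite -[200]/(100 + 100) mulnDl; apply: run_then.
    apply: (run_vertices (m := b) (I := I)) => //=; first exact: (proj1 en).
      by rewrite /writable; lia.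
    move=> t v u s' e kn e3 dv It.
    apply: (wp_put dv (known_denotes kn ab sa dv)) => w; rewrite mem_rcons inE.
    rewrite /= upd_same /upd => /orP[/eqP->|wt]; first by rewrite eqxx.
    by rewrite It //; case: eqP => // /val_inj->.
  move=> s1 [kn1 I1]; apply: run_pairs => //=; first by rewrite /writable; lia.
    move=> v /=; rewrite I1 ?mem_enum //; split; first by exists v; rewrite /= ?eqxx.
    by move=> u; rewrite /= orbF => /eqP->.
  by move=> t q u s' e kn e3 d1 d2 It; apply: wp_min_cmd.
move=> s' [_ If] c g bc; have <- : b = c by lia.
rewrite sb => -[<-] v; apply: lowest_cnbhd_min; have [[u Du e] le] := If v.
by split=> [|x]; [exists u => //; move: Du | move=> xv; apply: le];
  rewrite /= (mem_pairs nbP) in_cnbhd orbA orbb // -in_cnbhd.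
Qed.

End MinPass.

Section TwinPass.
Variables (A : eqType) (f : 'I_n -> A) (gd : pred ('I_n * 'I_n)) (b : nat) (g1 g2 : expr).
Hypotheses (b3 : 3 < b) (cg : ecost g1 + ecost g2 <= 20)
  (hitsE : forall u x, (hits [seq q <- pairs nb | gd q] u == hits [seq q <- pairs nb | gd q] x)
     = (f u == f x))
  (dgd : forall s (q : 'I_n * 'I_n), denotes W s src q.1 -> denotes W s dst q.2 ->
     tests s g1 g2 (gd q)).

(* Register 6 holds the first unused label. *)
Definition refine_cmd :=
  Seq (Asg 7 (Get b dst))
  (Seq (If (absdiff (Get b.+1 (Reg 7)) (Plus src (Cst 1))) (Cst 0) Skip
          (Seq (Put b.+1 (Reg 7) (Plus src (Cst 1)))
          (Seq (Put b.+2 (Reg 7) (Reg 6))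
               (Asg 6 (Plus (Reg 6) (Cst 1))))))
       (Put b dst (Get b.+2 (Reg 7)))).

Definition mark_cmd :=
  If (Get b.+3 (Get b (Reg 3))) (Cst 0) (Put b.+3 (Get b (Reg 3)) (Plus (Reg 3) (Cst 1))) Skip.

Definition canonize_cmd :=
  Seq mark_cmd
      (Put b.+4 (Reg 3) (Minus (Get b.+3 (Get b (Reg 3))) (Cst 1))).

Definition twin_pass :=
  Seq (Asg 6 (Cst 1)) (Seq (For 2 (If g1 g2 refine_cmd Skip)) (For 0 canonize_cmd)).

Definition refined L v s := exists A0 f0, refining L v A0 f0 (fun u => arrs s b u)
  (arrs s b.+1) (arrs s b.+2) (regs s 6).

Lemma refined_bounds L v s (u : 'I_n) : refined L v s -> size L <= N ->
  [/\ arrs s b u < regs s 6, arrs s b.+1 (arrs s b u) <= v.+1, regs s 6 <= N.+1 &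
      arrs s b.+1 (arrs s b u) = v.+1 -> (v, u) \notin L ->
      arrs s b.+2 (arrs s b u) < regs s 6].
Proof.
move=> [A0 [f0 ref]] LN; split.
- exact: refining_lt ref u.
- exact: refining_stamp_le ref _.
- by have /andP[_ le] := refining_fresh ref; apply: leq_trans le _.
move=> st uL; move: st; rewrite (refining_label_unhit ref uL) => st.
have [x xL <-] := (refining_stamp ref (refining_before_lt ref u)).1 st.
by have /andP[] := refining_new ref xL.
Qed.

Lemma refined_move_stamped L v (u : 'I_n) s s' : refined L v s -> (v, u) \notin L ->
  arrs s b.+1 (arrs s b u) = v.+1 ->
  arrs s' b =1 upd (arrs s b) u (arrs s b.+2 (arrs s b u)) ->
  arrs s' b.+1 =1 arrs s b.+1 -> arrs s' b.+2 =1 arrs s b.+2 -> regs s' 6 = regs s 6 ->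
  refined (rcons L (v, u)) v s'.
Proof.
move=> [A0 [f0 ref]] uL st eA eS eN e6; exists A0, f0; rewrite e6.
by apply: refining_ext (refining_move_stamped ref uL st) => // y; rewrite eA /upd -val_eqE.
Qed.

Lemma refined_move_fresh L v (u : 'I_n) s s' (x := arrs s b u) :
  refined L v s -> (v, u) \notin L -> arrs s b.+1 x != v.+1 ->
  arrs s' b =1 upd (arrs s b) u (regs s 6) -> arrs s' b.+1 =1 upd (arrs s b.+1) x v.+1 ->
  arrs s' b.+2 =1 upd (arrs s b.+2) x (regs s 6) -> regs s' 6 = (regs s 6).+1 ->
  refined (rcons L (v, u)) v s'.
Proof.
move=> [A0 [f0 ref]] uL st eA eS eN e6; exists A0, f0; rewrite e6.
by apply: refining_ext (refining_move_fresh ref uL st) => // y; rewrite eA /upd -val_eqE.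
Qed.

Lemma wp_refine_cmd L v (u : 'I_n) j s : size L <= N -> (v, u) \notin L ->
  denotes W s src v -> denotes W s dst u -> refined L v s ->
  wp W refine_cmd (fun s' => refined (rcons L (v, u)) v (set_reg s' 3 j)) s.
Proof.
move=> LN uL d1 d2 rs; have [xf stv fN new] := refined_bounds u rs LN.
set x := arrs s b u in xf stv new *.
have vW : v.+1 <= W by have := ltn_ord v; move: N_lt; rewrite /N; lia.
have fW : (regs s 6).+1 <= W by move: N_lt; lia.
have keep s' R B e i : frame R B s s' -> avoids R B e -> denotes W s e i -> denotes W s' e i.
  exact: denotes_frame.
apply/wp_seq/(wp_asg (denotes_get d2 (erefl x) _)); first by lia.
set s1 := set_reg s 7 x; have d7 : denotes W s1 (Reg 7) x by apply: denotes_reg => //; lia.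
have fr1 : frame [:: 7] [::] s s1 by apply: frame_set_reg.
have dv1 : denotes W s1 (Plus src (Cst 1)) (v + 1).
  by apply: denotes_plus (keep _ _ _ _ _ fr1 _ d1) (denotes_cst _ _) _ => //; lia.
have dst1 : denotes W s1 (Get b.+1 (Reg 7)) (arrs s b.+1 x).
  by apply: denotes_get d7 (erefl _) (leq_trans stv vW).
apply/wp_seq/(wp_tests (tests_eq dst1 dv1)) => [/eqP|]; rewrite addn1 => st.
  apply/wp_skip/(wp_put (keep _ _ _ _ _ fr1 _ d2) (denotes_get d7 (erefl _) _)) => //.
    by have := new st uL; rewrite /=; lia.
  by apply: (refined_move_stamped rs uL st) => [y|y|y|]; upd_simpl.
rewrite addn1 in dv1; apply/wp_seq/(wp_put d7 dv1); set s2 := set_arr _ _ _ _.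
have d62 : denotes W s2 (Reg 6) (regs s 6) by apply: denotes_reg => //; lia.
have d72 : denotes W s2 (Reg 7) x by apply: denotes_reg => //; lia.
apply/wp_seq/(wp_put d72 d62); set s3 := set_arr _ _ _ _.
have d63 : denotes W s3 (Plus (Reg 6) (Cst 1)) (regs s 6 + 1).
  by apply: denotes_plus (denotes_reg _ _) (denotes_cst _ _) _ => //; lia.
apply: (wp_asg d63); set s4 := set_reg _ _ _; have fr4 : frame [:: 7; 6] [:: b.+1; b.+2] s s4.
  by split=> r; rewrite !inE negb_or => /andP[n1 n2]; upd_simpl.
have d74 : denotes W s4 (Reg 7) x by apply: denotes_reg => //; lia.
have dnew : denotes W s4 (Get b.+2 (Reg 7)) (regs s 6).
  by apply: denotes_get d74 _ _; [upd_simpl | lia].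
apply: (wp_put (keep _ _ _ _ _ fr4 _ d2) dnew); first by rewrite /= !inE; lia.
by apply: (refined_move_fresh rs uL st) => [y|y|y|]; upd_simpl; rewrite ?addn1.
Qed.

Definition refined_prefix (t : seq ('I_n * 'I_n)) s := forall v : 'I_n,
  (forall q, q \in t -> q.1 <= v) -> refined [seq q <- t | gd q] v s.

Lemma refined_next_pivot L v v' s : v <= v' -> refined L v s -> refined L v' s.
Proof.
rewrite leq_eqVlt => /orP[/eqP/val_inj-> //|lt] [A0 [f0 ref]].
by exists (fun u => arrs s b u), (regs s 6); apply: (refining_next_pivot ref lt).
Qed.

Lemma wp_refine_prefix t q u j s : pairs nb = t ++ q :: u -> denotes W s src q.1 ->
  denotes W s dst q.2 -> refined_prefix t s ->
  wp W (If g1 g2 refine_cmd Skip) (fun s' => refined_prefix (rcons t q) (set_reg s' 3 j)) s.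
Proof.
move=> e d1 d2 It; have LN : size [seq p <- t | gd p] <= N.
  rewrite size_filter; apply: leq_trans (count_size _ _) _.
  by rewrite /N e size_cat addnCA leq_addr.
have before_v v : (forall p, p \in rcons t q -> p.1 <= v) ->
    (forall p, p \in t -> p.1 <= v) /\ q.1 <= v.
  by move=> h; split=> [p pt|]; apply: h; rewrite mem_rcons inE ?pt ?orbT ?eqxx.
apply: wp_tests (dgd d1 d2) _ _ => [gq|/negbTE gq]; last first.
  by apply/wp_skip => v /before_v[tv _]; rewrite filter_rcons gq; apply: It.
have qt : (q.1, q.2) \notin [seq p <- t | gd p].
  by rewrite mem_filter -surjective_pairing (negbTE (pairs_fresh nbP e)) andbF.
apply: (wp_weaken _ (wp_refine_cmd j LN qt d1 d2 (It q.1 (pairs_before e)))) => s' rs.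
move=> v /before_v[_ qv]; rewrite filter_rcons gq (surjective_pairing q).
exact: refined_next_pivot qv rs.
Qed.

Lemma refined_labels s (u x : 'I_n) : refined_prefix (pairs nb) s ->
  (arrs s b u == arrs s b x) = (f u == f x) /\ arrs s b u <= N.
Proof.
move=> If; have [v vmax] : exists v : 'I_n, forall w : 'I_n, w <= v.
  have n0 : 0 < n by apply: leq_ltn_trans (ltn_ord u).
  have lt : n.-1 < n by rewrite prednK.
  by exists (Ordinal lt) => w; rewrite /= -ltnS prednK.
have [A0 [f0 ref]] := If v (fun q _ => vmax q.1); split.
  by rewrite (refining_hits ref) hitsE.
rewrite -ltnS; apply: leq_trans (refining_lt ref u) _.
have /andP[_ le] := refining_fresh ref; apply: leq_trans le _.
by rewrite ltnS size_filter /N; apply: leq_trans (count_size _ _) (leq_addl _ _).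
Qed.

Definition canonized_prefix (lab : nat -> nat) (t : seq 'I_n) s :=
  [/\ arrs s b = lab,
      forall w, w \in t ->
        arrs s b.+3 (lab w) = (class_rep f w).+1 /\ arrs s b.+4 w = class_rep f w &
      forall i, (forall w, w \in t -> lab w != i) -> arrs s b.+3 i = 0].

Lemma class_rep_first (lab : nat -> nat) t v u :
  (forall w x : 'I_n, (lab w == lab x) = (f w == f x)) -> enum 'I_n = t ++ v :: u ->
  (forall w, w \in t -> lab w != lab v) -> class_rep f v = v.
Proof.
move=> labE e none; apply/val_inj/eqP; rewrite eqn_leq class_rep_le //=.
rewrite leqNgt -(mem_enum_ord_prefix e); apply/negP => /none.
by rewrite labE class_repK eqxx.
Qed.

Lemma canonized_prefix_lookup (lab : nat -> nat) t v u s :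
  (forall w x : 'I_n, (lab w == lab x) = (f w == f x)) -> enum 'I_n = t ++ v :: u ->
  canonized_prefix lab t s ->
  arrs s b.+3 (lab v) = (class_rep f v).+1 \/ arrs s b.+3 (lab v) = 0 /\ class_rep f v = v.
Proof.
move=> labE e [_ It Iz]; have [/hasP[w wt ew]|/hasPn none] :=
    boolP (has (fun w : 'I_n => lab w == lab v) t); last first.
  by right; split; [apply: Iz | apply: class_rep_first labE e none].
left; rewrite -(eqP ew) (proj1 (It w wt)); congr (_.+1).
by apply/eqP; rewrite val_eqE class_rep_eq -labE.
Qed.

Lemma wp_mark_cmd (lab : nat -> nat) t v u s :
  (forall w x : 'I_n, (lab w == lab x) = (f w == f x)) -> enum 'I_n = t ++ v :: u ->
  denotes W s (Reg 3) v -> denotes W s (Get b (Reg 3)) (lab v) -> canonized_prefix lab t s ->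
  wp W mark_cmd (fun s' => frame [::] [:: b.+3] s s' /\
    arrs s' b.+3 =1 upd (arrs s b.+3) (lab v) (class_rep f v).+1) s.
Proof.
move=> labE e dv dl It; have d0 := denotes_cst s (leq0n W).
have rW : (class_rep f v).+1 <= W.
  by have := ltn_ord (class_rep f v); move: N_lt; rewrite /N; lia.
case: (canonized_prefix_lookup labE e It) => [er|[e0 rv]].
  apply: (wp_if (denotes_get dl er rW) d0) => // _; apply: wp_skip; split=> // i.
  by rewrite /upd; case: eqP => [->|].
apply: (wp_if (denotes_get dl e0 _) d0) => // _; apply: (wp_put (v := v + 1) dl).
  by apply: denotes_plus dv (denotes_cst _ _) _; have := ltn_ord v; move: N_lt; rewrite /N; lia.
split; first exact: frame_set_arr.
by move=> i; rewrite rv addn1 /= upd_same.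
Qed.

Lemma wp_canonize_cmd (lab : nat -> nat) t v u s :
  (forall w x : 'I_n, (lab w == lab x) = (f w == f x)) -> lab v <= N ->
  enum 'I_n = t ++ v :: u -> regs s 3 = v -> denotes W s (Reg 3) v ->
  canonized_prefix lab t s ->
  wp W canonize_cmd (fun s' => canonized_prefix lab (rcons t v) (set_reg s' 3 v.+1)) s.
Proof.
move=> labE lv e e3 dv It; have [eb Irep Iz] := It; set r := class_rep f v.
have rW : r.+1 <= W by have := ltn_ord r; move: N_lt; rewrite /N; lia.
have dl : denotes W s (Get b (Reg 3)) (lab v).
  by apply: denotes_get dv _ _; [rewrite eb | lia].
apply/wp_seq/(wp_weaken _ (wp_mark_cmd labE e dv dl It)) => s1 [fr1 e31].
have dv1 : denotes W s1 (Reg 3) v by apply: denotes_frame fr1 _ dv.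
have dl1 : denotes W s1 (Get b (Reg 3)) (lab v).
  by apply: denotes_frame fr1 _ dl; rewrite /= !inE; lia.
have db3 : denotes W s1 (Get b.+3 (Get b (Reg 3))) r.+1.
  by apply: denotes_get dl1 _ rW; rewrite e31 upd_same.
apply: (wp_put dv1 (denotes_minus db3 (denotes_cst _ _))); first by lia.
split=> [|w|i none].
- by upd_simpl; rewrite (proj2 fr1) // inE; lia.
- rewrite mem_rcons inE => wt; upd_simpl; rewrite e31 subn1 /= /upd val_eqE.
  have [->|ne] := eqVneq w v; first by rewrite eqxx.
  rewrite (negbTE ne) in wt; have [er ec] := Irep w wt.
  rewrite (proj2 fr1) ?inE; last by lia.
  split=> //; rewrite labE; case: eqP => // efw; congr (_.+1).
  by apply/eqP; rewrite eq_sym val_eqE class_rep_eq efw.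
upd_simpl; rewrite e31 upd_other; last by rewrite eq_sym none // mem_rcons mem_head.
by apply: Iz => w wt; apply: none; rewrite mem_rcons inE wt orbT.
Qed.

Lemma run_twin_pass s : spec b = None -> spec b.+1 = None -> spec b.+2 = None ->
  spec b.+3 = None -> spec b.+4 = Some (fun v => nat_of_ord (class_rep f v)) ->
  env b s -> run W twin_pass s (300 * N.+1) (env b.+4.+1).
Proof.
move=> sb sb1 sb2 sb3 sb4 en.
pose Q s' := forall v, arrs s' b.+4 v = class_rep f v.
apply: (run_env (m := b) (Q := Q)) => //=; [by lia | by lia | |]; last first.
  move=> s' q a g /andP[ba ab] sa v.
  have : a = b \/ a = b.+1 \/ a = b.+2 \/ a = b.+3 \/ a = b.+4 by clear -ba ab; lia.
  move=> [|[|[|[|]]]] ea; move: sa; rewrite ea ?sb ?sb1 ?sb2 ?sb3 //.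
  by rewrite sb4 => -[<-].
apply: (@run_weaken _ _ _ (2 + (100 * N.+1 + 100 * N.+1)) _ Q) => //; first by lia.
apply: (run_then (R := fun s1 => s1 = set_reg s 6 1)) => [|_ ->].
  by apply: wp_asg => //; apply: denotes_cst; lia.
have [kn z] := en; have kn1 : known b (set_reg s 6 1).
  by apply: (known_frame b3 (frame_set_reg s 6 1)) kn.
apply: run_then; first apply/run_frame/(run_pairs (m := b) (I := refined_prefix)) => //=.
- by rewrite /writable; lia.
- by move: cg; lia.
- move=> v _; exists (fun=> 0), 1.
  apply: (refining_ext (A := fun=> 0) (S := fun=> 0) (N := fun=> 0)) => [i|i|i|];
    last exact: refining_nil.
  + by rewrite /= z.
  + by rewrite /= z // ltnW.
  by rewrite /= z //; lia.
- by move=> t q u s1 e kn2 e3 d1 d2 It; exact: (wp_refine_prefix _ e d1 d2 It).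
move=> s1 [[kn2 If] fr]; set lab := arrs s1 b.
have labE (w x : 'I_n) : (lab w == lab x) = (f w == f x) by have [] := refined_labels w x If.
have lab_le (w : 'I_n) : lab w <= N by have [] := refined_labels w w If.
apply: (@run_weaken _ _ _ (100 * N.+1) _
  (fun s' => known b s' /\ canonized_prefix lab (enum 'I_n) s')) => // [s' [_ [_ If' _]] v|].
  by have [] := If' v (mem_enum _ _).
apply: run_vertices => //=; first by rewrite /writable; lia.
  split=> // i _; rewrite (proj2 fr) ?inE; last by lia.
  by rewrite z; lia.
by move=> t v u s2 e kn3 e3 dv It; exact: (wp_canonize_cmd labE (lab_le v) e e3 dv It).
Qed.

End TwinPass.

Definition rank_pass a b :=
  Seq (Asg 8 (Cst 0))
    (For 0 (Seq (Put b (Reg 3) (Reg 8)) (Asg 8 (Plus (Reg 8) (Get a (Reg 3)))))).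

Lemma run_rank_pass (X : {set 'I_n}) a b s : 3 < b -> a < b ->
  spec a = Some (fun v => nat_of_bool (v \in X)) -> spec b = Some (rank X) -> env b s ->
  run W (rank_pass a b) s (200 * N.+1) (fun s' => env b.+1 s' /\ regs s' 8 = #|X|).
Proof.
move=> b3 ab sa sb en; pose I (t : seq 'I_n) s' :=
  regs s' 8 = count (mem X) t /\ forall v, v \in t -> arrs s' b v = rank X v.
have b_gt3 : 3 < b <= b.+1 by lia.
suff rI : run W (rank_pass a b) s (200 * N.+1) (fun s' => known b s' /\ I (enum 'I_n) s').
  apply: run_weaken (leqnn _) _ (run_frame rI) => s' [[_ [e8 eb]] fr]; split; last first.
    by rewrite e8 count_enum; apply: eq_card => v; rewrite !inE.
  apply: (env_extend b_gt3 en fr) => //=; first by lia.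
  move=> c g bc; have <- : b = c by lia.
  by rewrite sb => -[<-] v; apply: eb; rewrite mem_enum.
apply: (@run_weaken _ _ _ (2 + 100 * N.+1)) => [||]; [by lia | by move=> s' h; exact: h |].
apply: (run_then (R := fun s1 => s1 = set_reg s 8 0)) => [|_ ->].
  by apply: wp_asg => //; apply: denotes_cst; lia.
have kn : known b (set_reg s 8 0).
  by apply: (known_frame b3 (frame_set_reg s 8 0)) (proj1 en).
apply: run_vertices => //=; first by rewrite /writable; lia.
move=> t v u s1 e kn1 e3 dv [e8 eb].
have ct : count (mem X) t = rank X v by rewrite (count_enum_ord_prefix e).
have cv : rank X v <= v by rewrite -ct -(size_enum_ord_prefix e) count_size.
have d8 : denotes W s1 (Reg 8) (rank X v).
  apply: denotes_reg; first by rewrite e8.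
  by have := ltn_ord v; move: N_lt; rewrite /N; lia.
apply/wp_seq/(wp_put dv d8); apply: (wp_asg (v := rank X v + (v \in X))).
  have fr := frame_set_arr s1 b v (rank X v).
  apply: denotes_plus (denotes_frame fr _ d8) (denotes_frame fr _ _) _ => //.
  - by rewrite /= !inE; lia.
  - exact: known_denotes kn1 ab sa dv.
  by have := ltn_ord v; move: N_lt; rewrite /N; lia.
split=> [|w]; first by rewrite /= -ct -cats1 count_cat /= addn0.
rewrite mem_rcons inE /= upd_same /upd => /orP[/eqP->|wt]; first by rewrite eqxx.
by rewrite eb //; case: eqP => // /val_inj->.
Qed.

Definition emit_cmd sel degs ranks :=
  If (Cst 2) (Plus (Get sel src) (Get sel dst))
    (Seq (If (absdiff src dst) (Cst 0)
            (Put 1 (Reg 12) (Get degs src)) (Put 1 (Reg 12) (Get ranks dst)))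
         (Asg 12 (Plus (Reg 12) (Cst 1))))
    Skip.

Definition emit sel degs ranks :=
  Seq (Put 1 (Cst 0) (Reg 8)) (Seq (Put 1 (Cst 1) (Reg 1)) (Seq (Asg 12 (Cst 2))
    (For 2 (emit_cmd sel degs ranks)))).

Lemma output_is_rcons s w x : output_is s w ->
  output_is (set_arr s 1 (size w) x) (rcons w x).
Proof.
move=> out i; rewrite size_rcons nth_rcons /= upd_same /upd ltnS leq_eqVlt.
by case: ltngtP => //= lt _; apply: out.
Qed.

Section Emit.
Variables (X : {set 'I_n}) (m sel degs ranks : nat).
Hypotheses (m3 : 3 < m) (sel_lt : sel < m) (degs_lt : degs < m) (ranks_lt : ranks < m)
  (sel_spec : spec sel = Some (fun v => nat_of_bool (v \in X)))
  (degs_spec : spec degs = Some (degree_in G X)) (ranks_spec : spec ranks = Some (rank X))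
  (kW : k <= W).

Definition output_word (t : seq ('I_n * 'I_n)) : seq nat :=
  #|X| :: k :: [seq output_item G X q | q <- t & (q.1 \in X) && (q.2 \in X)].

Definition emitted t s := regs s 12 = size (output_word t) /\ output_is s (output_word t).

Lemma wp_emit_cmd t q u j s : pairs nb = t ++ q :: u -> known m s ->
  denotes W s src q.1 -> denotes W s dst q.2 -> emitted t s ->
  wp W (emit_cmd sel degs ranks) (fun s' => emitted (rcons t q) (set_reg s' 3 j)) s.
Proof.
move=> e kn d1 d2 [e12 out].
have outS : output_word (rcons t q) =
    if (q.1 \in X) && (q.2 \in X) then rcons (output_word t) (output_item G X q)
    else output_word t.
  by rewrite /output_word filter_rcons; case: ifP => // _; rewrite map_rcons.
have out_lt : (size (output_word t)).+1 <= W.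
  apply: leq_trans N_lt; rewrite /= !ltnS size_map size_filter.
  by apply: leq_trans (count_size _ _) _; rewrite /N e size_cat addnCA leq_addr.
have d12 : denotes W s (Reg 12) (size (output_word t)) by apply: denotes_reg => //; apply: ltnW.
have test : tests s (Cst 2) (Plus (Get sel src) (Get sel dst)) ((q.1 \in X) && (q.2 \in X)).
  exists 2, ((q.1 \in X) + (q.2 \in X)); split.
  - by apply: denotes_cst; lia.
  - apply: denotes_plus; try exact: known_denotes kn sel_lt sel_spec _.
    by case: (_ \in X); case: (_ \in X); lia.
  by case: (_ \in X); case: (_ \in X).
apply: wp_tests test _ _ => [qX|/negbTE qX]; last first.
  by apply: wp_skip; rewrite /emitted outS qX.
apply: wp_seq; apply: (@wp_weaken _ _ (fun s1 => regs s1 12 = size (output_word t) /\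
    output_is s1 (rcons (output_word t) (output_item G X q)))) => [s1 [e121 out1]|].
  apply: (wp_asg (v := size (output_word t) + 1)).
    by apply: denotes_plus (denotes_reg e121 _) (denotes_cst _ _) _; lia.
  by rewrite /emitted outS qX size_rcons addn1.
apply: wp_tests (tests_eq d1 d2) _ _ => [/eqP eq|ne].
  apply: (wp_put d12 (known_denotes kn degs_lt degs_spec d1)); split=> //.
  by rewrite /output_item (val_inj eq) eqxx; apply: output_is_rcons.
apply: (wp_put d12 (known_denotes kn ranks_lt ranks_spec d2)); split=> //.
by rewrite /output_item -val_eqE (negbTE ne); apply: output_is_rcons.
Qed.

Lemma run_emit s : env m s -> regs s 8 = #|X| ->
  run W (emit sel degs ranks) s (200 * N.+1) (fun s' => output_is s' (output_word (pairs nb))).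
Proof.
move=> [kn _] e8; have e1 := loaded_budget (known_loaded kn).
have cX : #|X| <= n by apply: leq_trans (max_card _) _; rewrite card_ord.
set s3 := set_reg (set_arr (set_arr s 1 0 #|X|) 1 1 k) 12 2.
apply: (@run_weaken _ _ _ (3 + (3 + (2 + 100 * N.+1))) _
  (fun s' => known m s' /\ emitted (pairs nb) s')) => [|s' [_ []]|]; [by lia | by [] |].
apply: (run_then (R := fun s1 => s1 = set_arr s 1 0 #|X|)) => [|_ ->].
  apply: (wp_put (denotes_cst _ (leq0n W)) (denotes_reg e8 _)) => //.
  by move: N_lt; rewrite /N; lia.
apply: (run_then (R := fun s1 => s1 = set_arr (set_arr s 1 0 #|X|) 1 1 k)) => [|_ ->].
  by apply: (wp_put (i := 1) (v := k)) => //; [apply: denotes_cst; lia | apply: denotes_reg].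
apply: (run_then (R := fun s1 => s1 = s3)) => [|_ ->].
  by apply: wp_asg => //; apply: denotes_cst; lia.
apply: run_pairs => //=.
- apply: (known_frame (R := [:: 12]) (A := [:: 1]) m3) kn => //.
  by split=> r; rewrite inE => ne; rewrite /= ?upd_other.
- by split=> // -[|[|i]].
by move=> t q u s1 e kn1 _ d1 d2 em; apply: wp_emit_cmd e kn1 d1 d2 em.
Qed.

End Emit.

End Loops.

(** * Reading the input *)

Section Scan.
Variables (W n k : nat) (G : sgraph 'I_n) (nb : 'I_n -> seq 'I_n).
Hypothesis nbP : forall v, uniq (nb v) /\ nb v =i G v.
Let N := n + size (pairs nb).
Let input := n :: k :: map (word_item nb) (pairs nb).
Hypotheses (N_lt : N + 4 < W) (kW : k <= W).

Definition scan_size :=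
  Seq (Asg 4 (Cst 2))
  (Seq (For 0 (Asg 4 (Plus (Plus (Reg 4) (Get 0 (Reg 4))) (Cst 1))))
       (Asg 2 (Minus (Reg 4) (Cst 2)))).

(* Register 4 counts the vertices whose block has begun, register 5 the entries
   of the current block that are still to be read. *)
Definition scan_head :=
  Seq (Put 2 (Reg 3) (Reg 4)) (Seq (Put 3 (Reg 3) (Reg 4))
  (Seq (Asg 5 (Get 0 (Plus (Reg 3) (Cst 2)))) (Asg 4 (Plus (Reg 4) (Cst 1))))).

Definition scan_tail :=
  Seq (Put 2 (Reg 3) (Minus (Reg 4) (Cst 1)))
  (Seq (Put 3 (Reg 3) (Get 0 (Plus (Reg 3) (Cst 2))))
       (Asg 5 (Minus (Reg 5) (Cst 1)))).

Definition scan_cmd := If (Reg 5) (Cst 0) scan_head scan_tail.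

Definition scan_pairs := Seq (Asg 4 (Cst 0)) (Seq (Asg 5 (Cst 0)) (For 2 scan_cmd)).

Definition blocks (vs : seq 'I_n) := [seq (v, u) | v <- vs, u <- v :: nb v].

Lemma pairs_blocks t v u : enum 'I_n = t ++ v :: u ->
  pairs nb = blocks t ++ (v, v) :: [seq (v, x) | x <- nb v] ++ blocks u.
Proof. by move=> e; rewrite /pairs e allpairs_cat allpairs_cons. Qed.

Lemma nth_input t q u : pairs nb = t ++ q :: u -> nth 0 input (2 + size t) = word_item nb q.
Proof. by move=> e; rewrite /input e /= map_cat nth_cat size_map ltnn subnn. Qed.

Lemma run_scan_size s : regs s 0 = n -> arrs s 0 =1 nth 0 input ->
  run W scan_size s (30 * N.+1) (fun s' => regs s' 2 = size (pairs nb)).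
Proof.
move=> s0 sw; pose I t s' := regs s' 4 = 2 + size (blocks t).
apply: (@run_weaken _ _ _ (2 + (17 * n.+1 + 4))) => [|s' h|]; [by rewrite /N; lia | exact: h |].
apply: (run_then (R := fun s1 => s1 = set_reg s 4 2)) => [|_ ->].
  by apply: wp_asg => //; apply: denotes_cst; lia.
apply: (run_then (R := I (enum 'I_n))) => [|s2 I2]; last first.
  have d4 : denotes W s2 (Reg 4) (2 + size (pairs nb)).
    by apply: denotes_reg => //; have := N_lt; rewrite /N; lia.
  apply: (wp_asg (denotes_minus d4 (denotes_cst _ _))); first by lia.
  by rewrite /= addKn.
have -> : 17 * n.+1 = 17 * (size (enum 'I_n)).+1 by rewrite size_enum_ord.
apply: (run_foreach (I := I)) => //=.
- by rewrite size_enum_ord.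
- by rewrite size_enum_ord; have := N_lt; rewrite /N; lia.
move=> t v u s1 e fr e3 I1; have eb := pairs_blocks e.
have i4 : arrs s1 0 (2 + size (blocks t)) = size (nb v).
  by rewrite (proj2 fr) // sw (nth_input eb) /word_item eqxx.
have szN : 2 + size (blocks t) + size (nb v) + 1 + size (blocks u) <= W.
  by move: N_lt; rewrite /N eb size_cat /= size_cat size_map; lia.
have d4 : denotes W s1 (Reg 4) (2 + size (blocks t)) by apply: denotes_reg => //; lia.
have d0 : denotes W s1 (Get 0 (Reg 4)) (size (nb v)) by apply: denotes_get d4 i4 _; lia.
apply: wp_asg; first apply: denotes_plus (denotes_plus d4 d0 _) (denotes_cst _ _) _; try lia.
by rewrite /I /blocks allpairs_rcons size_cat /= size_map; upd_simpl; rewrite /blocks; lia.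
Qed.

Definition filled (t : seq ('I_n * 'I_n)) s := forall d i, i < size t ->
  arrs s 2 i = (nth d t i).1 /\ arrs s 3 i = (nth d t i).2.

Lemma filled_rcons t (q : 'I_n * 'I_n) s s' : filled t s ->
  arrs s' 2 =1 upd (arrs s 2) (size t) q.1 -> arrs s' 3 =1 upd (arrs s 3) (size t) q.2 ->
  filled (rcons t q) s'.
Proof.
move=> ft e2 e3 d i; rewrite size_rcons ltnS leq_eqVlt e2 e3 nth_rcons /upd.
by case: ltngtP => //= it _; apply: ft.
Qed.

Definition scanned (t : seq ('I_n * 'I_n)) s := filled t s /\
  exists r vs ws, [/\ pairs nb = t ++ r ++ blocks ws, enum 'I_n = vs ++ ws,
    size vs = regs s 4, size r = regs s 5 &
    forall q, q \in r -> regs s 4 = q.1.+1 /\ q.1 != q.2].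

Lemma wp_scan_head t (v : 'I_n) ws vs s : pairs nb = t ++ blocks (v :: ws) ->
  enum 'I_n = vs ++ v :: ws -> regs s 3 = size t -> regs s 4 = v ->
  arrs s 0 =1 nth 0 input -> filled t s ->
  wp W scan_head (fun s' => scanned (rcons t (v, v)) (set_reg s' 3 (size t).+1)) s.
Proof.
move=> e ev e3 e4 sw ft; have vn := ltn_ord v; have NW := N_lt.
have eb : pairs nb = t ++ (v, v) :: [seq (v, x) | x <- nb v] ++ blocks ws.
  by rewrite e /blocks allpairs_cons.
have bounds : size t + 2 + size (nb v) <= W.
  by move: NW; rewrite /N eb size_cat /= size_cat size_map; lia.
have d3 s1 : regs s1 3 = size t -> denotes W s1 (Reg 3) (size t).
  by move=> r3; apply: denotes_reg; lia.
have d4 s1 : regs s1 4 = v -> denotes W s1 (Reg 4) v.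
  by move=> r4; apply: denotes_reg; lia.
apply/wp_seq/(wp_put (d3 _ e3) (d4 _ e4)); set s1 := set_arr _ _ _ _.
apply/wp_seq/(wp_put (d3 s1 e3) (d4 s1 e4)); set s2 := set_arr _ _ _ _.
have d0 : denotes W s2 (Get 0 (Plus (Reg 3) (Cst 2))) (size (nb v)).
  apply: denotes_get (denotes_plus (d3 s2 e3) (denotes_cst _ _) _) _ _; try lia.
  by upd_simpl; rewrite addnC sw (nth_input eb) /word_item eqxx.
apply/wp_seq/(wp_asg d0)/(wp_asg (v := v + 1)).
  by apply: denotes_plus (d4 _ e4) (denotes_cst _ _) _; lia.
split; first by apply: filled_rcons ft _ _ => i; rewrite /= ?upd_same.
exists [seq (v, x) | x <- nb v], (rcons vs v), ws; split=> [||||_ /mapP[x xv ->]].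
- by rewrite cat_rcons.
- by rewrite cat_rcons.
- by rewrite size_rcons (size_enum_ord_prefix ev) /= addn1.
- by rewrite size_map.
split; first by rewrite /= addn1.
by apply: contraTneq xv => /= <-; rewrite (mem_nb nbP) adj_irr.
Qed.

Lemma wp_scan_tail t (q : 'I_n * 'I_n) r ws vs s : pairs nb = t ++ q :: r ++ blocks ws ->
  enum 'I_n = vs ++ ws -> size vs = regs s 4 -> size (q :: r) = regs s 5 ->
  (forall p, p \in q :: r -> regs s 4 = p.1.+1 /\ p.1 != p.2) -> regs s 3 = size t ->
  arrs s 0 =1 nth 0 input -> filled t s ->
  wp W scan_tail (fun s' => scanned (rcons t q) (set_reg s' 3 (size t).+1)) s.
Proof.
move=> e ev e4 e5 rq e3 sw ft; have NW := N_lt.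
have [eq1 ne] := rq q (mem_head _ _).
have vW (v : 'I_n) : v < W by apply: leq_trans (ltn_ord v) _; move: NW; rewrite /N; lia.
have bounds : size t + 2 + size (q :: r) <= W.
  by move: NW; rewrite /N e size_cat /= size_cat; lia.
have d3 s1 : regs s1 3 = size t -> denotes W s1 (Reg 3) (size t).
  by move=> r3; apply: denotes_reg; lia.
have d1 : denotes W s (Minus (Reg 4) (Cst 1)) (q.1.+1 - 1).
  by apply: denotes_minus (denotes_reg eq1 (vW _)) (denotes_cst _ _); lia.
apply/wp_seq/(wp_put (d3 s e3) d1); set s1 := set_arr _ _ _ _.
have d0 : denotes W s1 (Get 0 (Plus (Reg 3) (Cst 2))) q.2.
  apply: denotes_get (denotes_plus (d3 s1 e3) (denotes_cst _ _) _) _ (ltnW (vW _)); try lia.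
  by upd_simpl; rewrite addnC sw (nth_input e) /word_item (negbTE ne).
apply/wp_seq/(wp_put (d3 s1 e3) d0)/(wp_asg (v := size (q :: r) - 1)).
  by apply: denotes_minus (denotes_reg _ _) (denotes_cst _ _); [rewrite e5 | lia | lia].
split.
  by apply: filled_rcons ft _ _ => i; rewrite /= ?upd_same ?subn1.
exists r, vs, ws; split=> // [||p pr].
- by rewrite cat_rcons.
- by rewrite /= subn1.
by apply: rq; rewrite inE pr orbT.
Qed.

Lemma wp_scan_cmd t (q : 'I_n * 'I_n) u s : pairs nb = t ++ q :: u -> regs s 3 = size t ->
  arrs s 0 =1 nth 0 input -> scanned t s ->
  wp W scan_cmd (fun s' => scanned (rcons t q) (set_reg s' 3 (size t).+1)) s.
Proof.
move=> e e3 sw [ft [r [vs [ws [e' ev e4 e5 rq]]]]].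
have rest : q :: u = r ++ blocks ws.
  by have := congr1 (drop (size t)) e; rewrite e' !drop_size_cat.
have r_le : regs s 5 <= W.
  by have := N_lt; rewrite /N e' -e5 !size_cat; lia.
apply: (wp_if (denotes_reg (erefl (regs s 5)) r_le) (denotes_cst _ (leq0n W))).
  rewrite -e5 leqn0 size_eq0 => /eqP r0; move: rest e'; rewrite r0 /=.
  case: ws ev => [|v ws] // ev [-> _] e'.
  by apply: (wp_scan_head e' ev e3 _ sw ft); rewrite -e4 (size_enum_ord_prefix ev).
move: rest e' e5 rq; case: r => [|p r] /=; first by move=> _ _ <-.
move=> [-> _] e' e5 rq _; exact: (wp_scan_tail e' ev e4 e5 rq e3 sw ft).
Qed.

Lemma run_scan_pairs s : regs s 2 = size (pairs nb) -> arrs s 0 =1 nth 0 input ->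
  run W scan_pairs s (60 * N.+1) (filled (pairs nb)).
Proof.
move=> s2 sw; have NW := N_lt; rewrite /N in NW.
apply: (@run_weaken _ _ _ (2 + (2 + 50 * (size (pairs nb)).+1)) _ (scanned (pairs nb))) =>
  [|s' []|] //; first by rewrite /N; lia.
apply: (run_then (R := fun s1 => s1 = set_reg s 4 0)) => [|_ ->].
  by apply: wp_asg => //; apply: denotes_cst.
apply: (run_then (R := fun s1 => s1 = set_reg (set_reg s 4 0) 5 0)) => [|_ ->].
  by apply: wp_asg => //; apply: denotes_cst.
apply: (@run_weaken _ _ _ ((cost scan_cmd + 10) * (size (pairs nb)).+1) _
  (scanned (pairs nb))) => //.
  by rewrite leq_mul2r orbT.
apply: (run_foreach (I := scanned)) => //=; first by lia.
  by split=> //; exists [::], [::], (enum 'I_n).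
by move=> t q u s1 e fr e3 sc; apply: wp_scan_cmd e e3 _ sc => i; rewrite (proj2 fr) // sw.
Qed.

Definition load := Seq (Asg 0 (Get 0 (Cst 0))) (Seq (Asg 1 (Get 0 (Cst 1)))
  (Seq scan_size scan_pairs)).

Lemma run_load spec : (forall a f, spec a = Some f -> 3 < a) ->
  run W load (input_state input) (100 * N.+1) (env k nb spec 4).
Proof.
move=> spec_gt3; have NW := N_lt; rewrite /N in NW.
apply: (@run_weaken _ _ _ (3 + (3 + (30 * N.+1 + 60 * N.+1))) _ (fun s =>
    [/\ regs s 0 = n, regs s 1 = k, regs s 2 = size (pairs nb), filled (pairs nb) s &
        forall a i, 4 <= a -> arrs s a i = 0])) => [|s [e0 e1 e2 fl z]|]; first by lia.
  split=> //; split=> [|a f a4 /spec_gt3]; last by rewrite leqNgt a4.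
  split=> // t q u e; have := fl q (size t).
  by rewrite e nth_cat ltnn subnn size_cat /= addnS ltnS leq_addr => /(_ isT).
set s0 := input_state _; set s1 := set_reg s0 0 n; set s2 := set_reg s1 1 k.
apply: (run_then (R := fun s => s = s1)) => [|_ ->].
  by apply: wp_asg => //; apply: denotes_get (denotes_cst _ _) _ _ => //; lia.
apply: (run_then (R := fun s => s = s2)) => [|_ ->].
  by apply: wp_asg => //; apply: denotes_get (denotes_cst _ _) _ _ => //; lia.
apply: (run_then (run_frame (run_scan_size _ _))) => // s3 [e2 [fr3 fa3]].
apply: run_weaken (leqnn _) _ (run_frame (run_scan_pairs e2 _)) => [s4 [fl [fr4 fa4]]|i].
  split=> // [|||a i a4]; [by rewrite fr4 // fr3 | by rewrite fr4 // fr3 | by rewrite fr4 |].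
  by rewrite fa4 /= ?inE ?fa3 //; case: a a4 => [|[|[|[|a]]]].
by rewrite fa3.
Qed.

End Scan.

(** * The kernelization program *)

Local Notation open_rep_arr := 8 (only parsing).
Local Notation closed_rep_arr := 13 (only parsing).
Local Notation degree_arr := 14 (only parsing).
Local Notation twins_arr := 15 (only parsing).
Local Notation self_arr := 16 (only parsing).
Local Notation near_arr := 17 (only parsing).
Local Notation root_arr := 18 (only parsing).
Local Notation class_size_arr := 19 (only parsing).
Local Notation parts_arr := 20 (only parsing).
Local Notation crossing_arr := 21 (only parsing).
Local Notation irregular_arr := 22 (only parsing).
Local Notation unrecognized_arr := 23 (only parsing).
Local Notation false_kept_arr := 25 (only parsing).
Local Notation kept_arr := 27 (only parsing).
Local Notation kept_degree_arr := 28 (only parsing).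
Local Notation kept_rank_arr := 29 (only parsing).

Definition at_root a := Get a (Get root_arr (Reg 3)).

(* Each [positive] is 0 or 1, so [Minus (Plus _ _) (Cst 1)] is a conjunction. *)
Definition unrecognized_expr l :=
  Minus (Plus (positive (Get degree_arr (Reg 3)))
    (positive (Plus (Plus (at_root crossing_arr) (at_root irregular_arr))
      (Minus (Plus (positive (Minus (at_root parts_arr) (Cst l)))
                   (positive (Minus (at_root class_size_arr) (at_root parts_arr))))
             (Cst 1))))) (Cst 1).

Definition double_budget_plus i := Plus (Plus (Reg 1) (Reg 1)) (Cst i).

Fixpoint block (cs : seq cmd) : cmd := if cs is c :: cs' then Seq c (block cs') else Skip.

Definition open_twins_pass := twin_pass 4 (Cst 1) (absdiff src dst).

Definition closed_twins_pass := twin_pass 9 (Cst 0) (Cst 0).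

Definition degrees_pass := count_pairs_cmd degree_arr src (Cst 1) (absdiff src dst).

Definition twin_counts_pass := count_vertices twins_arr (Get open_rep_arr (Reg 3)) (Cst 0) (Cst 0).

Definition identity_pass := fill self_arr (Reg 3).

Definition near_pass := min_pass self_arr near_arr.

Definition root_pass := min_pass near_arr root_arr.

Definition root_classes_pass :=
  count_vertices class_size_arr (Get root_arr (Reg 3)) (Cst 0) (Cst 0).

Definition parts_pass :=
  count_vertices parts_arr (Get root_arr (Reg 3))
    (absdiff (Get open_rep_arr (Reg 3)) (Reg 3)) (Cst 0).

Definition crossing_pass :=
  count_pairs_cmd crossing_arr (Get root_arr src) (Cst 1)
    (absdiff (Get root_arr src) (Get root_arr dst)).

Definition irregular_pass :=
  count_vertices irregular_arr (Get root_arr (Reg 3)) (Cst 1)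
    (absdiff (Plus (Get degree_arr (Reg 3)) (Get twins_arr (Get open_rep_arr (Reg 3))))
             (at_root class_size_arr)).

Definition unrecognized_pass l := fill unrecognized_arr (unrecognized_expr l).

Definition false_twin_kernel_pass :=
  truncate_pass unrecognized_arr open_rep_arr 24 (double_budget_plus 2).

Definition true_twin_kernel_pass l :=
  truncate_pass false_kept_arr closed_rep_arr 26 (double_budget_plus l.+1).

Definition kernel_degrees_pass :=
  count_pairs_cmd kept_degree_arr src (Cst 2)
    (Plus (Get kept_arr dst) (positive (absdiff src dst))).

Definition kernel_ranks_pass := rank_pass kept_arr kept_rank_arr.

Definition find_kernel l := block [:: load; open_twins_pass; closed_twins_pass;
  degrees_pass; twin_counts_pass; identity_pass; near_pass; root_pass; root_classes_pass;
  parts_pass; crossing_pass; irregular_pass; unrecognized_pass l;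
  false_twin_kernel_pass; true_twin_kernel_pass l;
  kernel_degrees_pass; kernel_ranks_pass].

Section FindKernel.
Variables (n l k : nat) (G : sgraph 'I_n) (nb : 'I_n -> seq 'I_n) (W : nat).
Hypothesis nbP : forall v, uniq (nb v) /\ nb v =i G v.
Let N := n + size (pairs nb).
Hypothesis W_ge : 10 * l * n ^ 2 + 2 * N + 2 * k + 10 * l + 20 <= W.

(* Arrays without an entry are scratch. *)
Definition contents (a : nat) : option ('I_n -> nat) :=
  match a with
  | open_rep_arr => Some (fun v => nat_of_ord (class_rep (nbhd G) v))
  | closed_rep_arr => Some (fun v => nat_of_ord (class_rep (cnbhd G) v))
  | degree_arr => Some (fun v => #|nbhd G v|)
  | twins_arr => Some (fun r => #|[set v | class_rep (nbhd G) v == r]|)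
  | self_arr => Some (fun v => nat_of_ord v)
  | near_arr => Some (fun v => nat_of_ord (cnbhd_min G id v))
  | root_arr => Some (fun v => nat_of_ord (root G v))
  | class_size_arr => Some (fun r => #|root_class G r|)
  | parts_arr => Some (fun r => #|parts G r|)
  | crossing_arr => Some (fun r => #|crossing G r|)
  | irregular_arr => Some (fun r => #|irregular G r|)
  | unrecognized_arr => Some (fun v => nat_of_bool (v \in ~: recognized l G))
  | false_kept_arr => Some (fun v => nat_of_bool (v \in false_twin_kernel l k G))
  | kept_arr => Some (fun v => nat_of_bool (v \in kernel l k G))
  | kept_degree_arr => Some (degree_in G (kernel l k G))
  | kept_rank_arr => Some (rank (kernel l k G))
  | _ => None
  end.

Lemma contents_gt3 a f : contents a = Some f -> 3 < a.
Proof. by case: a => [|[|[|[|a]]]]. Qed.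

Lemma word_bounds : 0 < l ->
  2 * (n * n) + n + l + 20 <= W /\ 2 * N + 2 * k + 10 * l + 20 <= W.
Proof.
move=> l0; have : 10 * (n * n) <= 10 * l * n ^ 2.
  by rewrite -mulnn -!mulnA leq_mul2l /= leq_pmull.
by move: W_ge; rewrite /N; lia.
Qed.

Hypothesis l_gt0 : 0 < l.

Lemma contents_le a f v : contents a = Some f -> f v <= W.
Proof.
have [sq lin] := word_bounds l_gt0.
have ord_le (x : 'I_n) : x <= W by have := ltn_ord x; move: lin; rewrite /N; lia.
have bool_le (x : bool) : x <= W by have := leq_b1 x; move: lin; lia.
have set_le (X : {set 'I_n}) : #|X| <= W.
  by apply: leq_trans (max_card _) _; rewrite card_ord; move: lin; rewrite /N; lia.
have pairs_le (X : {set 'I_n * 'I_n}) : #|X| <= W.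
  by apply: leq_trans (max_card _) _; rewrite card_prod card_ord; lia.
do 30?[case: a => [|a] //]; case=> <-;
  by [exact: ord_le | exact: bool_le | exact: set_le | exact: pairs_le].
Qed.

Lemma N_lt_W : N + 4 < W.
Proof. by have [_] := word_bounds l_gt0; lia. Qed.

Let N_lt : N.+2 < W.
Proof. by have := N_lt_W; lia. Qed.

Let ready := env k nb contents.

Lemma denotes_entry a f m e v s : known k nb contents m s -> a < m -> contents a = Some f ->
  denotes W s e (v : 'I_n) -> denotes W s (Get a e) (f v).
Proof. exact: known_denotes contents_le _ _ _ _ _ _. Qed.

Local Notation entry a kn d := (denotes_entry (a := a) kn isT (erefl _) d).

Lemma open_hits u x :
  (hits [seq q <- pairs nb | q.1 != q.2] u == hits [seq q <- pairs nb | q.1 != q.2] x) =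
  (nbhd G u == nbhd G x).
Proof.
suff hitsE v : hits [seq q <- pairs nb | q.1 != q.2] v = nbhd G v by rewrite !hitsE.
apply/setP => w; rewrite inE mem_filter (mem_pairs nbP) in_cnbhd in_nbhd adj_sym /=.
by case: eqVneq => [->|_] //=; rewrite adj_irr.
Qed.

Lemma closed_hits u x :
  (hits [seq q <- pairs nb | true] u == hits [seq q <- pairs nb | true] x) =
  (cnbhd G u == cnbhd G x).
Proof.
suff hitsE v : hits [seq q <- pairs nb | true] v = cnbhd G v by rewrite !hitsE.
by apply/setP => w; rewrite inE mem_filter (mem_pairs nbP) cnbhd_sym.
Qed.

Lemma run_open_twins s : ready 4 s ->
  run W open_twins_pass s (300 * N.+1) (ready 9).
Proof.
apply: (run_twin_pass N_lt contents_gt3 nbP (f := nbhd G) (gd := fun q => q.1 != q.2)) => //.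
  exact: open_hits.
by move=> s' q d1 d2; rewrite -val_eqE; exact: (tests_neq N_lt d1 d2).
Qed.

Lemma run_closed_twins s : ready 9 s ->
  run W closed_twins_pass s (300 * N.+1) (ready degree_arr).
Proof.
apply: (run_twin_pass N_lt contents_gt3 nbP (f := cnbhd G) (gd := xpredT)) => //.
  exact: closed_hits.
by move=> s' q _ _; apply: tests_true.
Qed.

Lemma card_pairs_from (P : rel 'I_n) i :
  #|[set q : 'I_n * 'I_n | P q.1 q.2 && (q.1 == i)]| = #|[set u | P i u]|.
Proof.
rewrite -(card_imset [set u | P i u] (f := pair i)); last by move=> u w [].
apply: eq_card => -[v u]; rewrite inE /=; apply/andP/imsetP => [[Pvu /eqP<-]|[w + [-> ->]]].
  by exists u; rewrite ?inE.
by rewrite inE => ->.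
Qed.

Lemma run_degrees s : ready degree_arr s ->
  run W degrees_pass s (100 * N.+1) (ready twins_arr).
Proof.
move=> en; apply: (run_count_pairs N_lt contents_gt3 nbP (ix := fst)
  (gd := fun q => q.1 != q.2) (b := degree_arr) isT _ (erefl _) _ en)
  => // [i|s' q _ d1 d2]; last first.
  by split=> //; rewrite -val_eqE; exact: (tests_neq N_lt d1 d2).
have -> : nbhd G i = [set u | (u \in cnbhd G i) && (i != u)].
  apply/setP => u; rewrite !inE; case: eqVneq => [->|_] /=; last by rewrite andbT.
  by rewrite adj_irr.
rewrite -(card_pairs_from (fun v u => (u \in cnbhd G v) && (v != u))).
by apply: eq_card => q; rewrite !inE andbA.
Qed.

Lemma run_twin_counts s : ready twins_arr s ->
  run W twin_counts_pass s (100 * N.+1) (ready self_arr).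
Proof.
move=> en; apply: (run_count_vertices N_lt contents_gt3 (ix := class_rep (nbhd G)) (gd := xpredT)
  (b := twins_arr) isT _ (erefl _) _ en) => // s' v kn d; split; last exact: tests_true.
exact: (entry open_rep_arr kn d).
Qed.

Lemma run_identity s : ready self_arr s ->
  run W identity_pass s (100 * N.+1) (ready near_arr).
Proof. by move=> en; apply: (run_fill N_lt contents_gt3 (b := self_arr) isT _ (erefl _) en). Qed.

Lemma run_near s : ready near_arr s ->
  run W near_pass s (200 * N.+1) (ready root_arr).
Proof.
by apply: (run_min_pass N_lt contents_gt3 contents_le nbP (f := id)).
Qed.

Lemma run_root s : ready root_arr s ->
  run W root_pass s (200 * N.+1) (ready class_size_arr).
Proof.
by apply: (run_min_pass N_lt contents_gt3 contents_le nbP (f := cnbhd_min G id)).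
Qed.

Lemma run_root_classes s : ready class_size_arr s ->
  run W root_classes_pass s (100 * N.+1) (ready parts_arr).
Proof.
move=> en; apply: (run_count_vertices N_lt contents_gt3 (ix := root G) (gd := xpredT)
  (b := class_size_arr) isT _ (erefl _) _ en) => // s' v kn d; split; last exact: tests_true.
exact: (entry root_arr kn d).
Qed.

Lemma run_parts s : ready parts_arr s ->
  run W parts_pass s (100 * N.+1) (ready crossing_arr).
Proof.
move=> en; apply: (run_count_vertices N_lt contents_gt3 (ix := root G)
  (gd := fun v => class_rep (nbhd G) v == v) (b := parts_arr) isT _ (erefl _) _ en)
  => // [i|s' v kn d].
  by apply: eq_card => v; rewrite !inE.
split; first exact: (entry root_arr kn d).
by rewrite -val_eqE; exact: (tests_eq N_lt (entry open_rep_arr kn d) d).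
Qed.

Lemma run_crossing s : ready crossing_arr s ->
  run W crossing_pass s (100 * N.+1) (ready irregular_arr).
Proof.
move=> en; apply: (run_count_pairs N_lt contents_gt3 nbP (ix := fun q => root G q.1)
  (gd := fun q => root G q.1 != root G q.2) (b := crossing_arr) isT _ (erefl _) _ en)
  => // [i|s' q kn d1 d2].
  apply: eq_card => -[v u]; rewrite !inE /=; case: (eqVneq u v) => [->|_] //=.
  by rewrite eqxx andbF.
have r1 := entry root_arr kn d1; split=> //.
rewrite -val_eqE; exact: (tests_neq N_lt r1 (entry root_arr kn d2)).
Qed.

Lemma run_irregular s : ready irregular_arr s ->
  run W irregular_pass s (100 * N.+1) (ready unrecognized_arr).
Proof.
move=> en; apply: (run_count_vertices N_lt contents_gt3 (ix := root G)
  (gd := fun v => #|nbhd G v| + #|twins G v| != #|root_class G (root G v)|)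
  (b := irregular_arr) isT _ (erefl _) _ en) => // s' v kn d.
have dr := entry root_arr kn d; split=> //.
have twinsE : [set w | class_rep (nbhd G) w == class_rep (nbhd G) v] = twins G v.
  by apply/setP => w; rewrite !inE class_rep_eq.
have dt := entry twins_arr kn (entry open_rep_arr kn d).
rewrite /= twinsE in dt.
apply: (tests_neq N_lt (denotes_plus (entry degree_arr kn d) dt _)
  (entry class_size_arr kn dr)).
have card_le (X : {set 'I_n}) : #|X| <= n by rewrite -[X in _ <= X]card_ord max_card.
apply: leq_trans (leq_add (card_le _) (card_le _)) _.
by have [_ lin] := word_bounds l_gt0; move: lin; rewrite /N; lia.
Qed.

Lemma run_unrecognized s : ready unrecognized_arr s ->
  run W (unrecognized_pass l) s (100 * N.+1) (ready 24).
Proof.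
move=> en.
apply: (run_fill N_lt contents_gt3 (b := unrecognized_arr) isT _ (erefl _) en) => // s' v kn _ d.
have W0 : 0 < W by have := N_lt; lia.
have [sq lin] := word_bounds l_gt0.
have lW : l <= W by move: lin; lia.
have W3 : 2 < W by move: lin; lia.
have dr := entry root_arr kn d.
have dpos e i := @denotes_positive W s' e i W0.
have ddeg := entry degree_arr kn d.
have dclass := entry class_size_arr kn dr.
have dparts := entry parts_arr kn dr.
have dcross := entry crossing_arr kn dr.
have dirr := entry irregular_arr kn dr.
have few : #|crossing G (root G v)| + #|irregular G (root G v)| < W.
  apply: leq_ltn_trans (leq_add (max_card _) (max_card _)) _.
  by rewrite card_prod card_ord; move: sq; lia.
have dbad := denotes_plus dcross dirr (ltnW few).
have bool_le (b c : bool) : b + c <= W by case: b; case: c => /=; lia.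
have d1 : denotes W s' (Cst 1) 1 by apply: denotes_cst; lia.
have dmany := denotes_minus (denotes_plus (dpos _ _ (denotes_minus dparts (denotes_cst _ lW)))
  (dpos _ _ (denotes_minus dclass dparts)) (bool_le _ _)) d1.
have dbad_or_many := denotes_plus dbad dmany ltac:(lia).
suff <- : (0 < #|nbhd G v|) + (0 < #|crossing G (root G v)| + #|irregular G (root G v)| +
    ((0 < #|parts G (root G v)| - l) +
     (0 < #|root_class G (root G v)| - #|parts G (root G v)|) - 1)) - 1 =
    (v \in ~: recognized l G).
  exact: denotes_minus (denotes_plus (dpos _ _ ddeg) (dpos _ _ dbad_or_many) (bool_le _ _)) d1.
by rewrite !inE -!cards_eq0; lia.
Qed.

Lemma loaded_double_budget_plus i s : 2 * k + i <= W -> loaded k nb s ->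
  denotes W s (double_budget_plus i) (2 * k + i).
Proof.
move=> le ld; rewrite -[2 * k]/(k + (k + 0)) addn0.
have dk : denotes W s (Reg 1) k by apply: denotes_reg (loaded_budget ld) _; lia.
by apply: denotes_plus (denotes_plus dk dk _) (denotes_cst _ _) _; lia.
Qed.

Lemma run_false_twin_kernel s : ready 24 s ->
  run W false_twin_kernel_pass s (100 * N.+1) (ready 26).
Proof.
apply: (run_truncate_pass N_lt contents_gt3 contents_le (f := nbhd G) (X := ~: recognized l G)
  (m := 2 * k + 2)) => // s' ld.
by apply: loaded_double_budget_plus ld; have [_] := word_bounds l_gt0; lia.
Qed.

Lemma run_true_twin_kernel s : ready 26 s ->
  run W (true_twin_kernel_pass l) s (100 * N.+1) (ready kept_degree_arr).
Proof.
apply: (run_truncate_pass N_lt contents_gt3 contents_le (f := cnbhd G)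
  (X := false_twin_kernel l k G) (m := 2 * k + l.+1)) => // s' ld.
by apply: loaded_double_budget_plus ld; have [_] := word_bounds l_gt0; lia.
Qed.

Lemma run_kernel_degrees s : ready kept_degree_arr s ->
  run W kernel_degrees_pass s (100 * N.+1) (ready kept_rank_arr).
Proof.
move=> en; apply: (run_count_pairs N_lt contents_gt3 nbP (ix := fst)
  (gd := fun q => (q.2 \in kernel l k G) && (q.1 != q.2)) (b := kept_degree_arr) isT _
  (erefl _) _ en) => // [i|s' q kn d1 d2]; last first.
  have W2 : 1 < W by have := N_lt; lia.
  have dx := entry kept_arr kn d2.
  have dn := denotes_positive (ltnW W2) (denotes_absdiff d1 d2).
  split=> //; do 2 eexists; split; [exact: denotes_cst | apply: denotes_plus dx dn _ |].
    by case: (_ \in _); case: (0 < _) => /=; lia.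
  by rewrite -val_eqE /distance; case: (_ \in _) => /=; lia.
have -> : degree_in G (kernel l k G) i =
    #|[set u | [&& u \in cnbhd G i, u \in kernel l k G & i != u]]|.
  apply: eq_card => u; rewrite in_setI in_nbhd [RHS]in_set in_cnbhd.
  by case: (eqVneq i u) => [<-|_] /=; rewrite ?adj_irr ?andbF ?andbT.
rewrite -(card_pairs_from (fun v u => [&& u \in cnbhd G v, u \in kernel l k G & v != u])).
by apply: eq_card => q; rewrite !in_set !andbA.
Qed.

Lemma run_kernel_ranks s : ready kept_rank_arr s ->
  run W kernel_ranks_pass s (200 * N.+1)
    (fun s' => ready 30 s' /\ regs s' 8 = #|kernel l k G|).
Proof.
move=> en.
exact: (run_rank_pass N_lt contents_gt3 contents_le (a := kept_arr) (b := kept_rank_arr)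
  isT isT (erefl _) (erefl _) en).
Qed.

Lemma run_find_kernel :
  run W (find_kernel l) (input_state (n :: k :: map (word_item nb) (pairs nb))) (2500 * N.+1)
    (fun s' => ready 30 s' /\ regs s' 8 = #|kernel l k G|).
Proof.
have kW : k <= W by have [_] := word_bounds l_gt0; lia.
pose times := [:: 100; 300; 300; 100; 100; 100; 200; 200; 100; 100; 100; 100; 100; 100; 100;
  100; 200].
apply: (run_weaken (t := foldr (fun c t => c * N.+1 + t) 1 times) _ (fun _ h => h)).
  by rewrite /=; lia.
apply: run_then (run_load nbP N_lt_W kW contents_gt3) _ => s /run_open_twins r.
apply: (run_then r) => {r}s /run_closed_twins r.
apply: (run_then r) => {r}s /run_degrees r.
apply: (run_then r) => {r}s /run_twin_counts r.
apply: (run_then r) => {r}s /run_identity r.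
apply: (run_then r) => {r}s /run_near r.
apply: (run_then r) => {r}s /run_root r.
apply: (run_then r) => {r}s /run_root_classes r.
apply: (run_then r) => {r}s /run_parts r.
apply: (run_then r) => {r}s /run_crossing r.
apply: (run_then r) => {r}s /run_irregular r.
apply: (run_then r) => {r}s /run_unrecognized r.
apply: (run_then r) => {r}s /run_false_twin_kernel r.
apply: (run_then r) => {r}s /run_true_twin_kernel r.
apply: (run_then r) => {r}s /run_kernel_degrees r.
apply: (run_then r) => {r}s /run_kernel_ranks r.
apply: (run_then r) => {r}s h.
by exists 1, s; split=> //; constructor.
Qed.

End FindKernel.

(** * The output *)

Definition path4_rel : rel 'I_4 := fun i j => (val i == j.+1) || (val j == i.+1).

Lemma path4_sym : symmetric path4_rel.
Proof. by move=> i j; rewrite /path4_rel orbC. Qed.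

Lemma path4_irr : irreflexive path4_rel.
Proof. by move=> i; rewrite /path4_rel orbb ltn_eqF. Qed.

Definition path4 := SGraph path4_sym path4_irr.

Lemma path4_no l : ~ yes_instance l path4 0.
Proof.
rewrite yes_instanceE => -[C [P [c [p [_ /no_conflicts adjE]]]]].
pose v i : 'I_4 := inord i.
have {adjE} joinedE i j : i < 4 -> j < 4 ->
    (i == j.+1) || (j == i.+1) = (c (v i) == c (v j)) && (p (v i) != p (v j)).
  by move=> i4 j4; rewrite -[RHS]adjE ?inE //= /path4_rel /v /= !inordK.
have [/esym/andP[/eqP c01 _] /esym/andP[/eqP c12 _]] := (joinedE 0 1 isT isT, joinedE 1 2 isT isT).
have /esym/andP[/eqP c23 p23] := joinedE 2 3 isT isT.
have := joinedE 0 2 isT isT; have := joinedE 0 3 isT isT.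
rewrite c01 c12 -c23 eqxx /= => /esym/negbFE/eqP p03 /esym/negbFE/eqP p02.
by rewrite -p03 -p02 eqxx in p23.
Qed.

Definition path4_word := [:: 4; 0; 1; 1; 2; 0; 2; 2; 1; 3; 1; 2].

Lemma path4_encodes : encodes path4 0 path4_word.
Proof.
exists (fun v => [seq u <- enum 'I_4 | path4 v u]); split=> [v|].
  split; first by rewrite filter_uniq ?enum_uniq.
  by move=> u; rewrite mem_filter mem_enum andbT.
pose nb i := [seq j <- iota 0 4 | (i == j.+1) || (j == i.+1)].
have nbE (v : 'I_4) : map val [seq u <- enum 'I_4 | path4 v u] = nb v.
  by rewrite /nb -val_enum_ord filter_map; congr map; apply: eq_filter.
have itemE (v : 'I_4) : size [seq u <- enum 'I_4 | path4 v u] ::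
    map val [seq u <- enum 'I_4 | path4 v u] = size (nb v) :: nb v.
  by rewrite -nbE size_map.
by rewrite (eq_map itemE) (map_comp (fun i => size (nb i) :: nb i) val) val_enum_ord.
Qed.

Fixpoint put_word i (u : seq nat) : cmd :=
  if u is x :: u' then Seq (Put 1 (Cst i) (Cst x)) (put_word i.+1 u') else Skip.

Lemma wp_put_word W u w s : output_is s w -> size w + size u <= W ->
  all (fun x => x <= W) u -> wp W (put_word (size w) u) (fun s' => output_is s' (w ++ u)) s.
Proof.
elim: u w s => [|x u IH] w s out le /=; first by move=> _; rewrite cats0; apply: wp_skip.
case/andP => xW uW; apply: wp_seq; apply: (wp_put (denotes_cst _ _) (denotes_cst _ xW)).
  by move: le => /=; lia.
rewrite -cat_rcons -(size_rcons w x); apply: IH => //; last by rewrite size_rcons -addSnnS in le *.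
exact: output_is_rcons.
Qed.

Definition times_reg x y e := Seq (Asg y (Cst 0)) (For x (Asg y (Plus (Reg y) e))).

Lemma run_times_reg W x y e i j s : regs s x = i -> i < W -> i * j <= W ->
  x \notin [:: 3; y] -> y != 3 ->
  (forall s', frame [:: 3; y] [::] s s' -> denotes W s' e j) ->
  run W (times_reg x y e) s ((ecost e + 20) * i.+1) (fun s' => regs s' y = i * j).
Proof.
move=> ex iW ijW xy y3 de; pose I (t : seq nat) s' := regs s' y = size t * j.
apply: (@run_weaken _ _ _ (2 + (ecost e + 3 + 10) * i.+1) _ (I (iota 0 i))) => [|s'|].
- by nia.
- by rewrite /I size_iota.
apply: (run_then (R := fun s1 => s1 = set_reg s y 0)) => [|_ ->].
  by apply: wp_asg => //; apply: denotes_cst.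
move: xy; rewrite inE negb_or mem_seq1 => /andP[x3 xy].
apply: (run_weaken _ (fun _ h => h)); last first.
  apply: (run_foreach (E := iota 0 i) (I := I)) => //=; rewrite ?size_iota //.
  - by rewrite upd_other.
  - by rewrite !inE negb_or x3.
  - by rewrite inE eq_sym.
  - by rewrite /I /= upd_other // upd_same.
  move=> t q u s' eE fr _ It; have ti : (size t).+1 * j <= i * j.
    by rewrite leq_mul // -(size_iota 0 i) eE size_cat /= addnS ltnS leq_addr.
  have dy : denotes W s' (Reg y) (size t * j) by apply: denotes_reg => //; lia.
  apply: (wp_asg (v := size t * j + j)).
    apply: denotes_plus dy (de _ _) _; last by lia.
    apply: frame_trans fr; apply: frame_sub (frame_set_reg s y 0) => // r.
    by rewrite !inE => ->; rewrite orbT.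
  by rewrite /I /= upd_other // upd_same size_rcons mulSn addnC.
by rewrite size_iota /=; lia.
Qed.

(* Cutting at [n], which bounds the kernel anyway, keeps the loops that compute
   the size bound linear. *)
Definition cap n k := minn (maxn k 1) n.

Definition cap_cmd :=
  Seq (Asg 9 (Reg 1)) (Seq (If (Cst 1) (Reg 9) Skip (Asg 9 (Cst 1)))
    (If (Reg 9) (Reg 0) Skip (Asg 9 (Reg 0)))).

Definition size_bound_cmd l :=
  Seq cap_cmd (Seq (times_reg 9 10 (Cst (10 * l))) (times_reg 9 11 (Reg 10))).

Definition replace_large := If (Reg 8) (Reg 11) Skip (put_word 0 path4_word).

Definition kernelize l :=
  Seq (find_kernel l) (Seq (size_bound_cmd l) (Seq (emit kept_arr kept_degree_arr kept_rank_arr)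
    replace_large)).

Lemma wp_cap_cmd W n k s : regs s 0 = n -> regs s 1 = k -> 0 < W -> n <= W -> k <= W ->
  wp W cap_cmd (fun s' => regs s' 9 = cap n k) s.
Proof.
move=> e0 e1 W0 nW kW; apply/wp_seq/(wp_asg (denotes_reg e1 kW)).
have d1 s' : denotes W s' (Cst 1) 1 by apply: denotes_cst.
have max_le : maxn k 1 <= W by rewrite geq_max kW.
apply/wp_seq/(@wp_weaken _ _ (fun s1 => regs s1 0 = n /\ regs s1 9 = maxn k 1)) => [s1 [e01 e9]|].
  have d9 : denotes W s1 (Reg 9) (maxn k 1) by apply: denotes_reg.
  apply: (wp_if d9 (denotes_reg e01 nW)) => le.
    by apply: wp_skip; rewrite e9 /cap (minn_idPl le).
  by apply: (wp_asg (denotes_reg e01 nW)); rewrite /= upd_same /cap (minn_idPr (ltnW le)).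
apply: (wp_if (d1 _) (denotes_reg (x := 9) _ kW)) => [|le|le]; first exact: upd_same.
  by apply: wp_skip; rewrite /= (maxn_idPl le).
by apply: wp_asg (d1 _) _; rewrite /= (maxn_idPr (ltnW le)).
Qed.

Section Kernelize.
Variables (n l k : nat) (G : sgraph 'I_n) (nb : 'I_n -> seq 'I_n) (W : nat).
Hypothesis nbP : forall v, uniq (nb v) /\ nb v =i G v.
Let N := n + size (pairs nb).
Hypotheses (W_ge : 10 * l * n ^ 2 + 2 * N + 2 * k + 10 * l + 20 <= W) (l_gt1 : 1 < l).

Let K := cap n k.

Lemma card_kernel_cap : yes_instance l G k -> #|kernel l k G| <= 10 * l * K ^ 2.
Proof.
move=> yes; rewrite /K /cap; case: (leqP (maxn k 1) n) => _.
  by apply: leq_trans (card_kernel l_gt1 yes) _; rewrite leq_mul2l leq_exp2r // leq_maxl orbT.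
apply: leq_trans (max_card _) _; rewrite card_ord.
have [n0|n0] := posnP n; first by rewrite [leqLHS]n0.
by rewrite -mulnn mulnA leq_pmull // !muln_gt0 n0 (ltnW l_gt1).
Qed.

Lemma run_size_bound_cmd s : regs s 0 = n -> regs s 1 = k ->
  run W (size_bound_cmd l) s (100 * N.+1) (fun s' => regs s' 11 = 10 * l * K ^ 2).
Proof.
move=> e0 e1; have Kn : K <= n by apply: geq_minr.
have KKl : 10 * l * K ^ 2 = K * (K * (10 * l)) by rewrite -mulnn mulnA mulnC [10 * l * K]mulnC.
have KKW : K * (K * (10 * l)) <= W.
  rewrite -KKl; apply: leq_trans W_ge; rewrite -!addnA; apply: leq_trans (leq_addr _ _).
  by rewrite leq_mul2l leq_exp2r // Kn orbT.
have KW : K * (10 * l) <= W.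
  by apply: leq_trans KKW; case: (K) => // K'; rewrite leq_pmull.
have [nW kW lW] : [/\ n.+2 <= W, k <= W & 10 * l <= W].
  by have := W_ge; rewrite /N; split; lia.
apply: (@run_weaken _ _ _ (cost cap_cmd + (21 * K.+1 + 21 * K.+1))) => [|s' h|].
- by rewrite /= /N; lia.
- exact: h.
have W0 : 0 < W by lia.
apply: run_then (wp_cap_cmd e0 e1 W0 (ltnW (ltnW nW)) kW) _ => s1 e9.
have KltW : K < W by lia.
apply: run_then (run_frame (run_times_reg (e := Cst (10 * l)) e9 KltW KW _ _ _)) _ => //.
  by move=> s' _; apply: denotes_cst.
move=> s2 [e10 fr].
apply: (run_weaken (leqnn _) _ (run_times_reg (e := Reg 10) _ KltW KKW _ _ _)) => //.
- by move=> s' ->.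
- by rewrite (proj1 fr).
by move=> s' fr'; apply: denotes_reg; rewrite ?(proj1 fr').
Qed.

Definition kernel_output s : Prop :=
  exists (n' : nat) (G' : sgraph 'I_n') (k' : nat) (w' : seq nat),
    [/\ output_is s w' /\ encodes G' k' w', k' <= k,
        yes_instance l G k <-> yes_instance l G' k' &
        n' <= 10 * l * maxn k 1 ^ 2].

Lemma wp_replace_large s : output_is s (output_word k G (kernel l k G) (pairs nb)) ->
  regs s 8 = #|kernel l k G| -> regs s 11 = 10 * l * K ^ 2 ->
  wp W replace_large kernel_output s.
Proof.
move=> out e8 e11; have W10 : 10 < W by move: W_ge; lia.
have dsize : denotes W s (Reg 8) #|kernel l k G|.
  apply: denotes_reg e8 _; apply: leq_trans (max_card _) _.
  by rewrite card_ord; move: W_ge; rewrite /N; lia.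
have dbound : denotes W s (Reg 11) (10 * l * K ^ 2).
  apply: denotes_reg e11 (leq_trans _ W_ge); rewrite -!addnA; apply: leq_trans (leq_addr _ _).
  by rewrite leq_mul2l leq_exp2r // geq_minr orbT.
apply: (wp_if dsize dbound) => [le|lt].
  apply: wp_skip; exists #|kernel l k G|, (induced G (kernel l k G)), k.
  exists (output_word k G (kernel l k G) (pairs nb)); split=> //.
  - by split=> //; apply: encodes_induced.
  - exact: kernel_equiv.
  by apply: leq_trans le _; rewrite leq_mul2l leq_exp2r // geq_minl orbT.
have no : ~ yes_instance l G k by move/card_kernel_cap; rewrite leqNgt lt.
apply: (wp_weaken _ (wp_put_word (w := [::]) _ _ _)) => [s' out4|//|/=|/=]; [|by lia|by lia].
exists 4, path4, 0, path4_word; split=> //.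
- by split=> //; apply: path4_encodes.
- by split=> [/no|/path4_no].
apply: (@leq_trans (10 * l * 1)); first by lia.
by rewrite leq_mul2l expn_gt0 leq_max orbT orbT.
Qed.

Lemma run_kernelize :
  run W (kernelize l) (input_state (n :: k :: map (word_item nb) (pairs nb))) (3000 * N.+1)
    kernel_output.
Proof.
have l_gt0 := ltnW l_gt1; have kW : k <= W by move: W_ge; lia.
have N_lt : N.+2 < W by move: W_ge; rewrite /N; lia.
have gt3 := @contents_gt3 n l k G; have bounded := @contents_le n l k G nb W W_ge l_gt0.
apply: (@run_weaken _ _ _ (2500 * N.+1 + (100 * N.+1 + (200 * N.+1 + 50)))) => [|s h|].
- by rewrite /=; lia.
- exact: h.
apply: run_then (run_find_kernel nbP W_ge l_gt0) _ => s [en e8].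
have [[ld _] _] := en.
apply: run_then (run_frame (run_size_bound_cmd (loaded_order ld) (loaded_budget ld))) _.
move=> s1 [e11 fr1].
have en1 : env k nb (contents l k G) 30 s1.
  by apply: (env_extend N_lt gt3 (isT : 3 < 30 <= 30) en fr1) => //; lia.
have e81 : regs s1 8 = #|kernel l k G| by rewrite (proj1 fr1).
have emitted := run_emit N_lt gt3 bounded (sel := kept_arr)
  (degs := kept_degree_arr) (ranks := kept_rank_arr) (isT : 3 < 30) isT isT isT
  (erefl _) (erefl _) (erefl _) kW en1 e81.
apply: run_then (run_frame emitted) _ => s2 [out fr2].
apply: (run_weaken _ (fun _ h => h) (wp_replace_large out _ _)) => //.
- by rewrite (proj1 fr2).
by rewrite (proj1 fr2).
Qed.

End Kernelize.

Theorem theorem8 :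
  exists C c d : nat, forall l : nat, 2 <= l ->
  exists P : cmd,
  forall (n : nat) (G : sgraph 'I_n) (k : nat) (w : seq nat),
  encodes G k w ->
  exists (t : nat) (s : state),
    [/\ exec ((l + n + #|edges G| + k + 2) ^ d) P (input_state w) t s,
        t <= c * (n + #|edges G| + 1) &
        exists (n' : nat) (G' : sgraph 'I_n') (k' : nat) (w' : seq nat),
          [/\ output_is s w' /\ encodes G' k' w',
              k' <= k,
              yes_instance l G k <-> yes_instance l G' k' &
              n' <= C * l * maxn k 1 ^ 2]].
Proof.
exists 10, (2 * 3000), 5 => l l_gt1; exists (kernelize l) => n G k w [nb [nbP ->]].
rewrite (word_pairs nbP); set S := l + n + #|edges G| + k + 2.
have W_ge : 10 * l * n ^ 2 + 2 * (n + size (pairs nb)) + 2 * k + 10 * l + 20 <= S ^ 5.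
  have cube : 4 * 4 * S ^ 3 <= S ^ 5.
    by rewrite (expnD S 2 3) leq_mul2r -mulnn leq_mul ?orbT //; rewrite /S; lia.
  have ln2 : l * n ^ 2 <= S ^ 3 by rewrite expnS leq_mul ?leq_exp2r // /S; lia.
  have linear : 16 * S <= S ^ 3 by rewrite mulnC expnS leq_mul2l -mulnn; rewrite /S; nia.
  rewrite (size_pairs nbP) -mulnA.
  by move: (S ^ 5) (S ^ 3) (l * n ^ 2) cube ln2 linear; rewrite /S; lia.
have [t [s [x le out]]] := run_kernelize nbP W_ge l_gt1; exists t, s; split=> //.
by apply: leq_trans le _; rewrite (size_pairs nbP); lia.
Qed.
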